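(* Let $n\ge 1$ be an integer, $0<\alpha<2$, $0<s<1$, $\omega\ge 0$ and $1<r,q<\infty$. Let $F:\mathbb{R}\to\mathbb{R}$ be locally Lipschitz continuous with $F(0)=0$ and $F'\ge c_0$ for some constant $c_0>0$. Suppose that $u\in C^{1,1}_{loc}(\mathbb{R}^n)\cap\mathcal{L}_\alpha(\mathbb{R}^n)$ is a positive solution of the equation $$\mathcal{F}_\alpha(u(x))+\omega u(x)=C_{n,2s}\left(\int_{\mathbb{R}^n}\frac{u^q(y)}{|x-y|^{n-2s}}\,dy\right)u^r(x),\qquad u(x)>0,\qquad x\in\mathbb{R}^n,$$ and that $$u(x)\sim\frac{1}{|x|^\gamma}\quad\text{for } |x| \text{ sufficiently large},$$ where $\gamma$ satisfies $$\frac{n}{q}>\gamma>\max\left\{\frac{\alpha}{r},\ \frac{2s}{q-1},\ \frac{2s+\alpha}{r-1+q}\right\}.$$ Then $u$ is radially symmetric and monotone decreasing about some point in $\mathbb{R}^n$.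
   Context: The fully nonlinear nonlocal operator $\mathcal{F}_\alpha$ is $$\mathcal{F}_\alpha(u(x))=C_{n,\alpha}\,\mathrm{P.V.}\int_{\mathbb{R}^n}\frac{F(u(x)-u(y))}{|x-y|^{n+\alpha}}dy=C_{n,\alpha}\lim_{\epsilon\to0}\int_{\mathbb{R}^n\setminus B_\epsilon(x)}\frac{F(u(x)-u(y))}{|x-y|^{n+\alpha}}dy,$$ with $C_{n,\alpha}=(2-\alpha)\alpha 2^{\alpha-2}\frac{\Gamma(\frac{n+\alpha}{2})}{\pi^{n/2}\Gamma(\frac{4-\alpha}{2})}$; $C_{n,2s}$ is the same expression with $\alpha$ replaced by $2s$. ($F'$ is understood almost everywhere, $F$ being locally Lipschitz.) $$\mathcal{L}_\alpha(\mathbb{R}^n)=\Big\{u:\ F(u)\in L^1_{loc}(\mathbb{R}^n),\ \int_{\mathbb{R}^n}\frac{|F(1+u(x))|}{1+|x|^{n+\alpha}}dx<\infty\Big\}.$$ $C^{1,1}_{loc}(\mathbb{R}^n)$ is the space of $C^1$ functions with locally Lipschitz gradient; solutions are understood pointwise. The notation $f(x)\sim|x|^{-\gamma}$ for $|x|$ sufficiently large means that there are constants $0<c\le C$ and $R>0$ with $c|x|^{-\gamma}\le f(x)\le C|x|^{-\gamma}$ for all $|x|\ge R$. ''Radially symmetric and monotone decreasing about $x_0$'' means that the function depends only on $|x-x_0|$ and is a decreasing function of $|x-x_0|$. *)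

(* Defs.v *)
From HB Require Import structures.
From mathcomp Require Import all_boot all_order all_algebra.
From mathcomp Require Import all_classical all_reals all_analysis.

Set Implicit Arguments.
Unset Strict Implicit.
Unset Printing Implicit Defensive.
Import Order.TTheory GRing.Theory Num.Theory.
Import numFieldNormedType.Exports.

Local Open Scope classical_set_scope.
Local Open Scope ring_scope.

Definition measure_rV_display : measure_display.
Proof. exact: default_measure_display. Qed.

(* The sigma-algebra generated by the coordinate maps (for R^n, this is the
   Borel sigma-algebra), as the library does for tuples. *)
Section measurable_rV.
Context {R : realType} {n : nat}.

Definition rV_coord (i : 'I_n) (v : 'rV[R]_n) : measurableTypeR R := v ord0 i.

Let rV_set0 : g_sigma_preimage rV_coord set0.
Proof. exact: sigma_algebra0. Qed.

Let rV_setC A : g_sigma_preimage rV_coord A -> g_sigma_preimage rV_coord (~` A).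
Proof. exact: sigma_algebraC. Qed.

Let rV_bigcup (F : _^nat) : (forall i, g_sigma_preimage rV_coord (F i)) ->
  g_sigma_preimage rV_coord (\bigcup_i (F i)).
Proof. exact: sigma_algebra_bigcup. Qed.

HB.instance Definition _ := @isMeasurable.Build measure_rV_display
  'rV[R]_n (g_sigma_preimage rV_coord) rV_set0 rV_setC rV_bigcup.

End measurable_rV.

Lemma measurable_rV_coord {R : realType} n (i : 'I_n) :
  measurable_fun [set: 'rV[R]_n] (rV_coord i).
Proof.
move=> _ Y mY; rewrite setTI; apply: sub_sigma_algebra => /=.
rewrite -bigcup_seq/=; exists i => /=; first by rewrite mem_index_enum.
by exists Y => //; rewrite setTI.
Qed.

Lemma measurable_fun_rV d (T : measurableType d) {R : realType} n
    (f : T -> 'rV[R]_n) :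
  (forall i, measurable_fun [set: T] (rV_coord i \o f)) ->
  measurable_fun [set: T] f.
Proof.
move=> mf _ A mA.
suff : g_sigma_preimage (fun i => rV_coord i \o f) `<=` measurable.
  by apply; rewrite g_sigma_preimage_comp; exists A.
apply: smallest_sub; first exact: sigma_algebra_measurable.
rewrite -bigcup_seq; apply: bigcup_sub => i _.
by move=> _ [B mB <-]; exact: mf.
Qed.

Definition cons_rV {R : realType} n (p : measurableTypeR R * 'rV[R]_n) :
  'rV[R]_n.+1 := row_mx (const_mx p.1 : 'rV_1) p.2.

Lemma measurable_cons_rV {R : realType} n :
  measurable_fun setT (@cons_rV R n).
Proof.
apply: measurable_fun_rV => i; rewrite /comp /rV_coord /cons_rV.
case: (splitP (i : 'I_(1 + n))) => [j ij|j ij].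
  rewrite (_ : (fun _ => _) = fst); first exact: measurable_fst.
  apply/funext => p; rewrite (_ : i = lshift n j); last exact/val_inj.
  by apply: etrans (row_mxEl _ _ _ _) _; rewrite mxE.
rewrite (_ : (fun _ => _) = rV_coord j \o snd).
  apply: measurableT_comp; [exact: measurable_rV_coord|exact: measurable_snd].
apply/funext => p; rewrite (_ : i = rshift 1 j); last exact/val_inj.
exact: etrans (row_mxEr _ _ _ _) _.
Qed.

Definition uncons_rV {R : realType} n (v : 'rV[R]_n.+1) :
  measurableTypeR R * 'rV[R]_n := (v ord0 ord0, \row_i v ord0 (lift ord0 i)).

Lemma cons_rVK {R : realType} n : cancel (@cons_rV R n) (@uncons_rV R n).
Proof.
case=> a v; congr pair => /=.
  rewrite (_ : ord0 = lshift n ord0 :> 'I_(1 + n)); last exact/val_inj.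
  by apply: etrans (row_mxEl _ _ _ _) _; rewrite mxE.
apply/rowP => i; rewrite mxE.
rewrite (_ : lift ord0 i = rshift 1 i :> 'I_(1 + n)); last exact/val_inj.
exact: etrans (row_mxEr _ _ _ _) _.
Qed.

Lemma measurable_uncons_rV {R : realType} n :
  measurable_fun setT (@uncons_rV R n).
Proof.
apply: measurable_fun_pair; first exact: (measurable_rV_coord ord0).
apply: measurable_fun_rV => i.
rewrite (_ : _ \o _ = rV_coord (lift ord0 i)); first exact: measurable_rV_coord.
by apply/funext => v; rewrite /rV_coord /= mxE.
Qed.

Section lebesgue_cons.
Local Open Scope ereal_scope.
Context {R : realType} (n : nat)
  (m : {sigma_finite_measure set 'rV[R]_n -> \bar R}).

Definition lebesgue_cons : set 'rV[R]_n.+1 -> \bar R :=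
  pushforward (lebesgue_measure \x m) (@cons_rV R n).

Let p : {measure set 'rV[R]_n.+1 -> \bar R} :=
  measure_function_pushforward__canonical__measure_function_Measure
    (lebesgue_measure \x m) (@measurable_cons_rV R n).

HB.instance Definition _ := isMeasure.Build _ _ _ lebesgue_cons
  (measure0 p) (measure_ge0 p) (@measure_semi_sigma_additive _ _ _ p).

Let lebesgue_cons_sigma_finite : sigma_finite setT lebesgue_cons.
Proof.
have /sigma_finiteP[F [TF ndF Foo]] := sigma_finiteT (@lebesgue_measure R).
have /sigma_finiteP[G [TG ndG Goo]] := sigma_finiteT m.
exists (fun i => @uncons_rV R n @^-1` (F i `*` G i)).
  rewrite -preimage_bigcup (_ : \bigcup_i _ = setT) ?preimage_setT//.
  rewrite -setXTT TF TG predeqE => -[x y]; split.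
    by move=> [i _ []/= ? ?]; split; exists i.
  move=> [/= [i _ Fix] [k _ Gky]]; exists (maxn i k) => //; split.
  - by move: x Fix; exact/subsetPset/ndF/leq_maxl.
  - by move: y Gky; exact/subsetPset/ndG/leq_maxr.
move=> i; have [mF Fi] := Foo i; have [mG Gi] := Goo i; split.
  rewrite -[X in measurable X]setTI.
  by apply: measurable_uncons_rV => //; exact: measurableX.
rewrite /lebesgue_cons /pushforward -comp_preimage.
rewrite (_ : _ \o _ = id) ?preimage_id; last first.
  by apply/funext => x; exact: cons_rVK.
by rewrite product_measure1E// lte_mul_pinfty// ge0_fin_numE.
Qed.

HB.instance Definition _ := Measure_isSigmaFinite.Build _ _ _
  lebesgue_cons lebesgue_cons_sigma_finite.

End lebesgue_cons.

Fixpoint lebesgue_rV {R : realType} n :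
    {sigma_finite_measure set 'rV[R]_n -> \bar R} :=
  match n with
  | 0 => \d_(0 : 'rV[R]_0)
  | m.+1 => lebesgue_cons (lebesgue_rV m)
  end.

Section nonlocal_equation.
Context {R : realType}.

Definition Gamma (z : R) : R :=
  \int[lebesgue_measure]_(t in `]0, +oo[) (t `^ (z - 1) * expR (- t)).

(* The library's norm on 'rV[R]_n is the sup norm. *)
Definition enorm n (x : 'rV[R]_n) : R := Num.sqrt (\sum_i x ord0 i ^+ 2).

Definition eball n (x : 'rV[R]_n) (eps : R) : set 'rV[R]_n :=
  [set y | enorm (x - y) < eps].

Definition fracC n (alpha : R) : R :=
  (2 - alpha) * alpha * 2 `^ (alpha - 2) * Gamma ((n%:R + alpha) / 2) /
  (pi `^ (n%:R / 2) * Gamma ((4 - alpha) / 2)).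

Definition fracF_trunc n alpha (F : R -> R) (u : 'rV[R]_n -> R) x eps : \bar R :=
  ((fracC n alpha)%:E *
   \int[lebesgue_rV n]_(y in ~` eball x eps)
     (F (u x - u y) / enorm (x - y) `^ (n%:R + alpha))%:E)%E.

(* The principal value F_alpha(u(x)) exists in R and equals l. The truncated
   integrals live in \bar R, and an integral that is not absolutely convergent
   is infinite there, so that a finite limit forces convergence for small eps. *)
Definition is_fracF n alpha F (u : 'rV[R]_n -> R) x (l : R) : Prop :=
  fracF_trunc alpha F u x eps @[eps --> 0^'+] --> l%:E.

Definition riesz_potential n s q (u : 'rV[R]_n -> R) x : \bar R :=
  (\int[lebesgue_rV n]_y (u y `^ q / enorm (x - y) `^ (n%:R - 2 * s))%:E)%E.

(* Equality in \bar R with a real left-hand side: it includes the finiteness of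
   the Riesz potential, as u > 0. *)
Definition positive_solution n alpha s omega r q F (u : 'rV[R]_n -> R) : Prop :=
  forall x, 0 < u x /\
    exists l : R, is_fracF alpha F u x l /\
      ((l + omega * u x)%:E =
       (fracC n (2 * s))%:E * riesz_potential s q u x * (u x `^ r)%:E)%E.

Definition calL n alpha (F : R -> R) (u : 'rV[R]_n -> R) : Prop :=
  (forall K, compact K ->
    (lebesgue_rV n).-integrable K (fun x => (F (u x))%:E)) /\
  (\int[lebesgue_rV n]_x
     (`|F (1 + u x)| / (1 + enorm x `^ (n%:R + alpha)))%:E < +oo)%E.

Definition gradient n (u : 'rV[R]_n -> R) (x : 'rV[R]_n) : 'rV[R]_n :=
  \row_i 'D_(delta_mx ord0 i) u x.

Definition locally_lipschitz (V W : normedModType R) (f : V -> W) : Prop :=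
  [locally [lipschitz f x | x in [set: V]]].

Definition C11_loc n (u : 'rV[R]_n -> R) : Prop :=
  [/\ forall x, differentiable u x, continuous (gradient u) &
      locally_lipschitz (gradient u)].

Definition sim_at_infinity n (f : 'rV[R]_n -> R) (gamma : R) : Prop :=
  exists c C R0 : R, [/\ 0 < c, c <= C, 0 < R0 &
    forall x, R0 <= enorm x ->
      c * enorm x `^ (- gamma) <= f x <= C * enorm x `^ (- gamma)].

Definition radially_decreasing n (u : 'rV[R]_n -> R) (x0 : 'rV[R]_n) : Prop :=
  exists phi : R -> R, (forall x, u x = phi (enorm (x - x0))) /\
    (forall t1 t2, 0 <= t1 -> t1 < t2 -> phi t2 < phi t1).

End nonlocal_equation.

(* Main.v *)
Require Import Defs.
From mathcomp Require Import all_boot all_order all_algebra.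
From mathcomp Require Import all_classical all_reals all_analysis.
From mathcomp Require Import measurable_realfun lra ring.

Set Implicit Arguments.
Unset Strict Implicit.
Unset Printing Implicit Defensive.
Import Order.TTheory GRing.Theory Num.Theory.
Import numFieldNormedType.Exports.

Local Open Scope classical_set_scope.
Local Open Scope ring_scope.

(** Direct moving planes.  For a unit vector [e] let [T] be the reflection in
the hyperplane [dot x e = l] and [w = u \o T - u] on the half space
[dot x e < l].  Suppose that [w] has a negative minimum at a point [x0] at
distance [d] from the hyperplane.  Folding the singular integrals along the
hyperplane and using that the slopes of [F] are at least [c0] gives
[F_alpha u (T x0) - F_alpha u x0 <= - c |w x0| d^-alpha].  On the other hand,
folding the potential, the decay of [u] and the lower bounds on [gamma] give
for the right-hand side of the equation a difference of at least
[- C |w x0| (1 + |x0|)^(-alpha - delta)] with some [delta > 0].  Hence [d] is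
bounded below, [x0] is bounded, and there is no negative minimum for [l] very
negative.  So [w >= 0] for small [l], and this persists up to a last position
of the plane; the same comparison at a zero of [w] is a strong maximum
principle, which forces symmetry at that position.  A maximum point of [u] lies
on each of these hyperplanes, so they meet in it. *)

(** [F] need not be odd and is not linearised. At a pair of mirror points the four values of [F] are
    regrouped so that each difference has ordered arguments, and the slope bound applies to it
    directly; the kernel, larger on the side of [x0], supplies nonnegative weights. On the
    right-hand side convexity of the powers plays this role: tangents are taken at the larger value,
    so every factor that has to decay is evaluated at [x0] and never at its mirror image. The number
    [delta = (q + r - 1) gamma - 2 s - alpha] is the margin in the last lower bound on [gamma]. The
    comparison yields [c (1 + |x0|)^(alpha + delta) <= d^alpha] with [c] independent of the plane,
    while [d <= L + |x0|] whenever [l <= L]; the surplus power [delta] is what bounds [x0]. The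
    conditions [2 s < (q - 1) gamma] and [q gamma < n] put both potentials in the range where the
    Riesz potential of [(1 + |x|)^(-b)] decays like [(1 + |x|)^(2 s - b)]. *)

(** * Open sets and boxes in R^n *)

Definition box n (R : realType) (a : 'rV[R]_n) (rho : R) : set 'rV[R]_n :=
  [set y | forall i, `|y ord0 i - a ord0 i| < rho].

Lemma measurable_box n (R : realType) (a : 'rV[R]_n) rho : measurable (box a rho).
Proof.
have -> : box a rho = \bigcap_(i in [set: 'I_n])
    (@rV_coord R n i @^-1` [set t | `|t - a ord0 i| < rho]).
  by apply/seteqP; split => [y h i _|y h i]; [exact: h|exact: h].
apply: fin_bigcap_measurable => // i _.
rewrite -[X in measurable X]setTI.
apply: measurable_rV_coord => //.
apply: open_measurable.
rewrite (_ : [set t | _] = ball (a ord0 i) rho); first exact: ball_open.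
by apply/seteqP; split=> t; rewrite /ball /= distrC.
Qed.

(** The sigma-algebra is generated by coordinates, so an open set must be exhausted by countably
    many boxes; those with rational centre and radius [1 / (k + 1)] contained in [U] suffice. *)
Lemma open_measurable_rV n (R : realType) (U : set 'rV[R]_n) :
  open U -> measurable U.
Proof.
move=> oU.
pose c (p : 'rV[rat]_n * nat) : 'rV[R]_n := \row_i ratr (p.1 ord0 i).
have -> : U = \bigcup_p (if asbool (box (c p) (p.2.+1%:R^-1) `<=` U)
                         then box (c p) (p.2.+1%:R^-1) else set0).
  apply/seteqP; split => [x Ux|x [p _]]; last by case: asboolP => // + xb; exact.
  have := open_nbhs_nbhs (conj oU Ux) => /nbhs_ballP[e /= e0 eU].
  have [k ke] : exists k : nat, k.+1%:R^-1 < e / 2.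
    have [k _ /(_ k (leqnn _))] := near_infty_natSinv_lt (PosNum (divr_gt0 e0 (@ltr0n R 2))).
    by exists k.
  have k0 : (0 : R) < k.+1%:R^-1 by [].
  have hx i : exists z : rat, `|x ord0 i - ratr z| < k.+1%:R^-1.
    have /(@rat_in_itvoo R) [z] : x ord0 i - k.+1%:R^-1 < x ord0 i + k.+1%:R^-1.
      by rewrite ltrBlDr -addrA ltrDl; exact: addr_gt0.
    by rewrite in_itv /= -ltr_distlC => zh; exists z.
  have [z zh] := choice hx.
  exists (\row_i z i, k) => //.
  case: asboolP => [_|].
    by move=> i; rewrite /c /= !mxE; exact: zh.
  case=> y yb; apply: eU; split => // i j; rewrite (ord1 i) /ball /=.
  have := yb j; have := zh j; rewrite !mxE /= => h1 h2.
  rewrite (splitr e) (le_lt_trans (ler_distD (ratr (z j)) _ _))// ltrD//.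
    exact: lt_trans ke.
  by rewrite distrC; exact: lt_trans ke.
apply: countable_bigcupT_measurable => // p.
by case: asboolP => _; [exact: measurable_box|exact: measurable0].
Qed.

Lemma continuous_measurable_rV n (R : realType) (f : 'rV[R]_n -> R) :
  continuous f -> measurable_fun setT f.
Proof.
move=> cf; apply: (measurability _ (RGenOpens.measurableE R)).
  move=> _ [_ [a [b ->] <-]]; rewrite setTI; apply: open_measurable_rV.
by move/continuousP : cf; apply; exact: interval_open.
Qed.

Lemma cons_rV_ord0 (R : realType) n (p : measurableTypeR R * 'rV[R]_n) :
  cons_rV p ord0 ord0 = p.1.
Proof. by have /(congr1 fst) := cons_rVK p. Qed.

Lemma cons_rV_lift (R : realType) n (p : measurableTypeR R * 'rV[R]_n) i :
  cons_rV p ord0 (lift ord0 i) = p.2 ord0 i.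
Proof. by have /(congr1 snd)/rowP/(_ i) := cons_rVK p; rewrite !mxE. Qed.

Lemma lebesgue_rV_box (R : realType) n (a : 'rV[R]_n) rho : 0 < rho ->
  lebesgue_rV n (box a rho) = ((rho *+ 2) ^+ n)%:E.
Proof.
move=> rho0; elim: n a => [|n IH] a.
  rewrite (_ : box a rho = setT); last by apply/seteqP; split=> // y _ [].
  by rewrite /= diracT.
pose a' : 'rV[R]_n := \row_i a ord0 (lift ord0 i).
rewrite -[LHS]/((lebesgue_measure \x lebesgue_rV n)%E (@cons_rV R n @^-1` box a rho)).
have -> : @cons_rV R n @^-1` box a rho = ball (a ord0 ord0) rho `*` box a' rho.
  apply/seteqP; split => [[t w] h|[t w] [/= h1 h2] i].
    split => /=; first by have := h ord0; rewrite cons_rV_ord0 /= /ball /= distrC.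
    by move=> i; have := h (lift ord0 i); rewrite cons_rV_lift mxE.
  case: (unliftP ord0 i) => [j ->|->].
    by rewrite cons_rV_lift; have := h2 j; rewrite mxE.
  by rewrite cons_rV_ord0 /= distrC.
rewrite product_measure1E; [|exact: open_measurable (ball_open _ _)|exact: measurable_box].
rewrite IH exprS EFinM; congr (_ * _)%E.
exact: lebesgue_measure_ball (ltW rho0).
Qed.

(** * Measure-preserving maps and translations *)

Section measure_preserving.
Context d (T : measurableType d) (R : realType) (mu : {measure set T -> \bar R}).
Variables (phi : T -> T) (mphi : measurable_fun setT phi).
Hypothesis phi_mu : forall A, measurable A -> mu (phi @^-1` A) = mu A.

Let ge0_integral_preserved (f : T -> \bar R) : measurable_fun setT f ->
  (forall x, 0 <= f x)%E -> (\int[mu]_x f (phi x) = \int[mu]_x f x)%E.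
Proof.
move=> mf f0; transitivity (\int[pushforward mu phi]_x f x)%E.
  by rewrite (ge0_integral_pushforward mphi).
by apply: eq_measure_integral => A mA _; exact: phi_mu.
Qed.

(** Measurability is enough: the positive and negative parts are transported separately, whether or
    not their integrals are finite. *)
Lemma integral_preserved (f : T -> \bar R) : measurable_fun setT f ->
  (\int[mu]_x f (phi x) = \int[mu]_x f x)%E.
Proof.
move=> mf; rewrite integralE [RHS]integralE.
have -> : ((fun x => f (phi x))^\+ = f^\+ \o phi)%E by apply/funext => x; rewrite /= !funeposE.
have -> : ((fun x => f (phi x))^\- = f^\- \o phi)%E by apply/funext => x; rewrite /= !funenegE.
rewrite !ge0_integral_preserved//.
exact: measurable_funeneg.
exact: measurable_funepos.
Qed.

End measure_preserving.

Lemma measurable_shift_rV (R : realType) n (a : 'rV[R]_n) :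
  measurable_fun setT (fun x : 'rV[R]_n => x + a).
Proof.
apply: measurable_fun_rV => i.
have -> : rV_coord i \o (fun x : 'rV[R]_n => x + a) =
   (fun x => rV_coord i x + a ord0 i) by apply/funext => x; rewrite /rV_coord /= mxE.
by apply: measurable_funD => //; exact: measurable_rV_coord.
Qed.

(** The image measure agrees with Lebesgue measure on half-open intervals, which determine it. *)
Lemma lebesgue_measure_shift (R : realType) (a : R) (A : set R) : measurable A ->
  lebesgue_measure ((+%R^~ a) @^-1` A) = lebesgue_measure A.
Proof.
move=> mA.
have mp : measurable_fun setT ((+%R^~ a) : measurableTypeR R -> measurableTypeR R).
  by apply: measurable_funD.
pose p : {measure set (measurableTypeR R) -> \bar R} :=
  measure_function_pushforward__canonical__measure_function_Measure
    (@lebesgue_measure R) mp.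
rewrite -[LHS]/(p A); apply/esym; apply: lebesgue_measure_unique => //.
move=> _ [[x y] _ <-].
rewrite -[RHS]/(lebesgue_measure ((+%R^~ a) @^-1` `]x, y])).
have -> : (+%R^~ a) @^-1` `]x, y]%classic = `]x - a, y - a]%classic.
  by apply/seteqP; split => t /=; rewrite !in_itv /= ltrBlDr lerBrDr.
by rewrite !lebesgue_measure_itv /= !lte_fin ltrD2r -!EFinB opprB addrA subrK.
Qed.

(** By slicing along the first coordinate: the outer integral is invariant under the shift of that
    coordinate, and each slice under the remaining shift by induction. *)
Lemma lebesgue_rV_shift (R : realType) n (a : 'rV[R]_n) (A : set 'rV[R]_n) :
  measurable A ->
  lebesgue_rV n ((+%R^~ a) @^-1` A) = lebesgue_rV n A.
Proof.
elim: n a A => [|n IH] a A mA.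
  have -> : (+%R^~ a) @^-1` A = A.
    by rewrite (_ : +%R^~ a = id) ?preimage_id//; apply/funext=> x; rewrite !thinmx0.
  by [].
pose a' : 'rV[R]_n := \row_i a ord0 (lift ord0 i).
rewrite -[LHS]/((lebesgue_measure \x lebesgue_rV n)%E
  (@cons_rV R n @^-1` ((+%R^~ a) @^-1` A))).
rewrite -[RHS]/((lebesgue_measure \x lebesgue_rV n)%E (@cons_rV R n @^-1` A)).
set B := @cons_rV R n @^-1` A.
have mB : measurable B by rewrite -[B]setTI; exact: measurable_cons_rV.
rewrite /product_measure1 /=.
pose f t := lebesgue_rV n (xsection B t).
have mf : measurable_fun setT f by exact: measurable_fun_xsection.
rewrite -(@integral_preserved _ _ R lebesgue_measure (+%R^~ (a ord0 ord0)) _ _ f) //; first last.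
- exact: lebesgue_measure_shift.
- by apply: measurable_funD.
apply: eq_integral => t _ /=; rewrite /f -[RHS](IH a'); last exact: measurable_xsection.
have E w : cons_rV (t + a ord0 ord0, w + a') = cons_rV (t, w) + a.
  apply/rowP => i; rewrite [RHS]mxE; case: (unliftP ord0 i) => [j ->|->].
    by rewrite !cons_rV_lift /= !mxE.
  by rewrite !cons_rV_ord0.
congr (lebesgue_rV n _); apply/seteqP.
by split => w /=; rewrite /xsection /= !inE /B /= E.
Qed.

(** * Euclidean inner product and norm *)

Definition dot (R : realType) n (x y : 'rV[R]_n) : R := \sum_i x ord0 i * y ord0 i.

Section dot_lemmas.
Context (R : realType) (n : nat).
Implicit Types x y z : 'rV[R]_n.

Lemma dotC x y : dot x y = dot y x.
Proof. by apply: eq_bigr => i _; rewrite mulrC. Qed.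

Lemma dotDl x y z : dot (x + y) z = dot x z + dot y z.
Proof. by rewrite -big_split; apply: eq_bigr => i _; rewrite mxE mulrDl. Qed.

Lemma dotZl a x z : dot (a *: x) z = a * dot x z.
Proof. by rewrite mulr_sumr; apply: eq_bigr => i _; rewrite mxE mulrA. Qed.

Lemma dotNl x z : dot (- x) z = - dot x z.
Proof. by rewrite -scaleN1r dotZl mulN1r. Qed.

Lemma dotBl x y z : dot (x - y) z = dot x z - dot y z.
Proof. by rewrite dotDl dotNl. Qed.

Lemma dotDr x y z : dot x (y + z) = dot x y + dot x z.
Proof. by rewrite dotC dotDl !(dotC x). Qed.

Lemma dotZr a x y : dot x (a *: y) = a * dot x y.
Proof. by rewrite dotC dotZl (dotC x). Qed.

Lemma dotBr x y z : dot x (y - z) = dot x y - dot x z.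
Proof. by rewrite dotC dotBl !(dotC x). Qed.

Lemma dot_delta i : dot (delta_mx ord0 i : 'rV[R]_n) (delta_mx ord0 i) = 1.
Proof.
rewrite /dot (bigD1 i)//= big1 ?addr0 ?mxE ?eqxx ?mulr1// => j ji.
by rewrite !mxE /= (negbTE ji) mulr0.
Qed.

Lemma dot_ge0 x : 0 <= dot x x.
Proof. by apply: sumr_ge0 => i _; rewrite -expr2 sqr_ge0. Qed.

Lemma enormE x : enorm x = Num.sqrt (dot x x).
Proof. by congr Num.sqrt; apply: eq_bigr => i _; rewrite expr2. Qed.

Lemma enorm_sqr x : enorm x ^+ 2 = dot x x.
Proof. by rewrite enormE sqr_sqrtr // dot_ge0. Qed.

Lemma enorm_ge0 x : 0 <= enorm x.
Proof. exact: sqrtr_ge0. Qed.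

Lemma enorm0 : enorm (0 : 'rV[R]_n) = 0.
Proof. by rewrite enormE -(scale0r 0) dotZl mul0r sqrtr0. Qed.

Lemma enormZ a x : enorm (a *: x) = `|a| * enorm x.
Proof.
by rewrite !enormE dotZl dotZr mulrA -expr2 sqrtrM ?sqr_ge0// sqrtr_sqr.
Qed.

Lemma enormN x : enorm (- x) = enorm x.
Proof. by rewrite -scaleN1r enormZ normrN1 mul1r. Qed.

Lemma enormB x y : enorm (x - y) = enorm (y - x).
Proof. by rewrite -enormN opprB. Qed.

Lemma coord_le_enorm x i : `|x ord0 i| <= enorm x.
Proof.
rewrite -sqrtr_sqr ler_wsqrtr// (bigD1 i)//= lerDl.
by apply: sumr_ge0 => j _; rewrite sqr_ge0.
Qed.

Lemma enorm_eq0 x : enorm x = 0 -> x = 0.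
Proof.
move=> h; apply/rowP => i; rewrite mxE; apply/eqP.
by rewrite -normr_le0 -h coord_le_enorm.
Qed.

(** The square of the norm of [|y| x - |x| y] equals [2 |x| |y| (|x| |y| - dot x y)]. *)
Lemma cauchy_schwarz x y : dot x y <= enorm x * enorm y.
Proof.
have [->|x0] := eqVneq x 0.
  by rewrite enorm0 mul0r -(scale0r 0) dotZl mul0r.
have [->|y0] := eqVneq y 0.
  by rewrite enorm0 mulr0 -(scale0r 0) dotZr mul0r.
have pos z : z != 0 -> 0 < enorm z.
  by move=> z0; rewrite lt_def enorm_ge0 andbT; apply: contra_neq z0; exact: enorm_eq0.
have := dot_ge0 (enorm y *: x - enorm x *: y).
rewrite dotBl !dotBr !dotZl !dotZr -!enorm_sqr (dotC y x).
have := pos _ x0; have := pos _ y0.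
set a := enorm x; set b := enorm y; set c := dot x y => b0 a0 h.
have : 0 <= 2 * (a * b) * (a * b - c) by apply: le_trans h _; rewrite le_eqVlt; apply/orP; left; apply/eqP; ring.
by rewrite pmulr_rge0 ?subr_ge0// !mulr_gt0.
Qed.

Lemma enormD x y : enorm (x + y) <= enorm x + enorm y.
Proof.
rewrite -(ler_pXn2r (n := 2))// ?nnegrE ?addr_ge0 ?enorm_ge0//.
rewrite sqrrD !enorm_sqr dotDl !dotDr (dotC y x).
have := cauchy_schwarz x y; lra.
Qed.

Lemma enorm_triangle x y z : enorm (x - z) <= enorm (x - y) + enorm (y - z).
Proof. by rewrite -(subrKA y) enormD. Qed.

(** The crude factor [n], instead of its square root, only affects constants in volume bounds. *)
Lemma enorm_le_sup x rho : (forall i, `|x ord0 i| <= rho) -> 0 <= rho ->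
  enorm x <= n%:R * rho.
Proof.
move=> h rho0.
have h1 : enorm x ^+ 2 <= n%:R * rho ^+ 2.
  rewrite enorm_sqr mulr_natl -[in leRHS](card_ord n) -sumr_const.
  apply: ler_sum => i _; rewrite -expr2 -(real_normK (num_real _)).
  by rewrite ler_pXn2r ?nnegrE.
rewrite -(ler_pXn2r (n := 2))// ?nnegrE ?enorm_ge0// ?mulr_ge0//.
apply: le_trans h1 _; rewrite exprMn ler_wpM2r ?sqr_ge0//.
by rewrite -natrX ler_nat; case: n => // m; exact: (leq_pmulr m.+1).
Qed.

Lemma mx_norm_le_enorm x : `|x| <= enorm x.
Proof.
rewrite /Num.norm /= mx_normrE; apply: bigmax_le; first exact: enorm_ge0.
by move=> [i j] _ /=; rewrite (ord1 i) coord_le_enorm.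
Qed.

Lemma continuous_coord (i : 'I_n) : continuous (fun x : 'rV[R]_n => x ord0 i).
Proof. exact: coord_continuous. Qed.

Lemma continuous_sum (T : topologicalType) m (f : 'I_m -> T -> R) :
  (forall i, continuous (f i)) -> continuous (fun t : T => \sum_i f i t).
Proof.
move=> cf; elim: m f cf => [|m IH] f cf t.
  by rewrite (_ : (fun _ => _) = (fun=> 0)); [exact: cst_continuous|apply/funext => ?; rewrite big_ord0].
rewrite (_ : (fun _ => _) = (fun y : T => f ord0 y + \sum_i f (lift ord0 i) y)).
  by apply: continuousD; [exact: cf|apply: IH => i; exact: cf].
by apply/funext => ?; rewrite big_ord_recl.
Qed.

Lemma continuous_dotl y : continuous (fun x => dot x y).
Proof.
apply: continuous_sum => i x; apply: continuousM; last exact: cst_continuous.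
exact: continuous_coord.
Qed.

Lemma continuous_enorm : continuous (@enorm R n).
Proof.
move=> x; rewrite /enorm.
apply: (continuous_comp (f := fun x : 'rV[R]_n => \sum_i x ord0 i ^+ 2) (g := Num.sqrt)).
  apply: continuous_sum => i {}x.
  apply: (continuous_comp (f := fun x : 'rV[R]_n => x ord0 i) (g := fun t => t ^+ 2)).
    exact: continuous_coord.
  exact: exprn_continuous.
exact: sqrt_continuous.
Qed.

Lemma continuous_enormB z : continuous (fun x : 'rV[R]_n => enorm (z - x)).
Proof.
move=> x; apply: (continuous_comp (f := fun x : 'rV[R]_n => z - x) (g := @enorm R n)).
  by apply: continuousB; [exact: cst_continuous|].
exact: continuous_enorm.
Qed.

End dot_lemmas.

(** * Reflections in hyperplanes *)

Section reflection.
Context (R : realType) (n : nat) (e : 'rV[R]_n) (l : R).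
Hypothesis e1 : dot e e = 1.
Implicit Types x y : 'rV[R]_n.

(** The linear part of [refl]; invariance of the measure is proved for it and then combined with a
    translation. *)
Definition refl0 x := x - (2 * dot x e) *: e.
Definition refl x := x - (2 * (dot x e - l)) *: e.

Lemma reflE x : refl x = refl0 x + (2 * l) *: e.
Proof. by rewrite /refl /refl0 mulrBr scalerBl opprB addrA addrAC. Qed.

Lemma refl_subE x : refl x - x = (2 * (l - dot x e)) *: e.
Proof. by apply/rowP => i; rewrite !mxE; ring. Qed.

Lemma refl_id x : dot x e = l -> refl x = x.
Proof. by move=> xl; rewrite /refl xl subrr mulr0 scale0r subr0. Qed.

Lemma refl0K : involutive refl0.
Proof.
by move=> x; rewrite /refl0 dotBl dotZl e1; apply/rowP => i; rewrite !mxE; ring.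
Qed.

Lemma refl0B x y : refl0 (x - y) = refl0 x - refl0 y.
Proof.
by rewrite /refl0 dotBl; apply/rowP => i; rewrite !mxE; ring.
Qed.

Lemma enorm_refl0 x : enorm (refl0 x) = enorm x.
Proof.
rewrite !enormE; congr Num.sqrt.
by rewrite /refl0 dotBl !dotBr !dotZl !dotZr e1 (dotC e x); ring.
Qed.

Lemma dot_refl x : dot (refl x) e = 2 * l - dot x e.
Proof. by rewrite /refl dotBl dotZl e1; ring. Qed.

Lemma reflK : involutive refl.
Proof.
by move=> x; rewrite {1}/refl dot_refl; apply/rowP => i; rewrite !mxE; ring.
Qed.

Lemma reflB x y : refl x - refl y = refl0 (x - y).
Proof. by rewrite !reflE refl0B; apply/rowP => i; rewrite !mxE; ring. Qed.

Lemma enorm_reflB x y : enorm (refl x - refl y) = enorm (x - y).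
Proof. by rewrite reflB enorm_refl0. Qed.

Lemma enorm_refl_swap x y : enorm (refl x - y) = enorm (x - refl y).
Proof. by rewrite -{1}(reflK y) enorm_reflB. Qed.

(* The squared distances differ by four times the product of the signed
   distances of [x] and [y] to the hyperplane. *)
Lemma enorm_refl_sqr x y :
  enorm (x - refl y) ^+ 2 = enorm (x - y) ^+ 2 + 4 * (l - dot x e) * (l - dot y e).
Proof.
rewrite !enorm_sqr /refl opprB addrA addrAC.
rewrite (_ : dot x e = dot (x - y) e + dot y e); last by rewrite dotBl subrK.
move: (x - y) => z; rewrite dotDl !dotDr !dotZl !dotZr e1 (dotC e z).
by ring.
Qed.

Lemma enorm_refl_le x y : dot x e <= l -> dot y e <= l ->
  enorm (x - y) <= enorm (x - refl y).
Proof.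
move=> hx hy; rewrite -(ler_pXn2r (n := 2))// ?nnegrE ?enorm_ge0//.
by rewrite enorm_refl_sqr lerDl !mulr_ge0// subr_ge0.
Qed.

Lemma refl_dist x y : dot x e <= l -> l <= dot y e -> l - dot x e <= enorm (x - y).
Proof.
move=> hx hy; apply: (@le_trans _ _ (dot (y - x) e)); first by rewrite dotBl lerB.
apply: le_trans (cauchy_schwarz _ _) _.
by rewrite [enorm e]enormE e1 sqrtr1 mulr1 enormB.
Qed.

Lemma continuous_refl : continuous refl.
Proof.
move=> x.
apply: (@continuousB _ _ _ (fun x : 'rV[R]_n => x) (fun x => (2 * (dot x e - l)) *: e)).
  by [].
apply: continuousZl; apply: continuousM; first exact: cst_continuous.
by apply: continuousB; [exact: continuous_dotl|exact: cst_continuous].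
Qed.

End reflection.

(** Joint continuity in the position of the plane and the point lets inequalities survive a small
    move of the plane. *)
Lemma continuous_refl_pair (R : realType) n (e : 'rV[R]_n) :
  continuous (fun p : R * 'rV[R]_n => refl e p.1 p.2).
Proof.
move=> [l x]; rewrite /refl.
apply: (@continuousB _ _ _ (fun p : R * 'rV[R]_n => p.2)
  (fun p => (2 * (dot p.2 e - p.1)) *: e)); first exact: cvg_snd.
apply: continuousZl; apply: continuousM; first exact: cst_continuous.
apply: continuousB; last exact: cvg_fst.
apply: (continuous_comp (f := snd) (g := fun x => dot x e)); first exact: cvg_snd.
exact: continuous_dotl.
Qed.

(** * Invariance of Lebesgue measure under reflections *)

Lemma measurable_indic_comp d d' (T : measurableType d) (T' : measurableType d')
    (R : realType) (C : set T') (g : T -> T') :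
  measurable C -> measurable_fun setT g ->
  measurable_fun setT (fun x => \1_C (g x) : R).
Proof.
by move=> mC mg; apply: (measurableT_comp (f := (\1_C : T' -> R))).
Qed.

Lemma integral_indicT d (T : measurableType d) (R : realType)
    (mu : {measure set T -> \bar R}) (A : set T) :
  measurable A -> (\int[mu]_x (\1_A x)%:E = mu A)%E.
Proof. by move=> mA; rewrite integral_indic// setIT. Qed.

Section lebesgue_isometry.
Context (R : realType) (n : nat).
Notation mu := (@lebesgue_rV R n).

Lemma measurable_enorm : measurable_fun setT (@enorm R n).
Proof. exact: continuous_measurable_rV (@continuous_enorm R n). Qed.

Lemma measurable_eball (x : 'rV[R]_n) rho : measurable (eball x rho).
Proof.
apply: open_measurable_rV.
rewrite (_ : eball x rho = (fun y => enorm (x - y)) @^-1` [set t | t < rho]) //.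
by apply: open_comp; [move=> y _; exact: continuous_enormB|exact: open_lt].
Qed.

Lemma eball_shift (x : 'rV[R]_n) rho : eball x rho = (+%R^~ (- x)) @^-1` eball 0 rho.
Proof. by apply/seteqP; split => y; rewrite /eball /= sub0r opprB. Qed.

Lemma lebesgue_eball_center (x : 'rV[R]_n) rho : mu (eball x rho) = mu (eball 0 rho).
Proof. by rewrite eball_shift; apply: lebesgue_rV_shift; exact: measurable_eball. Qed.

Lemma lebesgue_eball_le (x : 'rV[R]_n) rho : 0 < rho ->
  (mu (eball x rho) <= ((rho *+ 2) ^+ n)%:E)%E.
Proof.
move=> rho0; rewrite -(lebesgue_rV_box x rho0).
apply: le_measure; rewrite ?inE; [exact: measurable_eball|exact: measurable_box|].
move=> y /= h i; apply: le_lt_trans h; rewrite enormB.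
by have := coord_le_enorm (y - x) i; rewrite !mxE.
Qed.

(** From an inscribed cube. Dividing by [n + 1] rather than [n] makes the inclusion in the open ball
    strict and avoids a division by zero for [n = 0]. *)
Lemma lebesgue_eball_ge (x : 'rV[R]_n) rho : 0 < rho ->
  ((((rho / (n.+1)%:R) *+ 2) ^+ n)%:E <= mu (eball x rho))%E.
Proof.
move=> rho0; have r0 : 0 < rho / (n.+1)%:R by rewrite divr_gt0.
rewrite -(lebesgue_rV_box x r0).
apply: le_measure; rewrite ?inE; [exact: measurable_box|exact: measurable_eball|].
move=> y /= h; rewrite /eball /= enormB.
apply: (@le_lt_trans _ _ (n%:R * (rho / n.+1%:R))).
  apply: enorm_le_sup; last exact: ltW.
  by move=> i; rewrite !mxE; exact/ltW/h.
by rewrite mulrCA gtr_pMr// ltr_pdivrMr// mul1r ltr_nat.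
Qed.

Lemma lebesgue_eball_gt0 (x : 'rV[R]_n) rho : 0 < rho -> (0 < mu (eball x rho))%E.
Proof.
move=> rho0; apply: lt_le_trans (lebesgue_eball_ge x rho0).
by rewrite lte_fin exprn_gt0// pmulrn_rgt0// divr_gt0.
Qed.

Lemma lebesgue_eball_fin (x : 'rV[R]_n) rho : 0 < rho -> mu (eball x rho) \is a fin_num.
Proof.
move=> rho0; rewrite ge0_fin_numE//.
by apply: le_lt_trans (lebesgue_eball_le x rho0) _; rewrite ltry.
Qed.

Lemma integral_shift_rV (a : 'rV[R]_n) (f : 'rV[R]_n -> \bar R) :
  measurable_fun setT f -> (\int[mu]_x f (x + a)%R = \int[mu]_x f x)%E.
Proof.
apply: (@integral_preserved _ _ R mu (+%R^~ a)).
  exact: measurable_shift_rV.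
by move=> A mA; exact: lebesgue_rV_shift.
Qed.

(* Uniqueness of Haar measure: for an involutive linear isometry [T] and the
   unit ball [B], integrate [1_B y * 1_A (T x + y)] in both orders. *)
Lemma lebesgue_isometry (T : 'rV[R]_n -> 'rV[R]_n) (A : set 'rV[R]_n) :
  continuous T -> involutive T -> {morph T : x y / x - y} ->
  (forall x, enorm (T x) = enorm x) ->
  measurable A -> mu (T @^-1` A) = mu A.
Proof.
move=> cT TK TB Tn mA.
have mT : measurable_fun setT T.
  apply: measurable_fun_rV => i; apply: continuous_measurable_rV.
  move=> x; apply: (continuous_comp (f := T)); first exact: cT.
  exact: continuous_coord.
have TD x y : T (x + y) = T x + T y.
  have T0 : T 0 = 0 by have := TB 0 0; rewrite !subrr.
  have TN z : T (- z) = - T z by rewrite -sub0r TB T0 sub0r.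
  by rewrite -[y in LHS]opprK TB TN opprK.
pose B : set 'rV[R]_n := eball 0 1.
have mB : measurable B by exact: measurable_eball.
pose f (p : 'rV[R]_n * 'rV[R]_n) : \bar R := (\1_B p.2 * \1_A (T p.1 + p.2)%R)%:E.
have mD : measurable_fun setT (fun p : 'rV[R]_n * 'rV[R]_n => T p.1 + p.2).
  apply: measurable_fun_rV => i.
  rewrite (_ : _ \o _ = (fun p => rV_coord i (T p.1) + rV_coord i p.2)); last first.
    by apply/funext => p; rewrite /rV_coord /= mxE.
  apply: measurable_funD.
    apply: (measurableT_comp (measurable_rV_coord i)).
    by apply: (measurableT_comp mT); exact: measurable_fst.
  by apply: (measurableT_comp (measurable_rV_coord i)); exact: measurable_snd.
have mf : measurable_fun setT f.
  apply/measurable_EFinP; apply: measurable_funM.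
    by apply: measurable_indic_comp => //; exact: measurable_snd.
  exact: measurable_indic_comp.
have f0 p : (0 <= f p)%E by rewrite lee_fin mulr_ge0.
have := fubini_tonelli (m1 := mu) (m2 := mu) f mf f0.
have m1A : measurable_fun setT (fun x => (\1_A x : R)%:E).
  by apply/measurable_EFinP; exact: measurable_indic.
have m1B : measurable_fun setT (fun x => (\1_B x : R)%:E).
  by apply/measurable_EFinP; exact: measurable_indic.
have -> : (\int[mu]_y \int[mu]_x f (x, y) = mu B * mu (T @^-1` A))%E.
  transitivity (\int[mu]_y ((\1_B y)%:E * mu (T @^-1` A)))%E.
    apply: eq_integral => y _.
    rewrite /f /=; under eq_integral do rewrite EFinM.
    rewrite ge0_integralZl_EFin//; last first.
      by apply: (measurableT_comp m1A); exact: (measurableT_comp (measurable_shift_rV y) mT).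
    congr (_ * _)%E; have mTA : measurable (T @^-1` A) by rewrite -[_ @^-1` _]setTI; exact: mT.
    (* Since [T x + y = T (x + T y)], the section at [y] is a translate of the preimage of [A]. *)
    rewrite -(lebesgue_rV_shift (T y) mTA) -[RHS]integral_indicT//; last first.
      by rewrite -[X in measurable X]setTI; exact: measurable_shift_rV.
    apply: eq_integral => x _; congr (_ %:E).
    by rewrite !indicE; congr ((_ : bool)%:R); apply/idP/idP; rewrite !inE /= TD TK.
  rewrite ge0_integralZr//.
    by rewrite integral_indic// setIT.
have -> : (\int[mu]_x \int[mu]_y f (x, y) = mu B * mu A)%E.
  transitivity (\int[mu]_x \int[mu]_y (\1_B (y - T x)%R * \1_A y)%:E)%E.
    apply: eq_integral => x _.
    rewrite -(@integral_shift_rV (T x) (fun y => (\1_B (y - T x)%R * \1_A y)%:E)).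
      by apply: eq_integral => y _; rewrite /f /= addrK [y + _]addrC.
    apply/measurable_EFinP; apply: measurable_funM; last exact: measurable_indic.
    by apply: measurable_indic_comp => //; exact: measurable_shift_rV.
  rewrite (fubini_tonelli (fun p : 'rV[R]_n * 'rV[R]_n => (\1_B (p.2 - T p.1)%R * \1_A p.2)%:E)); first last.
  - by move=> p; rewrite lee_fin mulr_ge0.
  - apply/measurable_EFinP; apply: measurable_funM; last first.
      by apply: measurable_indic_comp => //; exact: measurable_snd.
    apply: measurable_indic_comp => //.
    apply: measurable_fun_rV => i.
    rewrite (_ : _ \o _ = (fun p => rV_coord i p.2 - rV_coord i (T p.1))); last first.
      by apply/funext => p; rewrite /rV_coord /= !mxE.
    apply: measurable_funB.
      by apply: (measurableT_comp (measurable_rV_coord i)); exact: measurable_snd.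
    apply: (measurableT_comp (measurable_rV_coord i)).
    by apply: (measurableT_comp mT); exact: measurable_fst.
  transitivity (\int[mu]_y (mu B * (\1_A y)%:E))%E.
    apply: eq_integral => y _ /=.
    under eq_integral do rewrite EFinM.
    have mby : measurable_fun setT (fun x => (\1_B (y - T x)%R : R)%:E).
      apply/measurable_EFinP; apply: measurable_indic_comp => //.
      apply: measurable_fun_rV => i; apply: continuous_measurable_rV => x.
      apply: (continuous_comp (f := fun x => y - T x)); last exact: continuous_coord.
      by apply: continuousB; [exact: cst_continuous|exact: cT].
    rewrite ge0_integralZr//; congr (_ * _)%E.
    (* As [T] is an involutive isometry, [y - T x] lies in the unit ball exactly when [x] lies in
       the unit ball about [T y]. *)
    have -> : mu B = mu (eball (T y) 1) by rewrite lebesgue_eball_center.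
    rewrite -[RHS](integral_indicT mu (measurable_eball _ _)).
    apply: eq_integral => x _; congr (_ %:E); rewrite /indic /=.
    congr ((_ : bool)%:R); apply/idP/idP; rewrite !inE /B /eball /= sub0r enormN.
      by rewrite -Tn TB TK.
    by rewrite -[enorm (y - _)]Tn TB TK.
  rewrite ge0_integralZl//.
  by rewrite integral_indic// setIT.
have B0 : (0 < mu B)%E by exact: lebesgue_eball_gt0.
have Bf : mu B \is a fin_num by exact: lebesgue_eball_fin.
move=> h; apply/eqP; rewrite eq_le.
by apply/andP; split; rewrite -(lee_pmul2l Bf B0) h.
Qed.

Lemma lebesgue_refl (e : 'rV[R]_n) l (A : set 'rV[R]_n) : dot e e = 1 ->
  measurable A -> mu (refl e l @^-1` A) = mu A.
Proof.
move=> e1 mA.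
rewrite (_ : refl e l @^-1` A = refl0 e @^-1` ((+%R^~ ((2 * l) *: e)) @^-1` A)); last first.
  by apply/seteqP; split => x /=; rewrite reflE.
rewrite lebesgue_isometry.
- exact: lebesgue_rV_shift.
- have -> : refl0 e = refl e 0 by apply/funext => x; rewrite /refl /refl0 subr0.
  exact: continuous_refl.
- exact: refl0K.
- exact: refl0B.
- exact: enorm_refl0.
- by rewrite -[X in measurable X]setTI; exact: measurable_shift_rV.
Qed.

Lemma measurable_refl (e : 'rV[R]_n) l : measurable_fun setT (refl e l).
Proof.
apply: measurable_fun_rV => i; apply: continuous_measurable_rV.
move=> x; apply: (continuous_comp (f := refl e l)); first exact: continuous_refl.
exact: continuous_coord.
Qed.

Lemma integral_refl (e : 'rV[R]_n) l (f : 'rV[R]_n -> \bar R) : dot e e = 1 ->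
  measurable_fun setT f -> (\int[mu]_x f (refl e l x) = \int[mu]_x f x)%E.
Proof.
move=> e1; apply: (@integral_preserved _ _ R mu (refl e l)).
  exact: measurable_refl.
by move=> A mA; exact: lebesgue_refl.
Qed.

End lebesgue_isometry.

(** * Real powers, and their integrals over dyadic layers *)

Section powR_lemmas.
Context (R : realType).
Implicit Types x y a : R.

Lemma powRXn x a k : 0 <= x -> (x ^+ k) `^ a = (x `^ a) ^+ k.
Proof.
move=> x0; elim: k => [|k IH]; first by rewrite !expr0 powR1.
by rewrite !exprS powRM ?exprn_ge0// IH.
Qed.

Lemma le_powRN x y a : 0 < x -> x <= y -> 0 <= a -> y `^ (- a) <= x `^ (- a).
Proof.
move=> x0 xy a0; have y0 := lt_le_trans x0 xy.
rewrite !powRN lef_pV2 ?posrE ?powR_gt0//.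
by apply: ge0_ler_powR => //; rewrite nnegrE ltW.
Qed.

Lemma lt_powRN x y a : 0 < x -> x < y -> 0 < a -> y `^ (- a) < x `^ (- a).
Proof.
move=> x0 xy a0; have y0 := lt_trans x0 xy.
rewrite !powRN ltf_pV2 ?posrE ?powR_gt0//.
by apply: gt0_ltr_powR => //; rewrite nnegrE ltW.
Qed.

Lemma powR_lt1 x a : 0 < x -> x < 1 -> 0 < a -> x `^ a < 1.
Proof.
move=> x0 x1 a0; have h1 : 1 = 1 `^ a :> R by rewrite powR1.
rewrite [ltRHS]h1.
by apply: gt0_ltr_powR => //; rewrite ?nnegrE// ltW.
Qed.

Lemma powR_continuous_pos a x : 0 < x -> {for x, continuous (fun t : R => t `^ a)}.
Proof.
move=> x0.
have : expR (a * ln t) @[t --> x] --> expR (a * ln x).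
  apply: (continuous_comp (f := fun t => a * ln t)); last exact: continuous_expR.
  by apply: continuousM; [exact: cst_continuous|exact: continuous_ln].
have E t : 0 < t -> t `^ a = expR (a * ln t) by move=> t0; rewrite /powR gt_eqF.
move=> h; suff : t `^ a @[t --> x] --> x `^ a by [].
rewrite E//; apply: cvg_trans h; apply: near_eq_cvg.
have pos : \forall t \near x, 0 < t by apply: open_nbhs_nbhs; split; [exact: open_gt|].
by apply: filterS pos => t t0; rewrite E.
Qed.

Lemma measurable_powR_comp d (T : measurableType d) (D : set T) (f : T -> R) a :
  measurable_fun D f -> measurable_fun D (fun t : T => f t `^ a).
Proof. by move=> mf; apply: (measurableT_comp (measurable_powR a)). Qed.

End powR_lemmas.

Lemma integral_indicM d (T : measurableType d) (R : realType)
    (mu : {measure set T -> \bar R}) (A : set T) (c : R) (w : T -> R) :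
  measurable A -> measurable_fun setT w -> (forall y, 0 <= w y) -> 0 <= c ->
  (\int[mu]_y (c * (\1_A y * w y))%:E = c%:E * \int[mu]_(y in A) (w y)%:E)%E.
Proof.
move=> mA mw w0 c0; under eq_integral do rewrite EFinM.
rewrite ge0_integralZl_EFin//; last 2 first.
- by move=> y _; rewrite lee_fin mulr_ge0.
- by apply/measurable_EFinP; apply: measurable_funM => //; exact: measurable_indic.
congr (_ * _)%E; rewrite [RHS]integral_mkcond; apply: eq_integral => y _.
by rewrite /patch indicE; case: ifP => _; rewrite ?mul1r ?mul0r.
Qed.

Section dyadic.
Context d (T : measurableType d) (R : realType) (mu : {measure set T -> \bar R}).
Variables (N : T -> R) (m C : R).
Hypotheses (mN : measurable_fun setT N) (N0 : forall x, 0 <= N x) (C0 : 0 <= C).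
Hypothesis muN : forall t, 0 < t -> (mu [set x | (N x < t)%R] <= (C * t `^ m)%:E)%E.

Lemma measurable_sublevel t : measurable [set x | N x < t].
Proof.
rewrite (_ : [set x | _] = [set: T] `&` N @^-1` `]-oo, t[%classic).
  exact: mN.
by rewrite setTI; apply/seteqP; split => x /=; rewrite in_itv.
Qed.

Lemma nneseries_geometric_le (c z : R) : 0 <= c -> 0 <= z -> z < 1 ->
  (\sum_(0 <= k <oo) (c * z ^+ k)%:E <= (c / (1 - z))%:E)%E.
Proof.
move=> c0 z0 z1.
have h k : (0 <= (c * z ^+ k)%:E)%E by rewrite lee_fin mulr_ge0// exprn_ge0.
apply: lime_le; first by apply: is_cvg_nneseries => k _ _; exact: h.
apply: nearW => k; rewrite sumEFin lee_fin.
have /(congr1 (fun f => f k)) := geometric_seriesE c (negbT (lt_eqF z1)).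
rewrite /series /geometric /= => ->.
by rewrite ler_pM2r ?invr_gt0 ?subr_gt0// ler_piMr// gerBl exprn_ge0.
Qed.

(** A substitute for polar coordinates that needs only a volume bound for the sublevel sets of [N].
    With [r_k = rho theta^k], layer [k] contributes at most a constant times [r_k^(m - a)], and
    these bounds form a geometric series. The ratio [theta = 1/2] serves singularities, [theta = 2]
    serves tails. *)
Lemma integral_dyadic_le (D : set T) (f : T -> R) (theta A B rho a : R) :
  measurable D -> measurable_fun D f -> (forall x, D x -> 0 <= f x) ->
  0 < theta -> 0 < A -> 0 <= B -> 0 < rho -> theta `^ (m - a) < 1 ->
  (forall x, D x -> f x = 0 \/ exists k, N x < A * (rho * theta ^+ k) /\
     f x <= B * (rho * theta ^+ k) `^ (- a)) ->
  (\int[mu]_(x in D) (f x)%:E <=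
    (B * C * A `^ m / (1 - theta `^ (m - a)) * rho `^ (m - a))%:E)%E.
Proof.
move=> mD mf f0 th0 A0 B0 rho0 z1 hf.
pose r k := rho * theta ^+ k.
have r0 k : 0 < r k by rewrite mulr_gt0// exprn_gt0.
pose S k := [set x | N x < A * r k].
have mS k : measurable (S k) by exact: measurable_sublevel.
pose g k x : \bar R := ((B * r k `^ (- a)) * \1_(S k) x)%:E.
have g0 k x : (0 <= g k x)%E by rewrite lee_fin !mulr_ge0// powR_ge0.
have mg k : measurable_fun setT (g k).
  by apply/measurable_EFinP; apply: measurable_funM => //; exact: measurable_indic.
have c0 k : 0 <= B * r k `^ (- a) by rewrite mulr_ge0// powR_ge0.
apply: (@le_trans _ _ (\int[mu]_(x in D) \sum_(0 <= k <oo) g k x)%E).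
  apply: ge0_le_integral => //.
  - exact/measurable_EFinP.
  - apply: (@measurable_funS _ _ _ _ setT) => //.
    by apply: ge0_emeasurable_sum.
  - move=> x Dx; case: (hf x Dx) => [->|[k [h1 h2]]].
      by apply: nneseries_ge0 => k _ _; exact: g0.
    apply: le_trans (nneseries_lim_ge k.+1 _) => //.
    rewrite big_nat_recr//= -[leLHS]add0e leeD ?sume_ge0//.
    by rewrite /g lee_fin indicE mem_set// mulr1.
apply: (@le_trans _ _ (\int[mu]_x \sum_(0 <= k <oo) g k x)%E).
  apply: ge0_subset_integral => //.
    by apply: ge0_emeasurable_sum.
  by move=> x _; apply: nneseries_ge0 => k _ _; exact: g0.
rewrite integral_nneseries//.
apply: (@le_trans _ _ (\sum_(0 <= k <oo) ((B * C * A `^ m * rho `^ (m - a)) * (theta `^ (m - a)) ^+ k)%:E)%E).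
  apply: lee_nneseries => [k _|k _]; first by move=> *; exact: integral_ge0.
  rewrite /g; under eq_integral do rewrite EFinM.
  rewrite ge0_integralZl_EFin//; last by apply/measurable_EFinP; exact: measurable_indic.
  rewrite integral_indic// setIT.
  apply: (@le_trans _ _ ((B * r k `^ (- a))%:E * (C * (A * r k) `^ m)%:E)%E).
    by rewrite lee_wpmul2l ?lee_fin// muN// mulr_gt0.
  rewrite -EFinM lee_fin le_eqVlt; apply/orP; left; apply/eqP.
  rewrite powRM ?ltW// -powRXn ?ltW//.
  have Er : rho `^ (m - a) * (theta ^+ k) `^ (m - a) = r k `^ m * r k `^ (- a).
    have rn0 : r k != 0 by rewrite gt_eqF.
    by rewrite -powRM ?exprn_ge0 ?ltW// powRD// rn0 implybT.
  by rewrite -[RHS]mulrA Er; ring.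
apply: le_trans (nneseries_geometric_le _ _ _) _ => //.
- by rewrite !mulr_ge0// powR_ge0.
- exact: powR_ge0.
- by rewrite lee_fin le_eqVlt; apply/orP; left; apply/eqP; ring.
Qed.

Lemma exists_pow2_gt (x : R) : exists k : nat, x < 2 ^+ k.
Proof.
exists (Num.bound x); apply: (@le_lt_trans _ _ `|x|); first exact: ler_norm.
apply: lt_le_trans (_ : (Num.bound x)%:R <= _).
  by have := archi_boundP (normr_ge0 x); rewrite /Num.bound normr_id.
by rewrite -natrX ler_nat ltnW// ltn_expl.
Qed.

Lemma integral_near_le (a : R) : 0 < a < m -> exists2 K : R, 0 <= K & forall rho : R, 0 < rho ->
  (\int[mu]_(x in [set x | (N x < rho)%R]) (N x `^ (- a))%:E <= (K * rho `^ (m - a))%:E)%E.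
Proof.
move=> /andP[a0 am].
have z1 : 2^-1 `^ (m - a) < 1 :> R by apply: powR_lt1; rewrite ?subr_gt0// ?invf_lt1// ltr1n.
(* On layer [k] the function [N] is only known to be at least [r_k / 2], whence the factor [2^a];
   the layer lies in [N < r_k], so [A = 1]. *)
exists (2 `^ a * C * 1 `^ m / (1 - 2^-1 `^ (m - a))).
  by rewrite divr_ge0 ?mulr_ge0 ?powR_ge0// subr_ge0 ltW.
move=> rho rho0; apply: integral_dyadic_le => //.
- exact: measurable_sublevel.
- by apply: measurable_powR_comp; exact: measurable_funTS.
- by move=> x _; exact: powR_ge0.
move=> x /= xr; have := N0 x; rewrite le_eqVlt => /predU1P[<-|Nx0].
  (* A negative power of [0] is [0] by convention, so the singular point itself contributes
     nothing. *)
  by left; rewrite powR0// oppr_eq0 gt_eqF.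
right.
have ex : exists k, rho * 2^-1 ^+ k.+1 <= N x.
  have [k hk] := exists_pow2_gt (rho / N x); exists k.
  rewrite exprVn ler_pdivrMr ?exprn_gt0// mulrC -ler_pdivrMr// ltW//.
  by apply: lt_trans hk _; rewrite exprS mulr_natl mulr2n ltrDl exprn_gt0.
(* Minimality of [k] gives the upper bound on [N x]; for [k = 0] it is the condition defining the
   domain. *)
case: (ex_minnP ex) => k hk kmin; exists k; split.
  rewrite mul1r; case: k hk kmin => [|k] hk kmin; first by rewrite mulr1.
  by rewrite ltNge; apply/negP => /kmin; rewrite ltnn.
apply: le_trans (le_powRN _ hk (ltW a0)) _; first by rewrite mulr_gt0// exprn_gt0.
have e1 : 2^-1 `^ a * 2 `^ a = 1 :> R by rewrite -powRM// mulVf// powR1.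
have e2 : 2^-1 `^ (- a) = 2 `^ a :> R.
  have h0 : 2^-1 `^ a != 0 :> R by rewrite gt_eqF// powR_gt0.
  by rewrite powRN; apply: (mulfI h0); rewrite mulfV// e1.
have rk0 : 0 <= rho * 2^-1 ^+ k by rewrite mulr_ge0 ?exprn_ge0// ltW.
by rewrite exprSr mulrA powRM// e2 mulrC.
Qed.

Lemma integral_far_le (b : R) : 0 < m < b -> exists2 K : R, 0 <= K & forall rho : R, 0 < rho ->
  (\int[mu]_(x in [set x | (rho <= N x)%R]) (N x `^ (- b))%:E <= (K * rho `^ (m - b))%:E)%E.
Proof.
move=> /andP[m0 mb].
have z1 : 2 `^ (m - b) < 1 :> R.
  rewrite -opprB powRN invf_lt1 ?powR_gt0// [ltLHS](_ : 1 = 1 `^ (b - m)); last by rewrite powR1.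
  by apply: gt0_ltr_powR; rewrite ?subr_gt0 ?nnegrE// ltr1n.
(* Here the layers are [r_k <= N x < 2 r_k], so [A = 2] and [B = 1]. *)
exists (1 * C * 2 `^ m / (1 - 2 `^ (m - b))).
  by rewrite divr_ge0 ?mulr_ge0 ?powR_ge0// subr_ge0 ltW.
move=> rho rho0; apply: integral_dyadic_le => //.
- rewrite (_ : [set x | _] = ~` [set x | N x < rho]).
    by apply: measurableC; exact: measurable_sublevel.
  by apply/seteqP; split => x /=; rewrite leNgt => /negP.
- by apply: measurable_powR_comp; exact: measurable_funTS.
- by move=> x _; exact: powR_ge0.
move=> x /= xr; right.
have ex : exists k, N x < rho * 2 ^+ k.+1.
  have [k hk] := exists_pow2_gt (N x / rho); exists k.
  rewrite mulrC -ltr_pdivrMr//; apply: lt_trans hk _.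
  by rewrite exprS mulr_natl mulr2n ltrDl exprn_gt0.
case: (ex_minnP ex) => k hk kmin; exists k; split.
  by rewrite mulrCA -exprS.
rewrite mul1r; apply: le_powRN; first by rewrite mulr_gt0// exprn_gt0.
  case: k hk kmin => [|k] hk kmin; first by rewrite mulr1.
  by rewrite leNgt; apply/negP => /kmin; rewrite ltnn.
by apply: ltW; exact: lt_trans mb.
Qed.

End dyadic.

(** * Power kernels on R^n and decay of Riesz potentials *)

Section euclidean_power_integrals.
Context (R : realType) (n : nat).
Hypothesis n0 : (0 < n)%N.
Notation mu := (@lebesgue_rV R n).

(** A form of the Japanese bracket: comparable to [|x|] at infinity and at least [1], so that its
    negative powers are bounded by [1]. *)
Definition jap (x : 'rV[R]_n) : R := 1 + enorm x.

Lemma jap_ge1 x : 1 <= jap x.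
Proof. by rewrite /jap lerDl enorm_ge0. Qed.

Lemma jap_gt0 x : 0 < jap x.
Proof. exact: lt_le_trans ltr01 (jap_ge1 x). Qed.

Lemma measurable_enormB (x : 'rV[R]_n) : measurable_fun setT (fun y : 'rV[R]_n => enorm (x - y)).
Proof. by apply: continuous_measurable_rV => y; exact: continuous_enormB. Qed.

Lemma measurable_jap : measurable_fun setT jap.
Proof. by apply: measurable_funD => //; exact: measurable_enorm. Qed.

Lemma lebesgue_eball_powR (x : 'rV[R]_n) (t : R) : 0 < t ->
  (mu (eball x t) <= (2 ^+ n * t `^ n%:R)%:E)%E.
Proof.
move=> t0; apply: le_trans (lebesgue_eball_le x t0) _.
by rewrite powR_mulrn ?(ltW t0)// lee_fin -exprMn mulr_natl.
Qed.

Lemma lebesgue_jap_powR (t : R) : 0 < t ->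
  (mu [set x | (jap x < t)%R] <= (2 ^+ n * t `^ n%:R)%:E)%E.
Proof.
move=> t0; apply: le_trans (lebesgue_eball_powR 0 t0).
apply: le_measure; rewrite ?inE; last 2 first.
- exact: measurable_eball.
- move=> x /= h; rewrite /eball /= sub0r enormN; apply: le_lt_trans h.
  by rewrite lerDr.
- exact: (measurable_sublevel measurable_jap).
Qed.

Let C0 : 0 <= 2 ^+ n :> R. Proof. exact: exprn_ge0. Qed.
Let n0' : 0 < n%:R :> R. Proof. by rewrite ltr0n. Qed.

(** Translating the centre to the origin makes [K] independent of [x], as a decay estimate in [x]
    requires. *)
Lemma integral_kernel_near (a : R) : 0 < a < n%:R ->
  exists2 K : R, 0 <= K & forall (x : 'rV[R]_n) (rho : R), 0 < rho ->
  (\int[mu]_(y in eball x rho) (enorm (x - y) `^ (- a))%:E <= (K * rho `^ (n%:R - a))%:E)%E.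
Proof.
move=> ha.
have h (t : R) : 0 < t -> (mu [set y | (enorm y < t)%R] <= (2 ^+ n * t `^ n%:R)%:E)%E.
  move=> t0; apply: le_trans (lebesgue_eball_powR 0 t0).
  rewrite (_ : [set y | _] = eball 0 t)//.
  by apply/seteqP; split => y; rewrite /eball /= sub0r enormN.
have [K K0 hK] := integral_near_le (@measurable_enorm R n) (@enorm_ge0 R n) C0 h ha.
exists K; [exact: K0|move=> x rho rho0]; apply: le_trans (hK rho rho0).
rewrite [leLHS]integral_mkcond [leRHS]integral_mkcond.
rewrite -[leRHS](@integral_shift_rV R n (- x)).
  rewrite le_eqVlt; apply/orP; left; apply/eqP; apply: eq_integral => y _.
  by rewrite /patch; congr (if _ then _ else _); rewrite ?(enormB x)//;
    apply/idP/idP; rewrite !inE /eball /= enormB.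
apply/(measurable_restrictT _ _).1; first exact: (measurable_sublevel (@measurable_enorm R n)).
apply/measurable_EFinP; apply: measurable_powR_comp; apply: measurable_funTS.
exact: measurable_enorm.
Qed.

Lemma integral_jap_near (a : R) : 0 < a < n%:R ->
  exists2 K : R, 0 <= K & forall rho : R, 0 < rho ->
  (\int[mu]_(y in [set y | (jap y < rho)%R]) (jap y `^ (- a))%:E <= (K * rho `^ (n%:R - a))%:E)%E.
Proof.
move=> ha; apply: (integral_near_le measurable_jap _ C0 lebesgue_jap_powR ha) => x.
exact: ltW (jap_gt0 x).
Qed.

Lemma integral_jap_far (b : R) : n%:R < b ->
  exists2 K : R, 0 <= K & forall rho : R, 0 < rho ->
  (\int[mu]_(y in [set y | (rho <= jap y)%R]) (jap y `^ (- b))%:E <= (K * rho `^ (n%:R - b))%:E)%E.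
Proof.
move=> hb; apply: (integral_far_le measurable_jap C0 lebesgue_jap_powR).
by apply/andP; split; [exact: n0'|].
Qed.

Lemma integral_kernel_far (b : R) : n%:R < b -> forall (x : 'rV[R]_n) (rho : R), 0 < rho ->
  (\int[mu]_(y in ~` eball x rho) (enorm (x - y) `^ (- b))%:E < +oo)%E.
Proof.
move=> hb x rho rho0.
have h (t : R) : 0 < t -> (mu [set y | (enorm (x - y) < t)%R] <= (2 ^+ n * t `^ n%:R)%:E)%E.
  exact: lebesgue_eball_powR.
have hb' : (0 < (n%:R : R)) && ((n%:R : R) < b) by apply/andP; split; [exact: n0'|].
have [K K0 hK] := integral_far_le (measurable_enormB x) C0 h hb'.
apply: le_lt_trans (ltry (K * rho `^ (n%:R - b))).
rewrite (_ : ~` eball x rho = [set y | (rho <= enorm (x - y))%R]); first exact: hK.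
by apply/seteqP; split => y /=; rewrite /eball /= leNgt => /negP.
Qed.

(* The regions are [|x - y| < jap x / 2], then [jap y < 2 jap x], then the rest,
   where [|x - y| >= jap y / 2]. *)
Lemma riesz_decay (s2 b : R) : 0 < s2 -> s2 < b -> b < n%:R ->
  exists2 K : R, 0 <= K & forall (f : 'rV[R]_n -> R) x,
  measurable_fun setT f -> (forall y, 0 <= f y <= jap y `^ (- b)) ->
  (\int[mu]_y (f y * enorm (x - y) `^ (s2 - n%:R))%:E <= (K * jap x `^ (s2 - b))%:E)%E.
Proof.
move=> s0 sb bn.
have ha1 : 0 < n%:R - s2 < n%:R by rewrite subr_gt0 (lt_trans sb)// gtrBl.
have [K1 K10 hK1] := integral_kernel_near ha1.
have ha2 : 0 < b < n%:R by rewrite (lt_trans s0).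
have [K2 K20 hK2] := integral_jap_near ha2.
(* Far out, the decay of [f] and that of the kernel combine to this exponent, which is integrable at
   infinity because [s2 < b]. *)
have ha3 : n%:R < b + (n%:R - s2) by lra.
have [K3 K30 hK3] := integral_jap_far ha3.
pose h := 2^-1 : R.
pose K := h `^ (- b) * (K1 * h `^ s2) + h `^ (s2 - n%:R) * (K2 * 2 `^ (n%:R - b))
   + h `^ (s2 - n%:R) * (K3 * 2 `^ (s2 - b)).
exists K; first by rewrite !addr_ge0// !mulr_ge0// powR_ge0.
move=> f x mf hf; set rho := jap x.
have rho0 : 0 < rho by exact: jap_gt0.
have h0 : 0 < h by rewrite invr_gt0.
have hr0 : 0 < h * rho by rewrite mulr_gt0.
have f0 y : 0 <= f y by case/andP: (hf y).
have fb y : f y <= jap y `^ (- b) by case/andP: (hf y).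
pose A1 := eball x (h * rho).
pose A2 := [set y | (jap y < 2 * rho)%R].
pose A3 := [set y | (2 * rho <= jap y)%R].
have mA1 : measurable A1 by exact: measurable_eball.
have mA2 : measurable A2 by exact: (measurable_sublevel measurable_jap).
have mA3 : measurable A3.
  rewrite (_ : A3 = ~` A2); first exact: measurableC.
  by apply/seteqP; split => y /=; rewrite /A3 /A2 /= leNgt => /negP.
have mk : measurable_fun setT (fun y : 'rV[R]_n => enorm (x - y) `^ (s2 - n%:R)).
  by apply: measurable_powR_comp; exact: measurable_enormB.
have mjb (c : R) : measurable_fun setT (fun y => jap y `^ c).
  by apply: measurable_powR_comp; exact: measurable_jap.
pose g1 y : \bar R := ((h * rho) `^ (- b) * (\1_A1 y * enorm (x - y) `^ (s2 - n%:R)))%:E.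
pose g2 y : \bar R := ((h * rho) `^ (s2 - n%:R) * (\1_A2 y * jap y `^ (- b)))%:E.
pose g3 y : \bar R := (h `^ (s2 - n%:R) * (\1_A3 y * jap y `^ (- (b + (n%:R - s2)))))%:E.
have g10 y : (0 <= g1 y)%E by rewrite lee_fin !mulr_ge0// powR_ge0.
have g20 y : (0 <= g2 y)%E by rewrite lee_fin !mulr_ge0// powR_ge0.
have g30 y : (0 <= g3 y)%E by rewrite lee_fin !mulr_ge0// powR_ge0.
have mg1 : measurable_fun setT g1.
  by apply/measurable_EFinP; apply: measurable_funM => //; apply: measurable_funM => //; exact: measurable_indic.
have mg2 : measurable_fun setT g2.
  by apply/measurable_EFinP; apply: measurable_funM => //; apply: measurable_funM => //; exact: measurable_indic.
have mg3 : measurable_fun setT g3.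
  by apply/measurable_EFinP; apply: measurable_funM => //; apply: measurable_funM => //; exact: measurable_indic.
have kle (t y : R) : 0 < t -> t <= y -> y `^ (s2 - n%:R) <= t `^ (s2 - n%:R).
  by move=> t0 ty; rewrite -opprB; apply: le_powRN => //; lra.
have pw : forall y, ((f y * enorm (x - y) `^ (s2 - n%:R))%:E <= g1 y + g2 y + g3 y)%E.
  move=> y; have [y1|y1] := ltP (enorm (x - y)) (h * rho).
    apply: (@le_trans _ _ (g1 y)); last by rewrite -addeA leeDl// adde_ge0.
    rewrite lee_fin indicE mem_set// mul1r ler_wpM2r ?powR_ge0//.
    apply: le_trans (fb y) _; apply: le_powRN => //; last by lra.
    have := enormD (x - y) y; rewrite subrK; move: y1; rewrite /rho /jap /h; lra.
  have [y2|y2] := ltP (jap y) (2 * rho).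
    apply: (@le_trans _ _ (g2 y)); last by rewrite addeAC leeDr// adde_ge0.
    rewrite lee_fin indicE mem_set// mul1r mulrC; apply: ler_pM => //; rewrite ?powR_ge0//.
    exact: kle.
  apply: (@le_trans _ _ (g3 y)); last by rewrite leeDr// adde_ge0.
  rewrite lee_fin indicE mem_set// mul1r.
  apply: (@le_trans _ _ (jap y `^ (- b) * (h * jap y) `^ (s2 - n%:R))).
    apply: ler_pM; rewrite ?powR_ge0//; apply: kle; first by rewrite mulr_gt0// jap_gt0.
    have := enormD (y - x) x; rewrite subrK (enormB y x); move: y2 y1; rewrite /rho /jap /h; lra.
  rewrite powRM ?(ltW h0) ?(ltW (jap_gt0 y))// mulrCA -powRD; last by rewrite (negbT (gt_eqF (jap_gt0 y))) implybT.
  by rewrite (_ : - b + _ = - (b + (n%:R - s2)))//; ring.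
apply: (@le_trans _ _ (\int[mu]_y (g1 y + g2 y + g3 y))%E).
  apply: ge0_le_integral => //.
  - by move=> y _; rewrite lee_fin mulr_ge0// powR_ge0.
  - by apply/measurable_EFinP; apply: measurable_funM.
  - by apply: emeasurable_funD => //; apply: emeasurable_funD.
rewrite ge0_integralD//; last 2 first.
- by move=> y _; rewrite adde_ge0.
- exact: emeasurable_funD.
rewrite ge0_integralD//.
rewrite !integral_indicM ?powR_ge0//; last 3 first.
- by move=> y; exact: powR_ge0.
- by move=> y; exact: powR_ge0.
- by move=> y; exact: powR_ge0.
have pe : s2 - n%:R = - (n%:R - s2) by ring.
have b1 : (\int[mu]_(y in A1) (enorm (x - y) `^ (s2 - n%:R))%:E <= (K1 * (h * rho) `^ s2)%:E)%E.
  by rewrite pe; apply: le_trans (hK1 x _ hr0) _; rewrite subKr.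
have b2 : (\int[mu]_(y in A2) (jap y `^ (- b))%:E <= (K2 * (2 * rho) `^ (n%:R - b))%:E)%E.
  by apply: hK2; rewrite mulr_gt0.
have b3 : (\int[mu]_(y in A3) (jap y `^ (- (b + (n%:R - s2))))%:E <= (K3 * (2 * rho) `^ (s2 - b))%:E)%E.
  apply: le_trans (hK3 (2 * rho) _) _; first by rewrite mulr_gt0.
  by rewrite (_ : n%:R - _ = s2 - b)//; ring.
apply: (@le_trans _ _ (((h * rho) `^ (- b))%:E * (K1 * (h * rho) `^ s2)%:E +
   ((h * rho) `^ (s2 - n%:R))%:E * (K2 * (2 * rho) `^ (n%:R - b))%:E +
   (h `^ (s2 - n%:R))%:E * (K3 * (2 * rho) `^ (s2 - b))%:E)%E).
  by apply: leeD; [apply: leeD|]; rewrite lee_wpmul2l// lee_fin powR_ge0.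
rewrite -!EFinM -!EFinD lee_fin le_eqVlt; apply/orP; left; apply/eqP.
rewrite !(powRM _ (ltW h0) (ltW rho0)) !(powRM _ (ler0n _ 2) (ltW rho0)).
have rn0 : rho != 0 by rewrite gt_eqF.
have r1 : rho `^ (- b) * rho `^ s2 = rho `^ (s2 - b).
  by rewrite -powRD ?rn0 ?implybT// addrC.
have r2 : rho `^ (s2 - n%:R) * rho `^ (n%:R - b) = rho `^ (s2 - b).
  by rewrite -powRD ?rn0 ?implybT//; congr (_ `^ _); ring.
transitivity (h `^ (- b) * (K1 * h `^ s2) * (rho `^ (- b) * rho `^ s2) +
  h `^ (s2 - n%:R) * (K2 * 2 `^ (n%:R - b)) * (rho `^ (s2 - n%:R) * rho `^ (n%:R - b)) +
  h `^ (s2 - n%:R) * (K3 * 2 `^ (s2 - b)) * rho `^ (s2 - b)); first by ring.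
by rewrite r1 r2 -!mulrDl.
Qed.

End euclidean_power_integrals.

(** * From the derivative almost everywhere to slopes *)

Section monotone_from_derivative.
Context (R : realType).
Notation lambda := (@lebesgue_measure R).

(** Continuous induction: the supremum of the points [t] with [H a <= H t] is itself such a point
    and cannot lie below [b]. Comparison of each centre [x] with its neighbours on both sides
    replaces continuity of [H]. *)
Lemma local_nondecreasing (H : R -> R) (a b : R) : a <= b ->
  (forall x, a <= x <= b -> exists2 dl, 0 < dl & forall y, a <= y <= b ->
     `|y - x| < dl -> (x <= y -> H x <= H y) /\ (y <= x -> H y <= H x)) ->
  H a <= H b.
Proof.
move=> ab hH.
pose S := [set t | a <= t <= b /\ H a <= H t].
have Sa : S a by split; rewrite ?lexx.
have Sb : ubound S b by move=> t [/andP[]].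
have hS : has_sup S by split; [exists a|exists b].
have ac : a <= sup S by exact: ub_le_sup hS.2 _ Sa.
have cb : sup S <= b by exact: ge_sup hS.1 Sb.
have cab : a <= sup S <= b by rewrite ac.
have [dl dl0 hd] := hH _ cab.
have Hc : H a <= H (sup S).
  have [t [tab Ht] tc] := sup_adherent dl0 hS.
  have ts : t <= sup S by apply: ub_le_sup; [exact: hS.2|split].
  apply: le_trans Ht _; apply: (hd t tab _).2 => //.
  by rewrite ler0_norm ?subr_le0// opprB ltrBlDl -ltrBlDr.
have [cb'|] := ltP (sup S) b; last by move=> bc; rewrite (_ : b = sup S)//; apply/le_anti; rewrite bc.
exfalso.
pose y := Num.min b (sup S + dl / 2).
have cy : sup S < y by rewrite lt_min cb' ltrDl divr_gt0.
have yb : y <= b by rewrite ge_min lexx.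
have yab : a <= y <= b by rewrite yb (le_trans ac)// ltW.
have Sy : S y.
  split => //; apply: le_trans Hc _; apply: (hd y yab _).1; last exact: ltW.
  rewrite gtr0_norm ?subr_gt0//.
  have : y <= sup S + dl / 2 by rewrite ge_min lexx orbT.
  by move=> ?; lra.
by have := ub_le_sup hS.2 Sy; rewrite leNgt cy.
Qed.

(* Adding [eps x] plus [L] times the measure, up to [x], of a small open
   neighbourhood of the exceptional set makes [G] locally nondecreasing
   everywhere. *)
Lemma lipschitz_ae_nondecreasing (G : R -> R) (L p q : R) : p <= q -> 0 <= L ->
  (forall x y, p <= x <= q -> p <= y <= q -> `|G x - G y| <= L * `|x - y|) ->
  {ae lambda, forall t : R, derivable G t 1 /\ 0 <= G^`()%classic t} ->
  G p <= G q.
Proof.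
move=> pq L0 lipG [A [mA A0 hA]].
have good x : ~ A x -> derivable G x 1 /\ 0 <= G^`()%classic x.
  by move=> nA; apply: contrapT => h; apply: nA; exact: hA.
suff key eps : 0 < eps -> G p <= G q + eps * (q - p + L).
  apply/ler_addgt0Pr => e e0.
  have d0 : 0 < q - p + L + 1 by rewrite ltr_wpDl// addr_ge0// subr_ge0.
  have := key (e / (q - p + L + 1)) (divr_gt0 e0 d0).
  have : e / (q - p + L + 1) * (q - p + L) <= e.
    rewrite mulrAC ler_pdivrMr// ler_pM2l// lerDl//.
  by lra.
move=> e0.
have [V [oO AO hO]] : exists U : set R, [/\ open U, A `<=` U & (lambda (U `\` A) < eps%:E)%E].
  apply: lebesgue_regularity_outer => //.
  exact: (eq_ind_r (fun x => (x < +oo)%E) (ltry 0) A0).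
have mO : measurable V by exact: open_measurable.
have lele (B C : set R) : measurable B -> measurable C -> B `<=` C ->
    (lambda B <= lambda C)%E.
  by move=> mB mC BC; apply: le_measure; rewrite ?inE.
have lO : (lambda V <= eps%:E)%E.
  rewrite -(setDUK AO); apply: le_trans (measureU2 _ _ _) _ => //.
    exact: measurableD.
  by rewrite [X in (X + _)%E](_ : _ = 0%E)// add0e ltW.
pose I x := V `&` `]p, x]%classic.
have mI x : measurable (I x) by apply: measurableI => //; exact: measurable_itv.
have Ifin x : lambda (I x) \is a fin_num.
  rewrite ge0_fin_numE//; apply: le_lt_trans (ltry eps); apply: le_trans lO.
  by apply: lele => //; exact: subIsetl.
pose M x := fine (lambda (I x)).
have Mmono x y : x <= y -> M x <= M y.
  move=> xy; apply: fine_le => //; apply: lele => //.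
  by move=> t [Ot] /=; rewrite !in_itv /= => /andP[pt tx]; split => //=; rewrite in_itv /= pt (le_trans tx).
have Minc x y : p <= x -> x <= y -> `]x, y]%classic `<=` V -> y - x <= M y - M x.
  move=> px xy xyO; rewrite lerBrDr -lee_fin EFinD fineK// fineK//.
  have <- : lambda `]x, y]%classic = (y - x)%:E.
    rewrite lebesgue_measure_itv /= lte_fin; case: ltP => // yx.
    by rewrite (_ : y = x) ?subrr//; apply/le_anti; rewrite xy yx.
  rewrite -measureU//; last 2 first.
  - exact: mI.
  - apply/seteqP; split => t //= [] /=; rewrite in_itv /= => /andP[xt _] [_] /=.
    by rewrite in_itv /= => /andP[_]; rewrite leNgt xt.
  apply: lele => //.
    by apply: measurableU => //; exact: measurable_itv.
  move=> t [tx|[Ot /=]].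
    split; first exact: xyO.
    by move: tx; rewrite /= !in_itv /= => /andP[xt ->]; rewrite (le_lt_trans px).
  rewrite in_itv /= => /andP[pt tx]; split => //=.
  by rewrite in_itv /= pt (le_trans tx).
pose H x := G x + eps * x + L * M x.
have Hpq : H p <= H q.
  apply: local_nondecreasing => // x xpq; have [px xq] := andP xpq.
  (* Near an exceptional point [M] grows with slope at least [1], so [L * M] outweighs any decrease
     of the [L]-Lipschitz [G]; elsewhere [eps * x] absorbs the error in the difference quotient. *)
  have [Ax|nAx] := pselect (A x).
    have /nbhs_ballP[dl /= dl0 dO] : nbhs x V by apply: open_nbhs_nbhs; split => //; exact: AO.
    have inc y z : p <= y <= q -> p <= z <= q -> y <= z -> `]y, z]%classic `<=` V -> H y <= H z.
      move=> ypq zpq yz yzO.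
      have := lipG y z ypq zpq; rewrite (distrC y z) [`|z - y|]ger0_norm ?subr_ge0//.
      move=> /ler_normlW h1.
      have py : p <= y by case/andP: ypq.
      have h2 : L * (z - y) <= L * (M z - M y) by rewrite ler_wpM2l// Minc.
      have h3 : eps * y <= eps * z by rewrite ler_wpM2l// ltW.
      by rewrite /H; lra.
    exists dl => // y ypq yx; split => xy; apply: inc => // t /=;
      rewrite in_itv /= => /andP[t1 t2]; apply: dO; rewrite /ball /=.
      rewrite distrC gtr0_norm ?subr_gt0//; apply: le_lt_trans yx.
      by rewrite ger0_norm ?subr_ge0// lerB.
    rewrite ger0_norm ?subr_ge0//; apply: lt_trans (_ : x - y < _); first by rewrite ltrD2l ltrN2.
    by rewrite -[x - y]ger0_norm ?subr_ge0// distrC.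
  have [dG G0] := good _ nAx.
  have : h^-1 *: (G (h *: 1 + x) - G x) @[h --> 0^'] --> G^`()%classic x.
    by rewrite derive1E; exact: dG.
  move=> /cvgrPdist_lt/(_ _ e0); rewrite near_withinE => /nbhs_ballP[dl /= dl0 hd].
  have sl h : h != 0 -> `|h| < dl -> - eps <= h^-1 * (G (h + x) - G x).
    move=> h0 hdl.
    have := hd h _ h0; rewrite /ball /= sub0r normrN => /(_ hdl).
    rewrite /GRing.scale /= mulr1 => /ltr_normlW; lra.
  exists dl => // y ypq yx.
  have [->|nyx] := eqVneq y x; first by split.
  have := sl (y - x); rewrite subr_eq0 subrK => /(_ nyx yx).
  move=> s1; split => xy.
    have yx0 : 0 < y - x by rewrite subr_gt0 lt_neqAle eq_sym nyx.
    move: s1; rewrite mulrC ler_pdivlMr// => s1.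
    have : L * M x <= L * M y by rewrite ler_wpM2l// Mmono.
    by rewrite /H; lra.
  have yx0 : y - x < 0 by rewrite subr_lt0 lt_neqAle nyx.
  move: s1; rewrite mulrC ler_ndivlMr// => s1.
  have : L * M y <= L * M x by rewrite ler_wpM2l// Mmono.
  by rewrite /H; lra.
have Mq : L * M q <= L * eps.
  rewrite ler_wpM2l// -lee_fin fineK//; apply: le_trans lO.
  by apply: lele => //; exact: subIsetl.
have Mp : 0 <= L * M p by rewrite mulr_ge0// fine_ge0.
by move: Hpq; rewrite /H; lra.
Qed.

Lemma locally_lipschitzP (F : R -> R) x : locally_lipschitz F ->
  exists M dl : R, [/\ 0 <= M, 0 < dl & forall y z, `|y - x| < dl -> `|z - x| < dl ->
    `|F y - F z| <= M * `|y - z|].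
Proof.
move=> /(_ (x, x) (conj I I)); rewrite /lipschitz_on /= => -[M [_ hM]].
(* The Lipschitz bound holds for every constant strictly above [M]; this one is also nonnegative. *)
have := hM (Num.max 0 M + 1); rewrite ltr_pwDr ?le_max ?lexx ?orbT// => /(_ isT).
rewrite /within => -[[U V] /= [/nbhs_ballP[d1 /= d10 hU] /nbhs_ballP[d2 /= d20 hV]] hUV].
exists (Num.max 0 M + 1), (Num.min d1 d2); split.
- by rewrite addr_ge0// le_max lexx.
- by rewrite lt_min d10.
- move=> y z; rewrite !lt_min => /andP[y1 y2] /andP[z1 z2].
  apply: (hUV (y, z)) => //; split => /=; [apply: hU|apply: hV]; by rewrite /ball /= distrC.
Qed.

Lemma locally_lipschitz_continuous (F : R -> R) : locally_lipschitz F -> continuous F.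
Proof.
move=> lipF x; have [M [dl [M0 dl0 hM]]] := locally_lipschitzP x lipF.
apply/cvgrPdist_lt => eps eps0.
have M1 : 0 < M + 1 by rewrite ltr_wpDl.
have h0 : 0 < Num.min dl (eps / (M + 1)) by rewrite lt_min dl0 divr_gt0.
apply/nbhs_ballP; exists (Num.min dl (eps / (M + 1))) => // y.
rewrite /ball /= lt_min => /andP[y1 y2].
have xx : `|x - x| < dl by rewrite subrr normr0.
have yx : `|y - x| < dl by rewrite distrC.
apply: le_lt_trans (hM x y xx yx) _.
move: y2; rewrite ltr_pdivlMr// => y2; apply: le_lt_trans y2.
by rewrite mulrC ler_wpM2l// lerDl.
Qed.

(** Monotonicity of [F t - c0 t]. This turns the pointwise ellipticity, known only almost
    everywhere, into an inequality for all increments, the form in which the folding argument uses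
    it. *)
Lemma slope_ge (F : R -> R) (c0 : R) : locally_lipschitz F ->
  {ae lambda, forall t : R, derivable F t 1 /\ c0 <= F^`()%classic t} ->
  forall a b, a <= b -> c0 * (b - a) <= F b - F a.
Proof.
move=> lipF aeF a b ab.
pose G t := F t - c0 * t.
have aeG : {ae lambda, forall t : R, derivable G t 1 /\ 0 <= G^`()%classic t}.
  case: aeF => A [mA A0 hA]; exists A; split => // t ht; apply: hA => -[dF hF].
  apply: ht.
  have dG : is_derive t 1 G (F^`()%classic t - c0).
    rewrite derive1E; have -> : G = F - (fun t => c0 *: t) by [].
    have dF' : is_derive t 1 F ('D_1 F t) by apply: DeriveDef.
    apply: is_deriveB.
    rewrite -[X in is_derive _ _ _ X]mulr1.
    apply: (is_deriveZ (f := id)).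
  by split; [exact: ex_derive|rewrite derive1E derive_val subr_ge0].
suff : G a <= G b by rewrite /G; lra.
(* The Lipschitz constant is only local, so the monotonicity criterion is applied near each point
   and then globalised. *)
apply: local_nondecreasing => // x _.
have [M [dl [M0 dl0 hM]]] := locally_lipschitzP x lipF.
have mono y z : `|y - x| < dl -> `|z - x| < dl -> y <= z -> G y <= G z.
  move=> yx zx yz; apply: (@lipschitz_ae_nondecreasing G (M + `|c0|)) => //.
    by rewrite addr_ge0.
  have nb t : y <= t <= z -> `|t - x| < dl.
    move=> /andP[yt tz]; move: yx zx; rewrite !ltr_norml => /andP[? ?] /andP[? ?].
    by apply/andP; split; lra.
  move=> s t /nb sx /nb tx; rewrite mulrDl -normrM.
  rewrite /G (_ : _ - _ - _ = (F s - F t) - c0 * (s - t)); last by ring.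
  apply: le_trans (ler_normB _ _) _; rewrite lerD2r; exact: hM.
exists dl => // y _ yx; split => h; apply: mono => //; by rewrite subrr normr0.
Qed.

End monotone_from_derivative.

(** * Positivity of [Gamma] and of the normalising constants *)

Section gamma_function.
Context (R : realType).
Notation lambda := (@lebesgue_measure R).
Variable z : R.
Hypothesis z0 : 0 < z.

Let f (t : R) := t `^ (z - 1) * expR (- t).

Let f0 t : 0 <= f t. Proof. by rewrite mulr_ge0 ?powR_ge0 ?expR_ge0. Qed.

Let mf : measurable_fun setT f.
Proof.
apply: measurable_funM; first by apply: measurable_powR_comp.
by apply: (measurableT_comp (@measurable_expR R)); exact: oppr_measurable.
Qed.

(** [Gamma] is the [fine] part of an extended integral, which would be [0] if that integral were
    infinite; hence finiteness has to precede positivity. Below [1] the integrand is at most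
    [t^(-a)] with [a < 1]; beyond [1] the inequality [t^(k+1) <= (k+1)! e^t] leaves a multiple of
    [t^(-2)]. *)
Let Gamma_lty : (\int[lambda]_(t in `]0%R, +oo[) (f t)%:E < +oo)%E.
Proof.
have hm (t : R) : 0 < t -> (lambda [set x : measurableTypeR R | (`|x| < t)%R] <= (2 * t `^ 1)%:E)%E.
  move=> t0; rewrite (_ : [set x | _] = ball 0 t).
    by rewrite [X in (X <= _)%E](lebesgue_measure_ball _ (ltW t0)) (powRr1 (ltW t0)) mulr_natl.
  by apply/seteqP; split => x; rewrite /ball /= sub0r normrN.
have mN : measurable_fun [set: measurableTypeR R] (@Num.norm R R) by exact: normr_measurable.
(* The maximum with [1/2] keeps the exponent positive when [z >= 1]. *)
pose a := Num.max 2^-1 (1 - z).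
have ha : 0 < a < 1.
  by rewrite lt_max invr_gt0 ltr0n /= gt_max invf_lt1// ltr1n/= gtrBl.
have [K1 K10 hK1] := @integral_near_le _ (measurableTypeR R) R lambda (@Num.norm R R) 1 2
  mN (@normr_ge0 R R) (ler0n R 2) hm a ha.
have hb : (0 < (1 : R)) && ((1 : R) < 2) by rewrite ltr01 ltr1n.
have [K2 K20 hK2] := @integral_far_le _ (measurableTypeR R) R lambda (@Num.norm R R) 1 2
  mN (ler0n R 2) hm 2 hb.
have [k hk] : exists k : nat, z + 1 <= k.+1%:R.
  exists (Num.bound (z + 1)); have := archi_boundP (_ : 0 <= z + 1).
  have h : 0 <= z + 1 by rewrite addr_ge0// ltW.
  by move=> /(_ h) /ltW h1; apply: le_trans h1 _; rewrite ler_nat.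
pose A1 := [set x : R | (`|x| < 1)%R].
pose A2 := [set x : R | (1 <= `|x|)%R].
have mA1 : measurable A1 by exact: (measurable_sublevel mN).
have mA2 : measurable A2.
  rewrite (_ : A2 = ~` A1); first exact: measurableC.
  by apply/seteqP; split => y /=; rewrite /A2 /A1 /= leNgt => /negP.
pose g1 x : \bar R := (1 * (\1_A1 x * `|x| `^ (- a)))%:E.
pose g2 x : \bar R := ((k.+1)`!%:R * (\1_A2 x * `|x| `^ (- 2)))%:E.
have g10 y : (0 <= g1 y)%E by rewrite lee_fin !mulr_ge0// powR_ge0.
have g20 y : (0 <= g2 y)%E by rewrite lee_fin !mulr_ge0// powR_ge0.
have mg1 : measurable_fun setT g1.
  apply/measurable_EFinP; apply: measurable_funM => //; apply: measurable_funM => //.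
  exact: measurable_powR_comp.
have mg2 : measurable_fun setT g2.
  apply/measurable_EFinP; apply: measurable_funM => //; apply: measurable_funM => //.
  exact: measurable_powR_comp.
have pw : forall t, `]0, +oo[%classic t -> ((f t)%:E <= g1 t + g2 t)%E.
  move=> t /=; rewrite in_itv /= andbT => t0.
  have nt : `|t| = t by rewrite gtr0_norm.
  have [t1|t1] := ltP t 1.
    apply: (@le_trans _ _ (g1 t)); last by rewrite leeDl.
    rewrite lee_fin indicE mem_set/= /A1 /= ?nt// !mul1r.
    apply: (@le_trans _ _ (t `^ (z - 1) * 1)).
      by rewrite ler_wpM2l ?powR_ge0// -expR0 ler_expR oppr_le0 ltW.
    rewrite mulr1; have t01 : 0 < t <= 1 by rewrite t0 ltW.
    apply: ger_powR t01 _ _ _; rewrite lerNl opprB.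
    by rewrite le_max lexx orbT.
  apply: (@le_trans _ _ (g2 t)); last by rewrite leeDr.
  rewrite lee_fin indicE mem_set/= /A2 /= ?nt// mul1r /f.
  have -> : t `^ (z - 1) = t `^ (z + 1) * t `^ (- 2).
    by rewrite -powRD ?(negbT (gt_eqF t0)) ?implybT//; congr (_ `^ _); ring.
  rewrite mulrAC ler_wpM2r ?powR_ge0// expRN ler_pdivrMr ?expR_gt0//.
  apply: (@le_trans _ _ (t ^+ k.+1)).
    by rewrite -powR_mulrn ?(ltW t0)//; apply: ler_powR.
  have := expR_ge1Dxn k (ltW t0); move=> h.
  by rewrite mulrC -ler_pdivrMr ?ltr0n ?fact_gt0//; apply: le_trans h; rewrite lerDr.
apply: (@le_lt_trans _ _ (\int[lambda]_t (g1 t + g2 t))%E).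
  apply: (@le_trans _ _ (\int[lambda]_(t in `]0%R, +oo[) (g1 t + g2 t))%E).
    apply: ge0_le_integral => //.
    - by move=> x _; rewrite lee_fin.
    - by apply/measurable_EFinP; exact: (measurable_funTS mf).
    - by apply: measurable_funTS; exact: emeasurable_funD.
  apply: ge0_subset_integral => //; first exact: emeasurable_funD.
  by move=> x _; exact: adde_ge0.
have w1 : measurable_fun setT (fun x : measurableTypeR R => `|x| `^ (- a)).
  exact: measurable_powR_comp.
have w2 : measurable_fun setT (fun x : measurableTypeR R => `|x| `^ (- 2)).
  exact: measurable_powR_comp.
have E1 := integral_indicM lambda mA1 w1 (fun y => powR_ge0 _ _) ler01.
have E2 := integral_indicM lambda mA2 w2 (fun y => powR_ge0 _ _) (ler0n R (k.+1)`!).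
rewrite ge0_integralD// E1 E2.
apply: lte_add_pinfty; apply: lte_mul_pinfty => //.
- by apply: le_lt_trans (hK1 1 ltr01) (ltry _).
- by apply: le_lt_trans (hK2 1 ltr01) (ltry _).
Qed.

Lemma Gamma_gt0 : 0 < Gamma z.
Proof.
rewrite /Gamma /Rintegral; apply: fine_gt0; rewrite Gamma_lty andbT.
(* A lower bound of the integrand on [[1, 2]]: the power is minimal at one of the endpoints,
   according to the sign of [z - 1]. *)
pose c := Num.min 1 (2 `^ (z - 1)) * expR (- 2).
have c0 : 0 < c by rewrite mulr_gt0 ?expR_gt0// lt_min ltr01 powR_gt0.
apply: (@lt_le_trans _ _ (\int[lambda]_(t in `[1%R, 2%R]) (cst c%:E t))%E).
  rewrite integral_cst//= lebesgue_measure_itv /= lte_fin ltr1n -EFinB -EFinM lte_fin.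
  by rewrite mulr_gt0// subr_gt0 ltr1n.
apply: (@le_trans _ _ (\int[lambda]_(t in `[1%R, 2%R]) (f t)%:E)%E).
  apply: ge0_le_integral => //.
  - by move=> x _; rewrite lee_fin ltW.
  - by apply/measurable_EFinP; exact: (measurable_funTS mf).
  move=> t /=; rewrite in_itv /= => /andP[t1 t2]; rewrite lee_fin.
  apply: ler_pM; rewrite ?expR_ge0 ?ler_expR ?lerN2//.
  have [z1|z1] := leP 1 z.
    rewrite ge_min; apply/orP; left.
    have h1 : 1 = 1 `^ (z - 1) :> R by rewrite powR1.
    rewrite [leLHS]h1; apply: ge0_ler_powR; rewrite ?nnegrE ?subr_ge0//.
    exact: le_trans t1.
  rewrite ge_min; apply/orP; right.
  rewrite -[z - 1]opprK; apply: le_powRN => //; first exact: lt_le_trans t1.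
  by rewrite opprB subr_ge0 ltW.
apply: ge0_subset_integral => //.
- by apply/measurable_EFinP; exact: (measurable_funTS mf).
- by move=> x _; rewrite lee_fin.
- by move=> t /=; rewrite !in_itv /= andbT => /andP[t1 _]; exact: lt_le_trans t1.
Qed.

End gamma_function.

Lemma fracC_gt0 (R : realType) n (alpha : R) : 0 < alpha < 2 -> 0 < fracC n alpha.
Proof.
move=> /andP[a0 a2]; rewrite /fracC divr_gt0// !mulr_gt0 ?subr_gt0 ?powR_gt0 ?pi_gt0//.
- by apply: Gamma_gt0; rewrite divr_gt0// ltr_wpDl.
- by apply: Gamma_gt0; lra.
Qed.

Local Opaque dot enorm refl powR.

(** * Compact sets and truncated integrals *)

Section bounded_integrands.
Context (R : realType) (n : nat).
Hypothesis n0 : (0 < n)%N.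
Notation mu := (@lebesgue_rV R n).

(** The topology comes from the sup norm, which the Euclidean norm dominates. *)
Lemma nbhs_eball (x : 'rV[R]_n) (P : set 'rV[R]_n) : nbhs x P ->
  exists2 rho : R, 0 < rho & eball x rho `<=` P.
Proof.
move=> /nbhs_ballP[e /= e0 eP]; exists e => // y xy; apply: eP; split => // i j.
rewrite (ord1 i) /ball /=; apply: le_lt_trans xy.
by have := coord_le_enorm (x - y) j; rewrite !mxE.
Qed.

Lemma compact_enorm_le (rho : R) (A : set 'rV[R]_n) :
  closed A -> compact [set x | enorm x <= rho /\ A x].
Proof.
move=> cA; apply: bounded_closed_compact.
  exists rho; split; first exact: num_real.
  move=> M rM x [/= xr _]; apply: le_trans (mx_norm_le_enorm x) _.
  by apply: le_trans xr _; exact: ltW.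
apply: closedI => //.
have -> : (fun x : 'rV[R]_n => is_true (enorm x <= rho)) = (@enorm R n) @^-1` [set t | t <= rho] by [].
by apply: closed_comp; [move=> x _; exact: continuous_enorm|exact: closed_le].
Qed.

Lemma closed_halfspace (e : 'rV[R]_n) (l : R) : closed [set x | dot x e <= l].
Proof.
have -> : [set x | dot x e <= l] = (fun x : 'rV[R]_n => dot x e) @^-1` [set t | t <= l] by [].
by apply: closed_comp; [move=> x _; exact: continuous_dotl|exact: closed_le].
Qed.

(** This makes the truncated integrals finite, so that two of them may be subtracted and folded. *)
Lemma integrable_far (b M eps : R) (x : 'rV[R]_n) (h : 'rV[R]_n -> R) :
  n%:R < b -> 0 < eps -> measurable_fun setT h -> (forall y, `|h y| <= M) ->
  mu.-integrable setT
    (fun y => (\1_(~` eball x eps) y * (h y * enorm (x - y) `^ (- b)))%:E).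
Proof.
move=> nb e0 mh hM; have mE : measurable (~` eball x eps).
  by apply: measurableC; exact: measurable_eball.
have mk : measurable_fun setT (fun y : 'rV[R]_n => enorm (x - y) `^ (- b)).
  by apply: measurable_powR_comp; exact: measurable_enormB.
have M0 : 0 <= M by exact: le_trans (hM x).
apply/integrableP; split.
  apply/measurable_EFinP; apply: measurable_funM; first exact: measurable_indic.
  exact: measurable_funM.
apply: (@le_lt_trans _ _ (\int[mu]_y (M * (\1_(~` eball x eps) y * enorm (x - y) `^ (- b)))%:E)%E).
  apply: ge0_le_integral => //.
  - apply: measurableT_comp => //; apply/measurable_EFinP.
    by apply: measurable_funM; [exact: measurable_indic|exact: measurable_funM].
  - apply/measurable_EFinP; apply: measurable_funM => //.
    by apply: measurable_funM => //; exact: measurable_indic.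
  - move=> y _; rewrite lee_fin !normrM [`|\1__ _|]ger0_norm// [`|_ `^ _|]ger0_norm ?powR_ge0//.
    by rewrite mulrCA ler_wpM2r ?mulr_ge0 ?powR_ge0.
rewrite integral_indicM//; last by move=> y; exact: powR_ge0.
apply: lte_mul_pinfty; rewrite ?lee_fin//.
exact: integral_kernel_far.
Qed.

End bounded_integrands.

(** * The nonlocal operator at mirror points *)

Section comparison.
Context (R : realType) (n : nat) (alpha c0 A : R) (F : R -> R) (u : 'rV[R]_n -> R).
Hypotheses (n0 : (0 < n)%N) (halpha : 0 < alpha < 2) (hc0 : 0 < c0).
Hypothesis cF : continuous F.
Hypothesis slopeF : forall a b, a <= b -> c0 * (b - a) <= F b - F a.
Hypothesis cu : continuous u.
Hypothesis u0A : forall x, 0 < u x <= A.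
Notation mu := (@lebesgue_rV R n).
Notation beta := (n%:R + alpha).

(** To be read with [p = u (T x0)], [q = u x0], [p' = u (T y)], [q' = u y]. In the second bound the
    four terms are re-paired as [F (p - p')] with [F (q - p')] and [F (p - q')] with [F (q - q')],
    whose arguments differ by [p - q]. *)
Lemma F_slope_diff (p p' q q' : R) : p - q <= p' - q' -> p <= q ->
  F (p - p') - F (q - q') <= c0 * ((p - q) - (p' - q')) /\
  (F (p - p') - F (q - q')) + (F (p - q') - F (q - p')) <= 2 * c0 * (p - q).
Proof.
move=> h pq.
have h1 : p - p' <= q - q' by lra.
have h2 : p - p' <= q - p' by lra.
have h3 : p - q' <= q - q' by lra.
have := slopeF h1; have := slopeF h2; have := slopeF h3.
by split; lra.
Qed.

(** Summation by parts: the weights become [k1 - k2] and [k2], both nonnegative when [k1] and [k2]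
    are the kernel at [y] and at its mirror image. *)
Lemma slope_combine (b1 b2 k1 k2 w0 w : R) : 0 <= k2 -> k2 <= k1 ->
  b1 <= c0 * (w0 - w) -> b1 + b2 <= 2 * c0 * w0 ->
  b1 * k1 + b2 * k2 <= c0 * (w0 - w) * (k1 - k2) + 2 * c0 * w0 * k2.
Proof.
move=> k0 kk h1 h2.
have -> : b1 * k1 + b2 * k2 = b1 * (k1 - k2) + (b1 + b2) * k2 by ring.
by apply: lerD; apply: ler_wpM2r => //; rewrite subr_ge0.
Qed.

Lemma slope_nonpos (w0 w k1 k2 : R) : 0 <= k2 -> k2 <= k1 -> w0 <= w -> w0 <= 0 ->
  c0 * (w0 - w) * (k1 - k2) + 2 * c0 * w0 * k2 <= 0.
Proof.
move=> k0 kk ww w00; rewrite -[leRHS]addr0; apply: lerD.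
  by apply: mulr_le0_ge0; rewrite ?subr_ge0// pmulr_rle0// subr_le0.
by apply: mulr_le0_ge0 => //; rewrite pmulr_rle0// mulr_gt0.
Qed.

Definition F_bound : R := `|F A| + `|F (- A)|.

Lemma F_bound_ge0 : 0 <= F_bound. Proof. exact: addr_ge0. Qed.

Lemma F_le_bound x y : `|F (u x - u y)| <= F_bound.
Proof.
have /andP[x0 xA] := u0A x; have /andP[y0 yA] := u0A y.
have mono a b : a <= b -> F a <= F b.
  move=> ab; rewrite -subr_ge0; apply: le_trans (slopeF ab).
  by rewrite mulr_ge0 ?subr_ge0 ?(ltW hc0).
have h1 : F (u x - u y) <= F A by apply: mono; lra.
have h2 : F (- A) <= F (u x - u y) by apply: mono; lra.
rewrite ler_norml /F_bound; apply/andP; split.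
  by apply: le_trans h2; rewrite lerNl; apply: le_trans (ler_norm _) _; rewrite normrN lerDr.
by apply: le_trans h1 _; apply: le_trans (ler_norm _) _; rewrite lerDl.
Qed.

Lemma measurable_F_diff (t : R) (v : 'rV[R]_n -> R) : continuous v ->
  measurable_fun setT (fun y => F (t - v y)).
Proof.
move=> cv; apply: continuous_measurable_rV => y.
apply: (continuous_comp (f := fun y => t - v y)); last exact: cF.
by apply: continuousB; [exact: cst_continuous|exact: cv].
Qed.

Lemma fracF_truncE x eps : fracF_trunc alpha F u x eps =
  ((fracC n alpha)%:E * \int[mu]_y
    (\1_(~` eball x eps) y * (F (u x - u y) * enorm (x - y) `^ (- beta)))%:E)%E.
Proof.
congr (_ * _)%E; rewrite integral_mkcond; apply: eq_integral => y _.
by rewrite /patch indicE; case: ifP => _; rewrite ?mul1r ?mul0r// powRN.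
Qed.

Variables (e : 'rV[R]_n) (l : R).
Hypothesis e1 : dot e e = 1.
Notation T := (refl e l).

Lemma continuous_u_refl : continuous (fun y => u (T y)).
Proof. by move=> y; apply: (continuous_comp (f := T)); [exact: continuous_refl|exact: cu]. Qed.

Lemma indic_far_refl x y eps :
  \1_(~` eball (T x) eps) (T y) = \1_(~` eball x eps) y :> R.
Proof.
rewrite !indicE; congr ((_ : bool)%:R).
by apply/idP/idP; rewrite !inE /eball /= enorm_reflB.
Qed.

Lemma fracF_trunc_refl x eps : fracF_trunc alpha F u (T x) eps =
  ((fracC n alpha)%:E * \int[mu]_y
    (\1_(~` eball x eps) y * (F (u (T x) - u (T y)) * enorm (x - y) `^ (- beta)))%:E)%E.
Proof.
pose f y := (\1_(~` eball (T x) eps) y * (F (u (T x) - u y) * enorm (T x - y) `^ (- beta)))%:E.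
have mf : measurable_fun setT f.
  apply/measurable_EFinP; apply: measurable_funM.
    by apply: measurable_indic; apply: measurableC; exact: measurable_eball.
  apply: measurable_funM; first exact: measurable_F_diff.
  by apply: measurable_powR_comp; exact: measurable_enormB.
have E : (\int[mu]_y f y = \int[mu]_y
    (\1_(~` eball x eps) y * (F (u (T x) - u (T y)) * enorm (x - y) `^ (- beta)))%:E)%E.
  rewrite -(integral_refl l e1 mf); apply: eq_integral => y _.
  by rewrite /f indic_far_refl enorm_reflB.
by rewrite fracF_truncE -E.
Qed.

(** The integrand of the difference of the operators at [T x0] and [x0], once the substitution of
    [T y] for [y] has centred both kernels at [x0]. *)
Definition F_pair x0 y :=
  (F (u (T x0) - u (T y)) - F (u x0 - u y)) * enorm (x0 - y) `^ (- beta).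

Section pointwise.
Variables (x0 : 'rV[R]_n) (B : set 'rV[R]_n) (dl m eps : R).
Hypotheses (x0l : dot x0 e < l) (hle : u (T x0) <= u x0) (m0 : 0 <= m).
Hypothesis hmin : forall y, dot y e <= l -> u (T x0) - u x0 <= u (T y) - u y.
Hypothesis hB : forall y, B y -> [/\ dot y e <= l, dl <= enorm (x0 - y) &
    c0 * ((u (T x0) - u x0) - (u (T y) - u y)) *
      (enorm (x0 - y) `^ (- beta) - enorm (x0 - T y) `^ (- beta)) +
    2 * c0 * (u (T x0) - u x0) * enorm (x0 - T y) `^ (- beta) <= - m].
Hypotheses (eps0 : 0 < eps) (epsd : eps <= l - dot x0 e) (epsdl : eps <= dl).
Notation M := (2 * F_bound * (l - dot x0 e) `^ (- beta)).
Notation G := (fun y => \1_(~` eball x0 eps) y * F_pair x0 y).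

Let beta0 : 0 <= beta.
Proof. by case/andP: halpha => a0 _; rewrite addr_ge0// ltW. Qed.

Let M0 : 0 <= M.
Proof. by rewrite !mulr_ge0 ?F_bound_ge0 ?powR_ge0. Qed.

(** Outside the [eps]-ball the folded integrand is nonpositive, and at most [- m] on [B]. Inside the
    ball truncation removes the term at [y] but not the one at [T y], because [eps] is at most the
    distance to the hyperplane; that unpaired term is bounded by [M]. *)
Lemma F_pair_sym_le_half y : dot y e <= l ->
  G y + G (T y) <= - m * \1_B y + M * \1_(eball x0 eps) y.
Proof.
move=> yl.
have Tyl : l <= dot (T y) e by rewrite dot_refl//; move: yl; move: (dot y e) => t; lra.
have d0 : 0 < l - dot x0 e by rewrite subr_gt0.
have dTy : l - dot x0 e <= enorm (x0 - T y) by apply: refl_dist => //; exact: ltW.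
have farT : \1_(~` eball x0 eps) (T y) = 1 :> R.
  rewrite indicE mem_set//= /eball /=; apply/negP; rewrite -leNgt.
  exact: le_trans dTy.
have k20 : 0 <= enorm (x0 - T y) `^ (- beta) by exact: powR_ge0.
rewrite farT mul1r.
have [near|far] := ltP (enorm (x0 - y)) eps.
  have -> : \1_(~` eball x0 eps) y = 0 :> R by rewrite indicE memNset//= => /(_ near).
  have -> : \1_B y = 0 :> R.
    rewrite indicE memNset//= => By; have [_ h _] := hB By.
    by move: near; rewrite ltNge (le_trans epsdl).
  have -> : \1_(eball x0 eps) y = 1 :> R by rewrite indicE mem_set.
  rewrite mul0r add0r mulr0 add0r mulr1.
  apply: le_trans (ler_norm _) _; rewrite /F_pair normrM [X in _ * X]ger0_norm//.
  apply: ler_pM => //; last by apply: le_powRN.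
  rewrite mulr_natl mulr2n.
  by apply: le_trans (ler_normB _ _) _; rewrite lerD// F_le_bound.
have -> : \1_(~` eball x0 eps) y = 1 :> R.
  by rewrite indicE mem_set//=; apply/negP; rewrite -leNgt.
have -> : \1_(eball x0 eps) y = 0 :> R.
  by rewrite indicE memNset//= => /(le_lt_trans far); rewrite ltxx.
rewrite mul1r mulr0 addr0.
have kk : enorm (x0 - T y) `^ (- beta) <= enorm (x0 - y) `^ (- beta).
  apply: le_powRN => //; first exact: lt_le_trans far.
  by apply: enorm_refl_le => //; exact: ltW.
have [h1 h2] := F_slope_diff (hmin yl) hle.
rewrite /F_pair reflK//.
apply: le_trans (slope_combine k20 kk h1 h2) _.
have [By|nBy] := pselect (B y).
  by rewrite indicE mem_set// mulr1; have [_ _] := hB By.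
rewrite indicE memNset// mulr0; apply: slope_nonpos => //; first exact: hmin.
by rewrite subr_le0.
Qed.

Lemma F_pair_sym_le y : G y + G (T y) <=
  - m * \1_B y + M * \1_(eball x0 eps) y + M * \1_(T @^-1` eball x0 eps) y.
Proof.
have EI : \1_(T @^-1` eball x0 eps) y = \1_(eball x0 eps) (T y) :> R by [].
have [yl|ly] := leP (dot y e) l.
  apply: le_trans (F_pair_sym_le_half yl) _.
  by rewrite lerDl mulr_ge0.
have Tyl : dot (T y) e <= l by rewrite dot_refl//; move: ly; move: (dot y e) => t; lra.
have /= := F_pair_sym_le_half Tyl; rewrite (reflK l e1) => h.
rewrite /= [leLHS]addrC; apply: le_trans h _; rewrite EI.
have -> : \1_B y = 0 :> R by rewrite indicE memNset// => /hB[]; rewrite leNgt ly.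
rewrite mulr0 add0r; apply: lerD => //.
apply: (@le_trans _ _ 0); last by apply: mulr_ge0.
by rewrite mulNr oppr_le0; apply: mulr_ge0.
Qed.

End pointwise.

Lemma integrable_cst_indic (D : set 'rV[R]_n) (c : R) : measurable D ->
  mu D \is a fin_num -> mu.-integrable setT (fun y => (c * \1_D y)%:E).
Proof.
move=> mD fD.
have i1 : mu.-integrable setT (fun y => (\1_D y : R)%:E).
  apply/integrableP; split.
    by apply/measurable_EFinP; exact: measurable_indic.
  under eq_integral do rewrite gee0_abs ?lee_fin//.
  by rewrite integral_indicT// ltey_eq fD.
rewrite (_ : (fun y => _) = (fun y => c%:E * (\1_D y)%:E)%E).
  exact: integrableZl.
by apply/funext => y; rewrite EFinM.
Qed.

Lemma integral_cst_indic (D : set 'rV[R]_n) (c : R) : measurable D ->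
  mu D \is a fin_num -> (\int[mu]_y (c * \1_D y)%:E = c%:E * mu D)%E.
Proof.
move=> mD fD; under eq_integral do rewrite EFinM.
rewrite integralZl//; first by rewrite integral_indicT.
have := integrable_cst_indic 1 mD fD.
by under eq_fun do rewrite mul1r.
Qed.

(** Adding [g] to its reflection over the whole space doubles the integral of [g], so no integral
    over a half space is needed. The set [B] is counted once, hence the factor [1/2]; [E] and its
    mirror image are both counted. *)
Lemma integral_pair_le (g : 'rV[R]_n -> R) (B E : set 'rV[R]_n) (m M : R) :
  mu.-integrable setT (fun y => (g y)%:E) ->
  measurable B -> mu B \is a fin_num -> measurable E -> mu E \is a fin_num ->
  (forall y, g y + g (T y) <= - m * \1_B y + M * \1_E y + M * \1_(T @^-1` E) y) ->
  fine (\int[mu]_y (g y)%:E) <= - (m * fine (mu B) / 2) + M * fine (mu E).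
Proof.
move=> ig mB fB mE fE h.
have mg : measurable_fun setT (fun y => (g y)%:E) by have /integrableP[] := ig.
have intT : (\int[mu]_y (g (T y))%:E = \int[mu]_y (g y)%:E)%E.
  by rewrite -(integral_refl l e1 mg).
have igT : mu.-integrable setT (fun y => (g (T y))%:E).
  apply/integrableP; split.
    by apply: (measurableT_comp mg); exact: measurable_refl.
  rewrite (integral_refl l e1 (f := fun y => `|(g y)%:E|%E)).
    by have /integrableP[] := ig.
  exact: measurableT_comp.
have mET : measurable (T @^-1` E).
  by rewrite -[_ @^-1` _]setTI; exact: measurable_refl.
have muET : mu (T @^-1` E) = mu E by exact: lebesgue_refl.
have fET : mu (T @^-1` E) \is a fin_num by rewrite muET.
have iB := integrable_cst_indic (- m) mB fB.
have iE := integrable_cst_indic M mE fE.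
have iET := integrable_cst_indic M mET fET.
have iBE : mu.-integrable setT (fun y => (- m * \1_B y)%:E + (M * \1_E y)%:E)%E by exact: integrableD.
have : (\int[mu]_y ((g y)%:E + (g (T y))%:E) <=
   \int[mu]_y ((- m * \1_B y)%:E + (M * \1_E y)%:E + (M * \1_(T @^-1` E) y)%:E))%E.
  apply: le_integral => //; [exact: integrableD|exact: integrableD|].
  by move=> y _; rewrite -!EFinD lee_fin.
rewrite !integralD// intT !integral_cst_indic// muET.
have fi := integral_fune_fin_num measurableT ig.
rewrite -(fineK fi) -(fineK fB) -(fineK fE).
set a := fine _; set b := fine (mu B); set c := fine (mu E).
by rewrite -!EFinM -!EFinD lee_fin /=; move: a b c => a b c; lra.
Qed.

(** The error [M * eps] is the price of truncating around [x0] only, not around its mirror image.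
    For a tolerance [eta], a quarter is granted to each limit and a quarter to this error. *)
Lemma lim_trunc_le (J1 J2 : R -> \bar R) (C K M d l1 l2 : R) : 0 < C -> 0 < d -> 0 <= M ->
  (forall eps, 0 < eps -> J1 eps \is a fin_num /\ J2 eps \is a fin_num) ->
  (forall eps, 0 < eps -> eps <= d -> fine (J2 eps) - fine (J1 eps) <= - K + M * eps) ->
  (C%:E * J1 eps)%E @[eps --> 0^'+] --> l1%:E ->
  (C%:E * J2 eps)%E @[eps --> 0^'+] --> l2%:E ->
  l2 - l1 <= - (C * K).
Proof.
move=> C0 d0 M0 fJ hJ hl1 hl2.
apply/ler_addgt0Pr => eta eta0.
have eta4 : 0 < eta / 4 by rewrite divr_gt0.
have lim_fine (f : R -> \bar R) a : f eps @[eps --> 0^'+] --> a%:E ->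
    \forall eps \near 0^'+, `|a - fine (f eps)| < eta / 4.
  by move=> /fine_cvg /cvgrPdist_lt; apply.
have near0 c : 0 < c -> \forall eps \near (0:R)^'+, eps <= c.
  by move=> c0'; apply: nbhs_right_le.
have CM1 : 0 < C * M + 1 by rewrite ltr_wpDl// mulr_ge0// ltW.
have n3 : 0 < eta / 4 / (C * M + 1) by rewrite divr_gt0.
have [eps [eps0 epsd e3 e1' e2]] : exists eps, [/\ 0 < eps, eps <= d,
    eps <= eta / 4 / (C * M + 1), `|l1 - fine (C%:E * J1 eps)%E| < eta / 4 &
    `|l2 - fine (C%:E * J2 eps)%E| < eta / 4].
  apply: (@filter_ex _ (0:R)^'+).
  near=> eps; split; near: eps.
  - exact: nbhs_right_gt.
  - exact: near0.
  - exact: near0.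
  - exact: lim_fine hl1.
  - exact: lim_fine hl2.
have [f1 f2] := fJ eps eps0.
move: e1' e2; rewrite !fineM// [`|l1 - _|]distrC => /ltr_normlW n1 /ltr_normlW n2.
have := hJ eps eps0 epsd; move: n1 n2 e3.
rewrite ler_pdivlMr//=; move: (fine (J1 eps)) (fine (J2 eps)) => j1 j2 n1 n2 e3 h.
have h1 : C * (j2 - j1) <= C * (- K + M * eps) by rewrite ler_wpM2l// ltW.
have h2 : eps * (C * M + 1) = C * (M * eps) + eps by ring.
move: h1; rewrite mulrBr mulrDr mulrN; lra.
Unshelve. all: by end_near. Qed.

(** The common form of both uses of folding: a test ball away from [x0] forces a gap proportional to
    its volume. At a negative minimum of [w] the gain [m] comes from the second term of the bound,
    at a zero of [w] from the first. *)
Lemma fracF_comparison x0 z rho dl m l1 l2 :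
  dot x0 e < l -> u (T x0) <= u x0 -> 0 <= m ->
  (forall y, dot y e <= l -> u (T x0) - u x0 <= u (T y) - u y) ->
  0 < rho -> 0 < dl ->
  (forall y, eball z rho y -> [/\ dot y e <= l, dl <= enorm (x0 - y) &
    c0 * ((u (T x0) - u x0) - (u (T y) - u y)) *
      (enorm (x0 - y) `^ (- beta) - enorm (x0 - T y) `^ (- beta)) +
    2 * c0 * (u (T x0) - u x0) * enorm (x0 - T y) `^ (- beta) <= - m]) ->
  is_fracF alpha F u x0 l1 -> is_fracF alpha F u (T x0) l2 ->
  l2 - l1 <= - (fracC n alpha * (m * fine (mu (eball z rho)) / 2)).
Proof.
move=> x0l hle m0 hmin rho0 dl0 hB hl1 hl2.
have nbeta : n%:R < beta by case/andP: halpha => a0 _; rewrite ltrDl.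
pose M := 2 * F_bound * (l - dot x0 e) `^ (- beta).
have M0 : 0 <= M by rewrite !mulr_ge0 ?F_bound_ge0 ?powR_ge0.
have d0 : 0 < l - dot x0 e by rewrite subr_gt0.
have mB : measurable (eball z rho) by exact: measurable_eball.
have fB : mu (eball z rho) \is a fin_num by exact: lebesgue_eball_fin.
pose g1 eps y := \1_(~` eball x0 eps) y * (F (u x0 - u y) * enorm (x0 - y) `^ (- beta)).
pose g2 eps y := \1_(~` eball x0 eps) y * (F (u (T x0) - u (T y)) * enorm (x0 - y) `^ (- beta)).
have ig1 eps : 0 < eps -> mu.-integrable setT (fun y => (g1 eps y)%:E).
  move=> eps0; apply: (integrable_far n0 (M := F_bound)) => //.
    exact: measurable_F_diff.
  by move=> y; exact: F_le_bound.
have ig2 eps : 0 < eps -> mu.-integrable setT (fun y => (g2 eps y)%:E).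
  move=> eps0; apply: (integrable_far n0 (M := F_bound)) => //.
    by apply: measurable_F_diff; exact: continuous_u_refl.
  by move=> y; exact: F_le_bound.
(* For [eps <= 1/2] and [n >= 1], [(2 eps)^n <= 2 eps], so the volume of the truncation ball is an
   error linear in [eps]. *)
have d'0 : 0 < Num.min (2^-1 : R) (Num.min (l - dot x0 e) dl) by rewrite !lt_min d0 dl0 invr_gt0 ltr0n.
apply: (@lim_trunc_le (fun eps => \int[mu]_y (g1 eps y)%:E)%E
  (fun eps => \int[mu]_y (g2 eps y)%:E)%E (fracC n alpha)
  (m * fine (mu (eball z rho)) / 2) (M * 2) _ l1 l2 _ d'0); first exact: fracC_gt0.
- by rewrite mulr_ge0.
- by move=> eps eps0; split; apply: integral_fune_fin_num => //; [exact: ig1|exact: ig2].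
- move=> eps eps0; rewrite !le_min => /and3P[epsh epsd epsdl].
  have fi1 := integral_fune_fin_num measurableT (ig1 _ eps0).
  have fi2 := integral_fune_fin_num measurableT (ig2 _ eps0).
  have GE : (fun y => (\1_(~` eball x0 eps) y * F_pair x0 y)%:E) =
      (fun y => (g2 eps y)%:E - (g1 eps y)%:E)%E.
    by apply/funext => y; rewrite -EFinB /g1 /g2 /F_pair -mulrBr -mulrBl.
  have iG : mu.-integrable setT (fun y => (\1_(~` eball x0 eps) y * F_pair x0 y)%:E).
    by rewrite GE; apply: integrableB => //; [exact: ig2|exact: ig1].
  have mE : measurable (eball x0 eps) by exact: measurable_eball.
  have fE : mu (eball x0 eps) \is a fin_num by exact: lebesgue_eball_fin.
  have := @integral_pair_le _ (eball z rho) (eball x0 eps) m M iG mB fB mE fE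
     (fun y => F_pair_sym_le x0l hle m0 hmin hB eps0 epsd epsdl y).
  rewrite GE integralB//; [|exact: ig2|exact: ig1].
  rewrite fineB// => h; apply: le_trans h _; rewrite lerD2l -mulrA ler_wpM2l//.
  rewrite -lee_fin fineK//; apply: le_trans (lebesgue_eball_le _ eps0) _.
  rewrite lee_fin (_ : eps *+ 2 = 2 * eps); last by rewrite mulr_natl.
  have : (2 * eps) ^+ n <= (2 * eps) ^+ 1.
    apply: ler_wiXn2l => //; first by rewrite mulr_ge0// ltW.
    by move: epsh; lra.
  by rewrite expr1.
- by move: hl1; rewrite /is_fracF; under eq_fun do rewrite fracF_truncE.
- by move: hl2; rewrite /is_fracF; under eq_fun do rewrite fracF_trunc_refl.
Qed.

End comparison.

(** * Convexity of powers and comparison of Riesz potentials *)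

(** Young's inequality for [a] and [b^(q - 1)] with the conjugate exponents [q] and [q / (q - 1)];
    no differentiation is involved and [a = 0] is included. *)
Lemma powR_tangent (R : realType) (a b q : R) : 0 <= a -> 0 < b -> 1 < q ->
  b `^ q + q * b `^ (q - 1) * (a - b) <= a `^ q.
Proof.
move=> a0 b0 q1; have q0 : 0 < q by exact: lt_trans q1.
have q10 : 0 < q - 1 by rewrite subr_gt0.
have q' : 0 < q / (q - 1) by rewrite divr_gt0.
have E : q^-1 + (q / (q - 1))^-1 = 1.
  by rewrite invf_div; field; rewrite !gt_eqF.
have := conjugate_powR a0 (powR_ge0 b (q - 1)) q0 q' E.
have -> : (b `^ (q - 1)) `^ (q / (q - 1)) = b `^ q.
  by rewrite -powRrM; congr (_ `^ _); field; rewrite gt_eqF.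
have -> : b `^ q = b `^ (q - 1) * b.
  rewrite -[X in _ * X](powRr1 (ltW b0)) -powRD ?subrK//.
  by rewrite (negbT (gt_eqF b0)) implybT.
set B := b `^ (q - 1); set Z := a `^ q => h.
have h2 : q * (a * B) <= q * (Z / q + B * b / (q / (q - 1))) by rewrite ler_wpM2l// ltW.
have h3 : q * (Z / q + B * b / (q / (q - 1))) = Z + (q - 1) * (B * b).
  by field; rewrite !gt_eqF.
by move: h2; rewrite h3; lra.
Qed.

Section potential.
Context (R : realType) (n : nat) (u : 'rV[R]_n -> R) (s2 : R).
Hypothesis n0 : (0 < n)%N.
Hypothesis cu : continuous u.
Hypothesis u0 : forall x, 0 < u x.
Notation mu := (@lebesgue_rV R n).

(** Here [s2] stands for [2 s]. The exponent [p] will be [q] in the equation and [q - 1] in the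
    linearised bound. *)
Definition potential p x : \bar R :=
  (\int[mu]_y (u y `^ p * enorm (x - y) `^ (s2 - n%:R))%:E)%E.

Let mu_ : measurable_fun setT u. Proof. exact: continuous_measurable_rV. Qed.

Let mK x : measurable_fun setT (fun y : 'rV[R]_n => enorm (x - y) `^ (s2 - n%:R)).
Proof. by apply: measurable_powR_comp; exact: measurable_enormB. Qed.

Lemma potential_ge0 p x : (0 <= potential p x)%E.
Proof. by apply: integral_ge0 => y _; rewrite lee_fin mulr_ge0// powR_ge0. Qed.

(** The Riesz decay estimate with [b = p * gamma], applied to [u^p] divided by [A^p]. *)
Lemma potential_le A gamma p : 0 < A -> (forall x, u x <= A * jap x `^ (- gamma)) ->
  0 < p -> 0 < s2 -> s2 < p * gamma -> p * gamma < n%:R ->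
  exists2 K : R, 0 <= K &
    forall x, (potential p x <= (K * jap x `^ (s2 - p * gamma))%:E)%E.
Proof.
move=> A0 uA p0 s0 sp pn.
have [K K0 hK] := riesz_decay n0 s0 sp pn.
exists (A `^ p * K); first by rewrite mulr_ge0// powR_ge0.
move=> x; have Ap : 0 < A `^ p by exact: powR_gt0.
pose f y := (A `^ p)^-1 * u y `^ p.
have mf : measurable_fun setT f.
  by apply: measurable_funM => //; exact: measurable_powR_comp.
have hf y : 0 <= f y <= jap y `^ (- (p * gamma)).
  apply/andP; split; first by rewrite /f mulr_ge0 ?invr_ge0 ?powR_ge0.
  have E : (A * jap y `^ (- gamma)) `^ p = A `^ p * jap y `^ (- (p * gamma)).
    rewrite powRM ?powR_ge0 ?(ltW A0)// -powRrM.
    by congr (_ * _ `^ _); ring.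
  rewrite /f ler_pdivrMl// -E.
  apply: ge0_ler_powR; rewrite ?nnegrE ?(ltW p0) ?(ltW (u0 y))//.
  by rewrite mulr_ge0 ?powR_ge0// ltW.
have := hK f x mf hf.
have -> : potential p x = ((A `^ p)%:E * \int[mu]_y (f y * enorm (x - y) `^ (s2 - n%:R))%:E)%E.
  rewrite -ge0_integralZl_EFin//; last 3 first.
  - by move=> y _; rewrite lee_fin mulr_ge0 ?powR_ge0//; have /andP[] := hf y.
  - by apply/measurable_EFinP; exact: measurable_funM.
  - exact: ltW.
  apply: eq_integral => y _; rewrite -EFinM /f !mulrA mulfV ?mul1r//.
  by rewrite gt_eqF.
move=> h; rewrite -mulrA EFinM; apply: lee_wpmul2l => //.
by rewrite lee_fin ltW.
Qed.

Variables (e : 'rV[R]_n) (l q : R).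
Hypothesis e1 : dot e e = 1.
Hypothesis sn : s2 < n%:R.
Notation T := (refl e l).

Let integrable_potential (v : 'rV[R]_n -> R) x p : continuous v ->
  (\int[mu]_y (v y `^ p * enorm (x - y) `^ (s2 - n%:R))%:E)%E \is a fin_num ->
  mu.-integrable setT (fun y => (v y `^ p * enorm (x - y) `^ (s2 - n%:R))%:E).
Proof.
move=> cv fi; apply/integrableP; split.
  apply/measurable_EFinP; apply: measurable_funM => //.
  by apply: measurable_powR_comp; exact: continuous_measurable_rV.
rewrite (eq_integral (fun y => (v y `^ p * enorm (x - y) `^ (s2 - n%:R))%:E)).
  by rewrite ltey_eq fi.
by move=> y _; rewrite gee0_abs// lee_fin mulr_ge0// powR_ge0.
Qed.

Lemma integral_sym_le (g J : 'rV[R]_n -> R) :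
  mu.-integrable setT (fun y => (g y)%:E) -> mu.-integrable setT (fun y => (J y)%:E) ->
  (forall y, g y + g (T y) <= J y + J (T y)) ->
  (\int[mu]_y (g y)%:E <= \int[mu]_y (J y)%:E)%E.
Proof.
move=> ig iJ h.
have refl_int (f : 'rV[R]_n -> R) : mu.-integrable setT (fun y => (f y)%:E) ->
    mu.-integrable setT (fun y => (f (T y))%:E) /\
    (\int[mu]_y (f (T y))%:E = \int[mu]_y (f y)%:E)%E.
  move=> /integrableP[mf fi]; split; last by rewrite -(integral_refl l e1 mf).
  apply/integrableP; split.
    by apply: (measurableT_comp mf); exact: measurable_refl.
  rewrite (integral_refl l e1 (f := fun y => `|(f y)%:E|%E))//.
  exact: measurableT_comp.
have [igT EgT] := refl_int _ ig; have [iJT EJT] := refl_int _ iJ.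
have : (\int[mu]_y ((g y)%:E + (g (T y))%:E) <= \int[mu]_y ((J y)%:E + (J (T y))%:E))%E.
  apply: le_integral => //; [exact: integrableD|exact: integrableD|].
  by move=> y _; rewrite -!EFinD lee_fin.
rewrite !integralD// EgT EJT.
rewrite -(fineK (integral_fune_fin_num measurableT ig)).
rewrite -(fineK (integral_fune_fin_num measurableT iJ)).
by rewrite -!EFinD !lee_fin; lra.
Qed.

Lemma potential_refl p x : potential p (T x) =
  (\int[mu]_y (u (T y) `^ p * enorm (x - y) `^ (s2 - n%:R))%:E)%E.
Proof.
have mf : measurable_fun setT (fun y => (u y `^ p * enorm (T x - y) `^ (s2 - n%:R))%:E).
  by apply/measurable_EFinP; apply: measurable_funM => //; exact: measurable_powR_comp.
rewrite /potential -(integral_refl l e1 mf); apply: eq_integral => y _.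
by rewrite enorm_reflB.
Qed.

(* At [y = x0] the kernel takes the junk value [0], whence the hypothesis
   [u (T x0) <= u x0]. *)
Lemma potential_comparison x0 th : 0 <= th -> dot x0 e < l -> u (T x0) <= u x0 -> 0 < q ->
  (forall y, dot y e <= l -> u y `^ q - u (T y) `^ q <= th * u y `^ (q - 1)) ->
  potential q x0 \is a fin_num -> potential q (T x0) \is a fin_num ->
  potential (q - 1) x0 \is a fin_num ->
  fine (potential q x0) - fine (potential q (T x0)) <= th * fine (potential (q - 1) x0).
Proof.
move=> th0 x0l hle q0 hth f1 f2 f3.
pose k y := enorm (x0 - y) `^ (s2 - n%:R).
have k0 y : 0 <= k y by exact: powR_ge0.
have cuT : continuous (fun y => u (T y)).
  by move=> y; apply: (continuous_comp (f := T)); [exact: continuous_refl|exact: cu].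
have i1 := integrable_potential cu f1.
have i3 := integrable_potential cu f3.
have i2 : mu.-integrable setT (fun y => (u (T y) `^ q * k y)%:E).
  move: (f2); rewrite potential_refl => f2'.
  exact: (integrable_potential cuT f2').
pose g y := (u y `^ q - u (T y) `^ q) * k y.
pose J y := th * (u y `^ (q - 1) * k y).
have gE : (fun y => (g y)%:E) = (fun y => (u y `^ q * k y)%:E - (u (T y) `^ q * k y)%:E)%E.
  by apply/funext => y; rewrite -EFinB /g mulrBl.
have ig : mu.-integrable setT (fun y => (g y)%:E) by rewrite gE; exact: integrableB.
have JE : (fun y => (J y)%:E) = (fun y => th%:E * (u y `^ (q - 1) * k y)%:E)%E.
  by apply/funext => y; rewrite -EFinM.
have iJ : mu.-integrable setT (fun y => (J y)%:E) by rewrite JE; exact: integrableZl.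
have J0 y : 0 <= J y by rewrite /J !mulr_ge0// powR_ge0.
have half y : dot y e <= l -> g y + g (T y) <= J y.
  move=> yl.
  (* The folded integrand is a product whose kernel factor is nonnegative away from [x0], so the
     one-sided bound on the difference of powers suffices. *)
  have -> : g y + g (T y) = (u y `^ q - u (T y) `^ q) * (k y - k (T y)).
    by rewrite /g (reflK l e1); move: (u y `^ q) (u (T y) `^ q) (k y) (k (T y)) => *; ring.
  have [yx|yx] := eqVneq y x0.
    apply: (@le_trans _ _ 0) => //; rewrite yx.
    have -> : k x0 = 0.
      by rewrite /k subrr enorm0 powR0// lt_eqF// subr_lt0.
    rewrite sub0r; apply: mulr_ge0_le0; last by rewrite oppr_le0.
    rewrite subr_ge0; apply: ge0_ler_powR; rewrite ?nnegrE ?(ltW q0) ?(ltW (u0 _))//.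
  have kk : k (T y) <= k y.
    have Es : s2 - n%:R = - (n%:R - s2) by rewrite opprB.
    rewrite /k Es; apply: le_powRN; last by rewrite subr_ge0 ltW.
      rewrite lt_neqAle enorm_ge0 andbT eq_sym; apply: contra_neq yx => /enorm_eq0/eqP.
      by rewrite subr_eq0 => /eqP.
    by apply: enorm_refl_le => //; exact: ltW.
  apply: (@le_trans _ _ (th * u y `^ (q - 1) * (k y - k (T y)))).
    by rewrite ler_wpM2r ?subr_ge0// hth.
  rewrite /J -mulrA ler_wpM2l// ler_wpM2l ?powR_ge0//.
  by rewrite gerBl; exact: k0.
have sym y : g y + g (T y) <= J y + J (T y).
  have [yl|ly] := leP (dot y e) l.
    by apply: le_trans (half y yl) _; rewrite lerDl.
  have Tyl : dot (T y) e <= l by rewrite dot_refl//; move: ly; move: (dot y e) => t; lra.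
  have h : g (T y) + g y <= J (T y) by have := half _ Tyl; rewrite (reflK l e1).
  by rewrite [g y + _]addrC; apply: le_trans h _; rewrite lerDr.
have := integral_sym_le ig iJ sym.
have Eq1 : (\int[mu]_y (u y `^ q * k y)%:E = potential q x0)%E by [].
have Eq3 : (\int[mu]_y (u y `^ (q - 1) * k y)%:E = potential (q - 1) x0)%E by [].
rewrite gE JE integralB// integralZl// -potential_refl Eq1 Eq3.
by rewrite -(fineK f1) -(fineK f2) -(fineK f3) -EFinB -EFinM lee_fin.
Qed.

End potential.

(** * Decay of the solution *)

Section decay.
Context (R : realType) (n : nat) (u : 'rV[R]_n -> R) (gamma : R).
Hypothesis cu : continuous u.
Hypothesis u0 : forall x, 0 < u x.
Hypothesis g0 : 0 < gamma.

(** Beyond [R0] one has [jap x <= (1 + 1 / R0) |x|]; on the remaining compact ball [u] is bounded.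
    The final [+ 1] in [A] makes it positive. *)
Lemma decay_bound : sim_at_infinity u gamma ->
  exists2 A : R, 0 < A & forall x, u x <= A * jap x `^ (- gamma).
Proof.
move=> [c [C [R0 [c0 cC R00 hd]]]].
have [M hM] : exists M, forall x, enorm x <= R0 -> u x <= M.
  have cK := @compact_enorm_le R n R0 setT closedT.
  have ne : [set x : 'rV[R]_n | enorm x <= R0 /\ setT x] !=set0.
    by exists 0; split => //=; rewrite enorm0 ltW.
  have [x xK hx] := EVT_max_rV (f := u) (A := [set x | enorm x <= R0 /\ setT x])
    ne cK (continuous_subspaceT cu).
  by exists (u x) => y yR; apply: hx; rewrite inE.
pose A := Num.max (C * (1 + R0^-1) `^ gamma) (`|M| * (1 + R0) `^ gamma) + 1.
have C0 : 0 < C by exact: lt_le_trans cC.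
have A0 : 0 < A.
  by rewrite ltr_wpDl// le_max mulr_ge0 ?powR_ge0// ltW.
exists A => // x.
have j0 : 0 < jap x `^ gamma by rewrite powR_gt0// jap_gt0.
rewrite powRN ler_pdivlMr//.
apply: (@le_trans _ _ (Num.max (C * (1 + R0^-1) `^ gamma) (`|M| * (1 + R0) `^ gamma))); last first.
  by rewrite /A lerDl.
rewrite le_max; have [xR|xR] := leP R0 (enorm x).
  have x0 : 0 < enorm x by exact: lt_le_trans xR.
  apply/orP; left; have /andP[_ h] := hd x xR.
  apply: (@le_trans _ _ (C * enorm x `^ (- gamma) * jap x `^ gamma)).
    by rewrite ler_wpM2r// ltW.
  rewrite -mulrA ler_wpM2l ?(ltW C0)// mulrC powRN ler_pdivrMr ?powR_gt0//.
  rewrite -powRM ?(ltW x0)//; last by rewrite addr_ge0 ?invr_ge0 ?(ltW R00).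
  apply: ge0_ler_powR; rewrite ?nnegrE ?(ltW g0) ?(ltW (jap_gt0 _))//.
    by rewrite mulr_ge0 ?(ltW x0)// addr_ge0 ?invr_ge0 ?(ltW R00).
  rewrite /jap mulrDl mul1r addrC lerD2l mulrC ler_pdivlMr// mul1r//.
apply/orP; right; apply: ler_pM; rewrite ?(ltW (u0 _)) ?powR_ge0//.
  by apply: le_trans (ler_norm _); apply: hM; exact: ltW.
apply: ge0_ler_powR; rewrite ?nnegrE ?(ltW g0) ?(ltW (jap_gt0 _))//.
  by rewrite addr_ge0// ltW.
by rewrite /jap lerD2l ltW.
Qed.

Lemma decay_to0 A : 0 < A -> (forall x, u x <= A * jap x `^ (- gamma)) ->
  forall eps, 0 < eps -> exists rho : R, forall x, rho <= enorm x -> u x < eps.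
Proof.
move=> A0 uA eps eps0; exists ((A / eps) `^ gamma^-1) => x hx.
apply: le_lt_trans (uA x) _.
have j0 : 0 < jap x `^ gamma by rewrite powR_gt0// jap_gt0.
rewrite powRN ltr_pdivrMr// mulrC -ltr_pdivrMr//.
have -> : A / eps = ((A / eps) `^ gamma^-1) `^ gamma.
  by rewrite -powRrM mulVf ?gt_eqF// powRr1// ltW// divr_gt0.
apply: gt0_ltr_powR; rewrite ?nnegrE ?powR_ge0 ?(ltW (jap_gt0 _))//.
by apply: le_lt_trans hx _; rewrite /jap ltrDr.
Qed.

End decay.

(** * The equation at mirror points: negative minima and strong maximum principle *)

Lemma tangent_bound (R : realFieldType) (q a b c d d' t t' : R) : 0 <= q * c ->
  t' - t <= d' - d -> a + q * c * (d' - d) <= b -> a - b <= q * (t - t') * c.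
Proof.
move=> qc h h2; have : 0 <= q * c * ((d' - d) - (t' - t)) by rewrite mulr_ge0// subr_ge0.
by lra.
Qed.

(** Here [t = u x0] and [t' = u (T x0)], [a] and [a'] are their [r]-th powers, [b = t^(r - 1)], [v1]
    and [v2] are the potentials at the two points and [w] is the potential with exponent [q - 1].
    The product is split as [(v1 - v2) a' + v1 (a - a')], and the term with [omega] has the
    favourable sign. *)
Lemma refl_equation_alg (R : realFieldType) (C omega q r l1 l2 a a' b t t' v1 v2 w : R) :
  0 <= C -> 0 <= omega -> 0 <= r -> 0 <= t - t' -> 0 <= q * (t - t') -> 0 <= v1 ->
  0 <= w -> 0 <= a' -> a + r * b * (t' - t) <= a' -> a' <= a ->
  v1 - v2 <= q * (t - t') * w ->
  l1 + omega * t = C * v1 * a -> l2 + omega * t' = C * v2 * a' ->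
  l1 - l2 <= C * (t - t') * (q * w * a + r * v1 * b).
Proof.
move=> C0 omega0 r0 w0 th0 v10 I0 a'0 htan hmono hv eq1 eq2.
have -> : l1 - l2 = C * (v1 * a - v2 * a') - omega * (t - t') by lra.
apply: (@le_trans _ _ (C * (v1 * a - v2 * a'))); first by rewrite gerBl mulr_ge0.
rewrite -mulrA ler_wpM2l//.
have h1 : (v1 - v2) * a' <= q * (t - t') * w * a' by rewrite ler_wpM2r.
have h2 : q * (t - t') * w * a' <= q * (t - t') * w * a.
  by rewrite ler_wpM2l// mulr_ge0.
have h3 : v1 * (a - a') <= v1 * (r * b * (t - t')).
  by rewrite ler_wpM2l//; move: htan; rewrite -opprB mulrN; lra.
have -> : v1 * a - v2 * a' = (v1 - v2) * a' + v1 * (a - a') by ring.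
have -> : (t - t') * (q * w * a + r * v1 * b) =
  q * (t - t') * w * a + v1 * (r * b * (t - t')) by ring.
by lra.
Qed.

Section moving_planes.
Context (R : realType) (n : nat) (alpha s2 omega r q gamma c0 A C2 K1 K2 : R)
  (F : R -> R) (u : 'rV[R]_n -> R).
Hypotheses (n0 : (0 < n)%N) (halpha : 0 < alpha < 2) (hc0 : 0 < c0).
Hypotheses (omega0 : 0 <= omega) (hr : 1 < r) (hq : 1 < q) (sn : s2 < n%:R).
Hypotheses (A0 : 0 < A) (C20 : 0 < C2) (K10 : 0 <= K1) (K20 : 0 <= K2).
Hypothesis cF : continuous F.
Hypothesis slopeF : forall a b, a <= b -> c0 * (b - a) <= F b - F a.
Hypothesis cu : continuous u.
Hypothesis u0 : forall x, 0 < u x.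
Hypothesis g0 : 0 < gamma.
Hypothesis uA : forall x, u x <= A * jap x `^ (- gamma).
Hypothesis pot1 : forall x, (potential u s2 q x <= (K1 * jap x `^ (s2 - q * gamma))%:E)%E.
Hypothesis pot2 : forall x,
  (potential u s2 (q - 1) x <= (K2 * jap x `^ (s2 - (q - 1) * gamma))%:E)%E.
Notation v x := (fine (potential u s2 q x)).
Notation mu := (@lebesgue_rV R n).
Notation beta := (n%:R + alpha).
Hypothesis equ : forall x, exists lx, is_fracF alpha F u x lx /\
  lx + omega * u x = C2 * v x * u x `^ r.

(** The margin in the condition [gamma > (2 s + alpha) / (r - 1 + q)], cleared of its
    denominator. *)
Let delta := (q + r - 1) * gamma - s2 - alpha.

Let alpha0 : 0 < alpha. Proof. by case/andP: halpha. Qed.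

Let u0A x : 0 < u x <= A.
Proof.
rewrite u0; apply: le_trans (uA x) _; rewrite ler_piMr ?(ltW A0)//.
have <- : jap x `^ 0 = 1 by rewrite powRr0.
by apply: ler_powR; [exact: jap_ge1|rewrite oppr_le0 ltW].
Qed.

Let fin_le (p c : R) x : (potential u s2 p x <= c%:E)%E -> potential u s2 p x \is a fin_num.
Proof.
move=> h; rewrite ge0_fin_numE ?potential_ge0//; exact: le_lt_trans h (ltry _).
Qed.

Let fp1 x : potential u s2 q x \is a fin_num. Proof. exact: fin_le (pot1 x). Qed.

Let fp2 x : potential u s2 (q - 1) x \is a fin_num. Proof. exact: fin_le (pot2 x). Qed.

Let v_le x : v x <= K1 * jap x `^ (s2 - q * gamma).
Proof. by rewrite -lee_fin fineK. Qed.

Let v_ge0 x : 0 <= v x. Proof. by rewrite fine_ge0// potential_ge0. Qed.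

Let w_ge0 x : 0 <= fine (potential u s2 (q - 1) x).
Proof. by rewrite fine_ge0// potential_ge0. Qed.

Let w_le x : fine (potential u s2 (q - 1) x) <= K2 * jap x `^ (s2 - (q - 1) * gamma).
Proof. by rewrite -lee_fin fineK. Qed.

Let u_pow_le x p : 0 < p -> u x `^ p <= A `^ p * jap x `^ (- (p * gamma)).
Proof.
move=> p0.
have -> : A `^ p * jap x `^ (- (p * gamma)) = (A * jap x `^ (- gamma)) `^ p.
  rewrite powRM ?powR_ge0 ?(ltW A0)// -powRrM.
  by congr (_ * _ `^ _); ring.
apply: ge0_ler_powR; rewrite ?nnegrE ?(ltW p0) ?(ltW (u0 x))//.
by rewrite mulr_ge0 ?powR_ge0// ltW.
Qed.

(** Both terms have total exponent [s2 - (q + r - 1) gamma = - (alpha + delta)]: lowering a power of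
    [u] by one costs the same decay inside the potential as outside. *)
Lemma source_decay x :
  q * fine (potential u s2 (q - 1) x) * u x `^ r + r * v x * u x `^ (r - 1) <=
  (q * K2 * A `^ r + r * K1 * A `^ (r - 1)) * jap x `^ (- (alpha + delta)).
Proof.
have r0 : 0 < r by exact: lt_trans hr.
have q0 : 0 < q by exact: lt_trans hq.
have jn : jap x != 0 by rewrite gt_eqF// jap_gt0.
have E1 : jap x `^ (- (alpha + delta)) = jap x `^ (s2 - (q - 1) * gamma) * jap x `^ (- (r * gamma)).
  by rewrite -powRD ?jn ?implybT//; congr (_ `^ _); rewrite /delta; ring.
have E2 : jap x `^ (- (alpha + delta)) = jap x `^ (s2 - q * gamma) * jap x `^ (- ((r - 1) * gamma)).
  by rewrite -powRD ?jn ?implybT//; congr (_ `^ _); rewrite /delta; ring.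
rewrite mulrDl; apply: lerD.
  apply: (@le_trans _ _ (q * ((K2 * jap x `^ (s2 - (q - 1) * gamma)) * (A `^ r * jap x `^ (- (r * gamma)))))).
    by rewrite -mulrA ler_pM2l//; apply: ler_pM; rewrite ?powR_ge0 ?u_pow_le.
  by rewrite E1 le_eqVlt; apply/orP; left; apply/eqP; ring.
apply: (@le_trans _ _ (r * ((K1 * jap x `^ (s2 - q * gamma)) * (A `^ (r - 1) * jap x `^ (- ((r - 1) * gamma)))))).
  by rewrite -mulrA ler_pM2l//; apply: ler_pM; rewrite ?powR_ge0 ?u_pow_le ?subr_gt0.
by rewrite E2 le_eqVlt; apply/orP; left; apply/eqP; ring.
Qed.

Section one_plane.
Variables (e : 'rV[R]_n) (l : R).
Hypothesis e1 : dot e e = 1.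
Notation T := (refl e l).

(** Minimality bounds [u y - u (T y)] by its value at [x0], so the tangent inequality bounds the
    difference of [q]-th powers by [q (u x0 - u (T x0))] times [u y ^ (q - 1)]. This is where the
    potential with exponent [q - 1] originates. *)
Lemma refl_equation x0 l1 l2 :
  dot x0 e < l -> u (T x0) <= u x0 ->
  (forall y, dot y e <= l -> u (T x0) - u x0 <= u (T y) - u y) ->
  l1 + omega * u x0 = C2 * v x0 * u x0 `^ r ->
  l2 + omega * u (T x0) = C2 * v (T x0) * u (T x0) `^ r ->
  l1 - l2 <= C2 * (u x0 - u (T x0)) *
    (q * fine (potential u s2 (q - 1) x0) * u x0 `^ r + r * v x0 * u x0 `^ (r - 1)).
Proof.
move=> x0l hle hmin eq1 eq2.
have r0 : 0 < r by exact: lt_trans hr.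
have q0 : 0 < q by exact: lt_trans hq.
have w0 : 0 <= u x0 - u (T x0) by rewrite subr_ge0.
have hth y : dot y e <= l ->
    u y `^ q - u (T y) `^ q <= q * (u x0 - u (T x0)) * u y `^ (q - 1).
  move=> yl; apply: tangent_bound (hmin y yl) _.
    by rewrite mulr_ge0 ?powR_ge0// ltW.
  exact: powR_tangent (ltW (u0 (T y))) (u0 y) hq.
have th0 : 0 <= q * (u x0 - u (T x0)) by rewrite mulr_ge0// ltW.
have hv := potential_comparison cu u0 e1 sn th0 x0l hle q0 hth (fp1 x0) (fp1 (T x0)) (fp2 x0).
have htan := powR_tangent (ltW (u0 (T x0))) (u0 x0) hr.
have hmono : u (T x0) `^ r <= u x0 `^ r.
  by apply: ge0_ler_powR; rewrite ?nnegrE ?(ltW r0) ?(ltW (u0 _)).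
exact: (refl_equation_alg (ltW C20) omega0 (ltW r0) w0 th0 (v_ge0 x0) (w_ge0 x0)
  (powR_ge0 (u (T x0)) r) htan hmono hv eq1 eq2).
Qed.

Lemma ball_measure_le (z : 'rV[R]_n) d : 0 < d ->
  (2 / n.+1%:R) ^+ n * d `^ n%:R <= fine (mu (eball z d)).
Proof.
move=> d0; rewrite -lee_fin fineK ?lebesgue_eball_fin//.
apply: le_trans (lebesgue_eball_ge z d0).
rewrite lee_fin powR_mulrn ?(ltW d0)// -exprMn le_eqVlt; apply/orP; left; apply/eqP.
by congr (_ ^+ _); rewrite -mulr_natl; ring.
Qed.

(* The reflected test ball is centred at [x0 - 2 d e], so it lies at distance
   at least [d] from [x0] and its mirror image within [5 d] of [x0]. *)
Lemma fracF_gap x0 l1 l2 :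
  dot x0 e < l -> u (T x0) <= u x0 ->
  (forall y, dot y e <= l -> u (T x0) - u x0 <= u (T y) - u y) ->
  is_fracF alpha F u x0 l1 -> is_fracF alpha F u (T x0) l2 ->
  fracC n alpha * c0 * (2 / n.+1%:R) ^+ n * 5 `^ (- beta) * (u x0 - u (T x0)) *
    (l - dot x0 e) `^ (- alpha) <= l1 - l2.
Proof.
move=> x0l hle hmin hl1 hl2.
pose d := l - dot x0 e.
have d0 : 0 < d by rewrite subr_gt0.
have C0 : 0 < fracC n alpha by exact: fracC_gt0.
have w0 : 0 <= u x0 - u (T x0) by rewrite subr_ge0.
have beta0 : 0 <= beta by rewrite addr_ge0// ltW.
pose z := x0 - (2 * d) *: e.
(* Only the second term of the slope bound is kept, the first being nonpositive. The kernel power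
   [d^(- beta)] times the ball volume [d^n] will leave [d^(- alpha)]. *)
pose m := 2 * c0 * (u x0 - u (T x0)) * (5 * d) `^ (- beta).
have m0 : 0 <= m by rewrite !mulr_ge0 ?powR_ge0// ltW.
have ne : enorm e = 1 by rewrite enormE e1 sqrtr1.
have hB y : eball z d y -> [/\ dot y e <= l, d <= enorm (x0 - y) &
    c0 * ((u (T x0) - u x0) - (u (T y) - u y)) *
      (enorm (x0 - y) `^ (- beta) - enorm (x0 - T y) `^ (- beta)) +
    2 * c0 * (u (T x0) - u x0) * enorm (x0 - T y) `^ (- beta) <= - m].
  rewrite /eball /= => zy.
  have xz : enorm (x0 - z) = 2 * d.
    by rewrite /z opprB addrC subrK enormZ ne mulr1 gtr0_norm// mulr_gt0.
  have yl : dot y e <= l.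
    have : dot (y - z) e <= enorm (y - z) * enorm e by exact: cauchy_schwarz.
    rewrite ne mulr1 enormB dotBl {1}/z dotBl dotZl e1 => h.
    by move: h zy d0; rewrite /d; move: (enorm _) (dot y e) (dot x0 e) => *; lra.
  have far : d <= enorm (x0 - y).
    have := enorm_triangle x0 y z; rewrite xz (enormB y z).
    by move: zy; move: (enorm _) (enorm _) => *; lra.
  have Tyl : l <= dot (T y) e.
    by rewrite dot_refl//; move: yl; move: (dot y e) => *; lra.
  have dTy : d <= enorm (x0 - T y) by apply: refl_dist => //; exact: ltW.
  have T5 : enorm (x0 - T y) <= 5 * d.
    rewrite -enorm_refl_swap//.
    have Tx : T x0 - x0 = (2 * d) *: e.
      exact: refl_subE.
    have h1 := enorm_triangle (T x0) x0 y; have h2 := enorm_triangle x0 z y.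
    have h3 : enorm (T x0 - x0) = 2 * d by rewrite Tx enormZ ne mulr1 gtr0_norm// mulr_gt0.
    move: h1 h2 zy; rewrite h3 xz.
    by move: (enorm (T x0 - y)) (enorm (x0 - y)) (enorm (z - y)) => *; lra.
  split => //.
  have k2 : (5 * d) `^ (- beta) <= enorm (x0 - T y) `^ (- beta).
    by apply: le_powRN => //; exact: lt_le_trans dTy.
  have kk : enorm (x0 - T y) `^ (- beta) <= enorm (x0 - y) `^ (- beta).
    apply: le_powRN => //; first exact: lt_le_trans far.
    by apply: enorm_refl_le => //; exact: ltW.
  have hm := hmin y yl.
  move: kk k2 hm w0; rewrite /m.
  move: (enorm (x0 - T y) `^ _) (enorm (x0 - y) `^ _) ((5 * d) `^ _) (u (T y)) (u y) (u (T x0)) (u x0).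
  move=> k2 k1 k5 a b a0 b0 kk k25 hm w0.
  have h1 : 0 <= c0 * ((a - b) - (a0 - b0)) * (k1 - k2).
    by rewrite !mulr_ge0 ?subr_ge0// ltW.
  have h2 : 2 * c0 * (b0 - a0) * k5 <= 2 * c0 * (b0 - a0) * k2.
    by rewrite ler_wpM2l// !mulr_ge0// ltW.
  have -> : c0 * (a0 - b0 - (a - b)) * (k1 - k2) = - (c0 * ((a - b) - (a0 - b0)) * (k1 - k2)) by ring.
  have -> : 2 * c0 * (a0 - b0) * k2 = - (2 * c0 * (b0 - a0) * k2) by ring.
  by lra.
have := fracF_comparison n0 halpha hc0 cF slopeF cu u0A e1 x0l hle m0 hmin d0 d0 hB hl1 hl2.
rewrite -opprB lerN2 => h; apply: le_trans h.
have hb := ball_measure_le z d0.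
have E : (5 * d) `^ (- beta) * d `^ n%:R = 5 `^ (- beta) * d `^ (- alpha).
  rewrite powRM ?(ltW d0)// -mulrA -powRD ?(negbT (gt_eqF d0)) ?implybT//.
  by congr (_ * _ `^ _); ring.
have h5 : 0 <= (5 * d) `^ (- beta) by exact: powR_ge0.
rewrite -[l - dot x0 e]/d /m.
have -> : fracC n alpha * c0 * (2 / n.+1%:R) ^+ n * 5 `^ (- beta) * (u x0 - u (T x0)) * d `^ (- alpha)
   = fracC n alpha * (c0 * (u x0 - u (T x0)) * (5 * d) `^ (- beta) * ((2 / n.+1%:R) ^+ n * d `^ n%:R)).
  transitivity (fracC n alpha * c0 * (2 / n.+1%:R) ^+ n * (u x0 - u (T x0)) * ((5 * d) `^ (- beta) * d `^ n%:R)); last by ring.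
  by rewrite E; ring.
rewrite ler_pM2l//.
set mB := fine _ in hb *; set t := (_ * d `^ n%:R) in hb *.
have -> : 2 * c0 * (u x0 - u (T x0)) * (5 * d) `^ (- beta) * mB / 2 =
   c0 * (u x0 - u (T x0)) * (5 * d) `^ (- beta) * mB by field.
by rewrite ler_wpM2l// !mulr_ge0// ltW.
Qed.

End one_plane.

(** The gap and the equation bound [l1 - l2] from both sides by multiples of [u x0 - u (T x0)],
    which is positive and cancels. The constant is chosen before the plane, hence serves all
    directions and positions; [C3 + 1] avoids dividing by a vanishing [C3]. *)
Lemma negative_minimum_bound : exists2 ck : R, 0 < ck & forall (e : 'rV[R]_n) (l : R) x0,
  dot e e = 1 -> dot x0 e < l -> u (refl e l x0) < u x0 ->
  (forall y, dot y e <= l -> u (refl e l x0) - u x0 <= u (refl e l y) - u y) ->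
  ck * jap x0 `^ (alpha + delta) <= (l - dot x0 e) `^ alpha.
Proof.
have q0 : 0 < q by exact: lt_trans hq.
have r0 : 0 < r by exact: lt_trans hr.
pose c1 := fracC n alpha * c0 * (2 / n.+1%:R) ^+ n * 5 `^ (- beta).
have c10 : 0 < c1.
  rewrite /c1; apply: mulr_gt0; last by apply: powR_gt0; rewrite ltr0n.
  apply: mulr_gt0; last by apply: exprn_gt0; rewrite divr_gt0 ?ltr0n.
  by apply: mulr_gt0 => //; exact: fracC_gt0.
pose C3 := C2 * (q * K2 * A `^ r + r * K1 * A `^ (r - 1)).
have C30 : 0 <= C3.
  by rewrite /C3 mulr_ge0 ?(ltW C20)// addr_ge0// !mulr_ge0 ?powR_ge0 ?(ltW q0) ?(ltW r0).
have C31 : 0 < C3 + 1 by rewrite ltr_wpDl.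
exists (c1 / (C3 + 1)); first by rewrite divr_gt0.
move=> e l x0 e1 x0l hlt hmin.
have [l1 [hl1 eq1]] := equ x0; have [l2 [hl2 eq2]] := equ (refl e l x0).
have := fracF_gap e1 x0l (ltW hlt) hmin hl1 hl2.
have := refl_equation e1 x0l (ltW hlt) hmin eq1 eq2.
move=> h1 h2; have := le_trans h2 h1.
have := source_decay x0; rewrite -/c1.
have w0 : 0 < u x0 - u (refl e l x0) by rewrite subr_gt0.
set S := q * _ * _ + _.
move: w0; move: (u x0 - u (refl e l x0)) => w w0 hS h.
have d0 : 0 < l - dot x0 e by rewrite subr_gt0.
have da : 0 < (l - dot x0 e) `^ alpha by rewrite powR_gt0.
have ja : 0 < jap x0 `^ (alpha + delta) by rewrite powR_gt0// jap_gt0.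
move: h hS; rewrite !powRN.
move: ((l - dot x0 e) `^ alpha) (jap x0 `^ (alpha + delta)) da ja => D J D0 J0 h hS.
have h3 : c1 / D <= C2 * S.
  have h' : w * (c1 / D) <= w * (C2 * S).
    by rewrite mulrA [w * c1]mulrC; apply: le_trans h _; rewrite le_eqVlt; apply/orP; left; apply/eqP; ring.
  by rewrite -(ler_pM2l w0).
have h4 : c1 / D <= C3 / J.
  by apply: le_trans h3 _; rewrite /C3 -[leRHS]mulrA ler_pM2l.
rewrite ler_pdivrMr// in h4.
rewrite mulrAC ler_pdivrMr//.
have h5 : c1 * J <= C3 * D.
  by move: h4; rewrite mulrAC ler_pdivlMr.
by apply: le_trans h5 _; rewrite mulrC ler_pM2l// lerDl.
Qed.

(** Where [w x0 = 0], the equation gives [l1 <= l2]. If [w] were positive at some [y0], necessarily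
    different from [x0], a small ball about [y0] would serve as test ball and give [l2 < l1]. *)
Lemma strong_maximum (e : 'rV[R]_n) (l : R) x0 :
  dot e e = 1 -> dot x0 e < l -> (forall y, dot y e <= l -> u y <= u (refl e l y)) ->
  u (refl e l x0) = u x0 -> forall y, dot y e < l -> u (refl e l y) = u y.
Proof.
move=> e1 x0l hge heq y0 y0l; apply/eqP; apply: contrapT => /negP neq.
pose T := refl e l.
have beta0 : 0 < beta by rewrite ltr_pwDr.
have hmin y : dot y e <= l -> u (T x0) - u x0 <= u (T y) - u y.
  by move=> yl; rewrite /T heq subrr subr_ge0 hge.
have w0 : 0 < u (T y0) - u y0 by rewrite subr_gt0 lt_neqAle eq_sym neq hge// ltW.
have xy : 0 < enorm (x0 - y0).
  rewrite lt_neqAle enorm_ge0 andbT eq_sym; apply: contra_neq neq => /enorm_eq0/eqP.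
  by rewrite subr_eq0 => /eqP <-; rewrite heq.
have xTy : enorm (x0 - y0) < enorm (x0 - T y0).
  rewrite -(ltr_pXn2r (n := 2))// ?nnegrE ?enorm_ge0//.
  by rewrite enorm_refl_sqr// ltrDl !mulr_gt0// subr_gt0.
pose k y := enorm (x0 - y) `^ (- beta).
have k0 : 0 < k y0 - k (T y0) by rewrite subr_gt0; exact: lt_powRN.
(* Half of the values at [y0], so that by continuity both are strict lower bounds on a whole
   ball. *)
pose eta := (u (T y0) - u y0) / 2; pose kappa := (k y0 - k (T y0)) / 2.
have eta0 : 0 < eta by rewrite divr_gt0.
have kappa0 : 0 < kappa by rewrite divr_gt0.
have half (t : R) : 0 < t -> t / 2 < t by move=> t0; rewrite ltr_pdivrMr// ltr_pMr// ltr1n.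
have cT : continuous T by exact: continuous_refl.
have cuT : {for y0, continuous (fun y => u (T y) - u y)}.
  apply: continuousB; last exact: cu.
  by apply: (continuous_comp (f := T)); [exact: cT|exact: cu].
have ck1 : {for y0, continuous (fun y : 'rV[R]_n => enorm (x0 - y) `^ (- beta))}.
  apply: (continuous_comp (f := fun y : 'rV[R]_n => enorm (x0 - y)) (g := fun t : R => t `^ (- beta))).
    exact: continuous_enormB.
  exact: powR_continuous_pos.
have ck2 : {for y0, continuous (fun y : 'rV[R]_n => enorm (x0 - T y) `^ (- beta))}.
  apply: (continuous_comp (f := fun y : 'rV[R]_n => enorm (x0 - T y)) (g := fun t : R => t `^ (- beta))).
    by apply: (continuous_comp (f := T) (g := fun y : 'rV[R]_n => enorm (x0 - y))); [exact: cT|exact: continuous_enormB].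
  by apply: powR_continuous_pos; exact: lt_trans xTy.
have ck : {for y0, continuous (fun y => k y - k (T y))}.
  by apply: continuousB; [exact: ck1|exact: ck2].
have n1 : \forall y \near y0, eta < u (T y) - u y.
  by apply: (cvgr_gt _ cuT); exact: half.
have n2 : \forall y \near y0, kappa < k y - k (T y).
  by apply: (cvgr_gt _ ck); exact: half.
have n3 : \forall y \near y0, dot y e < l.
  by apply: (cvgr_lt _ (@continuous_dotl R n e y0)).
have n4 : \forall y \near y0, enorm (x0 - y0) / 2 < enorm (x0 - y).
  by apply: (cvgr_gt _ (@continuous_enormB R n x0 y0)); exact: half.
have [rho rho0 hrho] := nbhs_eball (filterI (filterI n1 n2) (filterI n3 n4)).
have [l1 [hl1 eq1]] := equ x0; have [l2 [hl2 eq2]] := equ (T x0).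
pose m := c0 * eta * kappa.
have m0 : 0 < m by rewrite !mulr_gt0.
have hB y : eball y0 rho y -> [/\ dot y e <= l, enorm (x0 - y0) / 2 <= enorm (x0 - y) &
    c0 * ((u (T x0) - u x0) - (u (T y) - u y)) *
      (enorm (x0 - y) `^ (- beta) - enorm (x0 - T y) `^ (- beta)) +
    2 * c0 * (u (T x0) - u x0) * enorm (x0 - T y) `^ (- beta) <= - m].
  move=> /hrho[[p1 p2] [p3 p4]]; split; [exact: ltW|exact: ltW|].
  rewrite {1 2}/T heq subrr mulr0 mul0r addr0 sub0r.
  have pm : c0 * eta * kappa <= c0 * (u (T y) - u y) * (k y - k (T y)).
    rewrite -[leLHS]mulrA -[leRHS]mulrA ler_pM2l//.
    by apply: ler_pM; [exact: ltW|exact: ltW|exact: ltW|exact: ltW].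
  by rewrite mulrN mulNr lerN2; exact: pm.
have hle : u (T x0) <= u x0 by rewrite /T heq.
have d0 : 0 < enorm (x0 - y0) / 2 by rewrite divr_gt0.
have h1 := fracF_comparison n0 halpha hc0 cF slopeF cu u0A e1 x0l hle (ltW m0) hmin rho0 d0 hB hl1 hl2.
have h2 := refl_equation e1 x0l hle hmin eq1 eq2.
have mB : 0 < fine (mu (eball y0 rho)).
  apply: lt_le_trans (ball_measure_le y0 rho0).
  by rewrite mulr_gt0 ?powR_gt0// exprn_gt0// divr_gt0.
have h3 : 0 < fracC n alpha * (m * fine (mu (eball y0 rho)) / 2).
  by apply: mulr_gt0; [exact: fracC_gt0|rewrite divr_gt0// mulr_gt0].
move: h2; rewrite heq subrr mulr0 mul0r subr_le0 -subr_ge0 => h2.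
by move: (le_trans h2 h1); rewrite oppr_ge0 leNgt h3.
Qed.

End moving_planes.

(** * Moving the plane, and radial symmetry *)

Section symmetry_from_planes.
Context (R : realType) (n : nat) (u : 'rV[R]_n -> R) (a dl ck : R).
Hypotheses (n0 : (0 < n)%N) (a0 : 0 < a) (dl0 : 0 < dl) (ck0 : 0 < ck).
Hypothesis cu : continuous u.
Hypothesis u0 : forall x, 0 < u x.
Hypothesis decay0 : forall eps, 0 < eps -> exists rho : R, forall x, rho <= enorm x -> u x < eps.
Hypothesis neg_bound : forall (e : 'rV[R]_n) (l : R) x0,
  dot e e = 1 -> dot x0 e < l -> u (refl e l x0) < u x0 ->
  (forall y, dot y e <= l -> u (refl e l x0) - u x0 <= u (refl e l y) - u y) ->
  ck * jap x0 `^ (a + dl) <= (l - dot x0 e) `^ a.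
Hypothesis strong_max : forall (e : 'rV[R]_n) (l : R) x0,
  dot e e = 1 -> dot x0 e < l -> (forall y, dot y e <= l -> u y <= u (refl e l y)) ->
  u (refl e l x0) = u x0 -> forall y, dot y e < l -> u (refl e l y) = u y.

Definition neg_min (e : 'rV[R]_n) l x0 := [/\ dot x0 e < l, u (refl e l x0) < u x0 &
  forall y, dot y e <= l -> u (refl e l x0) - u x0 <= u (refl e l y) - u y].

Definition good (e : 'rV[R]_n) l := forall x, dot x e <= l -> u x <= u (refl e l x).

(** Far out [u z < u y - u (T y)], and since [u (T z) > 0] the value of [w] there exceeds [w y]; so
    the infimum is attained in a compact set. The minimum is off the hyperplane because [w] vanishes
    on it. *)
Lemma not_good_neg_min e l : dot e e = 1 -> ~ good e l -> exists x0, neg_min e l x0.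
Proof.
move=> e1 /existsNP[y /not_implyP[yl /negP]]; rewrite -ltNge => hy.
pose w x := u (refl e l x) - u x.
have wy0 : 0 < u y - u (refl e l y) by rewrite subr_gt0.
have [rho hrho] := decay0 wy0.
pose K := [set x : 'rV[R]_n | enorm x <= Num.max rho (enorm y) /\ dot x e <= l].
have cK : compact K by apply: compact_enorm_le; exact: closed_halfspace.
have Ky : K y by split => //; rewrite le_max lexx orbT.
have cw : continuous w.
  move=> x; apply: continuousB; last exact: cu.
  by apply: (continuous_comp (f := refl e l)); [exact: continuous_refl|exact: cu].
have [c cin hc] := EVT_min_rV (ex_intro _ y Ky) cK (continuous_subspaceT cw).
have [cr cl] : K c by rewrite inE in cin.
have wy : w c <= w y by apply: hc; rewrite inE.
have wc : w c < 0 by apply: le_lt_trans wy _; rewrite subr_lt0.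
exists c; split.
- rewrite lt_neqAle cl andbT; apply/eqP => ce.
  by move: wc; rewrite /w refl_id// subrr ltxx.
- by rewrite -subr_lt0.
- move=> z zl; have [zr|zr] := leP (enorm z) (Num.max rho (enorm y)).
    by apply: hc; rewrite inE.
  apply: (@le_trans _ _ (w y)) => //.
  have uz : u z < u y - u (refl e l y).
    by apply: hrho; apply: le_trans (ltW zr); rewrite le_max lexx.
  by have := u0 (refl e l z); rewrite /w; move: uz; move: (u z) (u y) (u (refl e l y)) (u (refl e l z)); move=> *; lra.
Qed.

(** As [jap x0 >= 1], a strip along the hyperplane, of width independent of the plane, contains no
    negative minimum. *)
Lemma neg_min_dist : exists2 d0 : R, 0 < d0 &
  forall e l x0, dot e e = 1 -> neg_min e l x0 -> d0 <= l - dot x0 e.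
Proof.
exists (ck `^ a^-1); first exact: powR_gt0.
move=> e l x0 e1 [x0l hlt hmin].
have d0 : 0 < l - dot x0 e by rewrite subr_gt0.
have h : ck <= (l - dot x0 e) `^ a.
  apply: le_trans (neg_bound e1 x0l hlt hmin); rewrite ler_peMr ?(ltW ck0)//.
  have <- : jap x0 `^ 0 = 1 by rewrite powRr0.
  by apply: ler_powR; [exact: jap_ge1|rewrite addr_ge0// ltW].
have -> : l - dot x0 e = ((l - dot x0 e) `^ a) `^ a^-1.
  by rewrite -powRrM mulfV ?gt_eqF// powRr1// ltW.
by apply: ge0_ler_powR; rewrite ?nnegrE ?powR_ge0 ?invr_ge0 ?(ltW a0) ?(ltW ck0).
Qed.

(** Since [l - dot x0 e <= (1 + L) * jap x0], the powers [a] cancel and the surplus exponent [dl]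
    bounds [jap x0]. *)
Lemma neg_min_bounded L : 0 <= L -> exists rho : R,
  forall e l x0, dot e e = 1 -> l <= L -> neg_min e l x0 -> enorm x0 < rho.
Proof.
move=> L0; exists (((1 + L) `^ a / ck) `^ dl^-1) => e l x0 e1 lL [x0l hlt hmin].
have h := neg_bound e1 x0l hlt hmin.
have j0 := jap_gt0 x0.
have ne : enorm e = 1 by rewrite enormE e1 sqrtr1.
have hd : l - dot x0 e <= (1 + L) * jap x0.
  have := cauchy_schwarz (- x0) e; rewrite ne mulr1 enormN dotNl => h1.
  have := enorm_ge0 x0 => h2.
  have h3 : 0 <= L * enorm x0 by rewrite mulr_ge0.
  by rewrite /jap; move: h1 h2 h3 lL; move: (dot x0 e) (enorm x0); move=> *; lra.
have h' : ck * jap x0 `^ (a + dl) <= (1 + L) `^ a * jap x0 `^ a.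
  apply: le_trans h _; have L1 : 0 <= 1 + L by exact: addr_ge0.
  rewrite -(powRM _ L1 (ltW j0)).
  have p1 : 0 <= l - dot x0 e by rewrite subr_ge0 ltW.
  have p2 : 0 <= (1 + L) * jap x0 by apply: mulr_ge0 => //; exact: ltW.
  by apply: ge0_ler_powR; rewrite ?nnegrE ?(ltW a0).
have ja : 0 < jap x0 `^ a by exact: powR_gt0.
have hj : jap x0 `^ dl <= (1 + L) `^ a / ck.
  rewrite ler_pdivlMr// mulrC -(ler_pM2r ja) -mulrA -powRD.
    by rewrite [dl + a]addrC.
  by rewrite (negbT (gt_eqF j0)) implybT.
apply: (@lt_le_trans _ _ (jap x0)); first by rewrite /jap ltrDr.
have -> : jap x0 = (jap x0 `^ dl) `^ dl^-1.
  by rewrite -powRrM mulfV ?gt_eqF// powRr1// ltW.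
apply: ge0_ler_powR; rewrite ?nnegrE ?powR_ge0 ?invr_ge0 ?(ltW dl0)//.
by rewrite divr_ge0 ?powR_ge0// ltW.
Qed.

Section direction.
Variable e : 'rV[R]_n.
Hypothesis e1 : dot e e = 1.

Let ne : enorm e = 1. Proof. by rewrite enormE e1 sqrtr1. Qed.

(** A negative minimum would satisfy [dot x0 e < l <= - |rho|], hence lie outside the ball that has
    to contain it. *)
Lemma good_start : exists l1, forall l, l <= l1 -> good e l.
Proof.
have [rho hrho] := neg_min_bounded (lexx (0 : R)).
exists (- `|rho|) => l ll; apply: contrapT => /(not_good_neg_min e1)[x0 hx0].
have l0 : l <= 0 by apply: le_trans ll _; rewrite oppr_le0.
have h1 := hrho e l x0 e1 l0 hx0; have [h2 _ _] := hx0.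
have := cauchy_schwarz (- x0) e; rewrite ne mulr1 enormN dotNl => h3.
have h4 := ler_norm rho.
by move: h1 h2 h3 h4 ll; move: (dot x0 e) (enorm x0) `|rho|; move=> *; lra.
Qed.

(** For large [l] the origin is reflected to distance [2 l], where [u] is already below [u 0]. *)
Lemma good_bounded : exists l2, forall l, good e l -> l <= l2.
Proof.
have [rho hrho] := decay0 (u0 0).
exists `|rho| => l gl; rewrite leNgt; apply/negP => hl.
have l0 : 0 < l by apply: le_lt_trans hl.
have d0 : dot 0 e = 0 by rewrite -(scale0r (0 : 'rV[R]_n)) dotZl mul0r.
have := gl 0; rewrite d0 => /(_ (ltW l0)); rewrite leNgt => /negP; apply.
apply: hrho; have := refl_subE e l 0; rewrite subr0 d0 subr0 => ->.
rewrite enormZ ne mulr1 gtr0_norm ?mulr_gt0//.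
have := ler_norm rho; move: hl l0; move: `|rho|; move=> *; lra.
Qed.

(** Requiring all earlier positions makes every [l] below the supremum good, not merely some values
    close to it. *)
Definition good_below l := forall m, m <= l -> good e m.

Let S : set R := [set l | good_below l].

Let supS : has_sup S.
Proof.
have [l1 h1] := good_start; have [l2 h2] := good_bounded.
split; first by exists l1 => m ml; exact: h1.
by exists l2 => l /(_ l (lexx l)); exact: h2.
Qed.

Let l0 := sup S.

Lemma refl_near (l : R) x c : u (refl e l x) < c ->
  \forall m \near l, u (refl e m x) < c.
Proof.
move=> h; have cl : {for l, continuous (fun m => u (refl e m x))}.
  apply: (continuous_comp (f := fun m => (m, x)) (g := fun p => u (refl e p.1 p.2))).
    exact: (@cvg_pair _ _ _ (nbhs l) (nbhs l) (nbhs x) _ _ _ id (cst x) cvg_id (cvg_cst x)).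
  apply: (continuous_comp (f := fun p => refl e p.1 p.2)); last exact: cu.
  exact: continuous_refl_pair.
exact: (cvgr_lt _ cl).
Qed.


(** A strict failure at the last position would, by continuity in the position, occur at slightly
    smaller ones too. *)
Lemma good_sup : good_below l0.
Proof.
have glt m : m < l0 -> good e m.
  by move=> /(sup_gt supS.1)[t St mt]; apply: St; exact: ltW.
move=> m; rewrite le_eqVlt => /predU1P[->|]; last exact: glt.
move=> x; rewrite le_eqVlt => /predU1P[xl|xl]; first by rewrite refl_id.
rewrite leNgt; apply/negP => /refl_near h1.
have h2 : \forall m \near l0, dot x e < m.
  by apply: open_nbhs_nbhs; split; [exact: open_gt|].
have : \forall m \near l0, u (refl e m x) < u x /\ dot x e < m by exact: filterI h1 h2.
move=> /nbhs_ballP[d /= d0 hd].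
have [] := hd (l0 - d / 2).
  by rewrite /ball /= opprB addrC subrK gtr0_norm ?divr_gt0// ltr_pdivrMr// ltr_pMr// ltr1n.
move=> h3 h4.
have := glt (l0 - d / 2) _ x (ltW h4); rewrite leNgt h3 => /(_ _)/negP; apply => //.
by rewrite gtrBl divr_gt0.
Qed.

(** Otherwise [w > 0] on the open half space by the strong maximum principle. Negative minima for
    slightly larger [m] are confined to one compact set off the plane, on which positivity persists,
    so the plane could move further. *)
Lemma symmetric_sup x : u (refl e l0 x) = u x.
Proof.
suff half y : dot y e < l0 -> u (refl e l0 y) = u y.
  have [xl|xl|xl] := ltgtP (dot x e) l0; [exact: half| |by rewrite refl_id].
  have hT : dot (refl e l0 x) e < l0 by rewrite dot_refl//; move: xl; move: (dot x e) => *; lra.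
  by have := half _ hT; rewrite (reflK l0 e1) => ->.
apply: contrapT => nsym.
have pos z : dot z e < l0 -> u z < u (refl e l0 z).
  move=> zl; rewrite lt_neqAle good_sup// ?andbT; last exact: ltW.
  apply/eqP => zz; apply: nsym => yl.
  exact: (strong_max e1 zl (good_sup (lexx _)) (esym zz)).
have [d0 d00 hd0] := neg_min_dist.
have L0 : 0 <= `|l0| + 1 by rewrite addr_ge0.
have [rho hrho] := neg_min_bounded L0.
(* A minimum at distance at least [d0] from a plane advanced by at most [d0 / 2] is still at
   distance [d0 / 2] from the plane at [l0]. *)
pose K := [set x : 'rV[R]_n | enorm x <= rho /\ dot x e <= l0 - d0 / 2].
have cK : compact K by apply: compact_enorm_le; exact: closed_halfspace.
have cov := (compact_near_coveringP K).1 cK.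
have : \forall m \near l0, K `<=` (fun z => u z < u (refl e m z)).
  apply: (cov _ (nbhs l0) (fun m z => u z < u (refl e m z))) => z [_ zl].
  have zl0 : dot z e < l0 by apply: le_lt_trans zl _; rewrite gtrBl divr_gt0.
  have cw : {for (z, l0), continuous (fun p : 'rV[R]_n * R => u (refl e p.2 p.1) - u p.1)}.
    apply: continuousB; last first.
      by apply: (continuous_comp (f := fst)); [exact: cvg_fst|exact: cu].
    apply: (continuous_comp (f := fun p : 'rV[R]_n * R => (p.2, p.1))
       (g := fun p => u (refl e p.1 p.2))).
      exact: (@cvg_pair _ _ _ (nbhs (z, l0)) (nbhs l0) (nbhs z) _ _ _ snd fst cvg_snd cvg_fst).
    apply: (continuous_comp (f := fun p => refl e p.1 p.2)); last exact: cu.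
    exact: continuous_refl_pair.
  have pos0 : 0 < u (refl e l0 z) - u z by rewrite subr_gt0; exact: pos.
  have := @cvgr_gt _ _ (nbhs (z, l0)) (nbhs_filter (z, l0)) _ _ cw 0 pos0.
  by apply: filterS => p /=; rewrite subr_gt0.
move=> /nbhs_ballP[d /= dd0 hd].
have [eps [eps0 e2 e3 e4]] : exists eps, [/\ 0 < eps, eps <= d / 2, eps <= d0 / 2 & eps <= 1].
  exists (Num.min (d / 2) (Num.min (d0 / 2) 1)).
  by split; rewrite ?lt_min ?ge_min ?lexx ?orbT// !divr_gt0//= ltr01.
have : S (l0 + eps).
  move=> m ml; have [ml0|ml0] := leP m l0; first exact: good_sup.
  apply: contrapT => /(not_good_neg_min e1)[x0 hx0].
  have mL : m <= `|l0| + 1.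
    by have := ler_norm l0; move: ml e4; move: `|l0| => *; lra.
  have r1 := hrho e m x0 e1 mL hx0; have r2 := hd0 e m x0 e1 hx0.
  have Kx : K x0.
    split; first exact: ltW.
    by move: r2 ml e3; move: (dot x0 e) => *; lra.
  have mb : ball l0 d m.
    rewrite /ball /= distrC gtr0_norm ?subr_gt0//.
    by move: ml e2 dd0; lra.
  by have := hd m mb x0 Kx; have [_ h _] := hx0; rewrite ltNge (ltW h).
by move=> /(ub_le_sup supS.2); rewrite -/l0 leNgt ltrDl eps0.
Qed.

(** Equality somewhere would make [u] symmetric about two parallel hyperplanes, hence periodic with
    period [2 (l0 - l)] along [e], against decay at infinity. *)
Lemma strict_below l x : l < l0 -> dot x e < l -> u x < u (refl e l x).
Proof.
move=> ll xl; have gl := good_sup (ltW ll).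
rewrite lt_neqAle gl ?(ltW xl)// andbT; apply/eqP => heq.
have half := strong_max e1 xl gl (esym heq).
have sym y : u (refl e l y) = u y.
  have [yl|yl|yl] := ltgtP (dot y e) l; [exact: half| |by rewrite refl_id].
  have hT : dot (refl e l y) e < l by rewrite dot_refl//; move: yl; move: (dot y e) => *; lra.
  by have := half _ hT; rewrite (reflK l e1) => ->.
pose p := (2 * (l0 - l)) *: e.
have tr y : u (y + p) = u y.
  have E : refl e l0 (refl e l y) = y + p.
    have h1 := refl_subE e l0 (refl e l y); rewrite dot_refl// in h1.
    have h2 := refl_subE e l y.
    rewrite -[LHS](subrK (refl e l y)) -[X in _ + X](subrK y) h1 h2 addrA addrC; congr (_ + _).
    by rewrite -scalerDl /p; congr (_ *: _); ring.
  by rewrite -E symmetric_sup sym.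
have trk k y : u (y + k%:R *: p) = u y.
  elim: k => [|k IH]; first by rewrite scale0r addr0.
  by rewrite -natr1 scalerDl scale1r addrA tr.
have [rho hrho] := decay0 (u0 0).
have c0 : 0 < 2 * (l0 - l) by rewrite mulr_gt0// subr_gt0.
pose k := Num.bound (rho / (2 * (l0 - l))).
have hk : rho <= k%:R * (2 * (l0 - l)).
  rewrite -ler_pdivrMr//; apply: le_trans (ler_norm _) _.
  by rewrite /k; have := archi_boundP (normr_ge0 (rho / (2 * (l0 - l)))); rewrite /Num.bound normr_id => /ltW.
have := hrho (0 + k%:R *: p); rewrite trk ltxx => h.
suff : false by []. apply: h.
by rewrite add0r /p scalerA enormZ ne mulr1 ger0_norm// mulr_ge0// ltW.
Qed.

End direction.

Lemma planes_radial : exists x0 : 'rV[R]_n, radially_decreasing u x0.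
Proof.
have dir (e : 'rV[R]_n) : exists l0 : R, dot e e = 1 ->
    (forall x, u (refl e l0 x) = u x) /\
    (forall l x, l < l0 -> dot x e < l -> u x < u (refl e l x)).
  exists (sup [set l | good_below e l]) => e1; split => [x|l x].
    exact: symmetric_sup.
  exact: strict_below.
have [M hM] : exists M, forall x, u x <= u M.
  have [rho hrho] := decay0 (u0 0).
  have cK := @compact_enorm_le R n `|rho| setT closedT.
  have ne : [set x : 'rV[R]_n | enorm x <= `|rho| /\ setT x] !=set0.
    by exists 0; split => //=; rewrite enorm0.
  have [M _ hx] := EVT_max_rV ne cK (continuous_subspaceT cu).
  exists M => x; have [xr|xr] := leP (enorm x) `|rho|; first by apply: hx; rewrite inE.
  apply: (@le_trans _ _ (u 0)); last by apply: hx; rewrite inE /= enorm0; split.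
  by apply: ltW; apply: hrho; apply: le_trans (ler_norm _) (ltW xr).
have planes (e : 'rV[R]_n) : dot e e = 1 ->
    (forall x, u (refl e (dot M e) x) = u x) /\
    (forall l x, l < dot M e -> dot x e < l -> u x < u (refl e l x)).
  move=> e1; have [l0 /(_ e1)[h1 h2]] := dir e.
  (* The plane midway between [y] and the last position sends [y] to a point of strictly larger
     value. *)
  have nlt y : dot y e < l0 -> u y < u M.
    move=> yl; apply: lt_le_trans (h2 ((dot y e + l0) / 2) y _ _) (hM _);
      by move: yl; move: (dot y e) => *; lra.
  suff -> : dot M e = l0 by [].
  have [Ml|Ml|//] := ltgtP (dot M e) l0.
    by have := nlt M Ml; rewrite ltxx.
  have := nlt (refl e l0 M); rewrite h1 ltxx dot_refl// => h.
  suff : false by []. apply: h.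
  by move: Ml; move: (dot M e) => *; lra.
have [e1 he1] : exists e1 : 'rV[R]_n, dot e1 e1 = 1.
  by exists (delta_mx ord0 (Ordinal n0)); exact: dot_delta.
have ne1 : enorm e1 = 1 by rewrite enormE he1 sqrtr1.
exists M, (fun t => u (M + t *: e1)); split => [x|t1 t2 t10 t12].
  (* The profile is read along the ray from [M] in the direction [e1]. Two distinct points at equal
     distance from [M] are exchanged by the reflection whose hyperplane passes through [M]
     orthogonally to their difference. *)
  set y := M + _; have [->//|xy] := eqVneq x y.
  pose N := enorm (x - y).
  have N0 : N != 0 by apply: contra_neq xy => /enorm_eq0/eqP; rewrite subr_eq0 => /eqP.
  pose e := N^-1 *: (x - y).
  have NN : N ^+ 2 = dot (x - y) (x - y) by exact: enorm_sqr.
  have ee : dot e e = 1 by rewrite /e dotZl dotZr -NN; field.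
  have [h _] := planes e ee; rewrite -[LHS](h x); congr (u _).
  have yM : enorm (y - M) = enorm (x - M).
    by rewrite /y addrC addKr enormZ ne1 mulr1 ger0_norm// enorm_ge0.
  have E3 : x - y = (x - M) - (y - M) by rewrite opprB addrA subrK.
  have E4 : dot (y - M) (y - M) = dot (x - M) (x - M) by rewrite -!enorm_sqr yM.
  have E1 := refl_subE e (dot M e) x.
  have E2 : dot M e - dot x e = - dot (x - M) e by rewrite dotBl opprB.
  have E5 : 2 * dot (x - M) (x - y) = N ^+ 2.
    rewrite NN E3; move: (x - M) (y - M) E4 => p p' E4.
    by rewrite dotBl !dotBr (dotC p' p) E4; ring.
  have E6 : (2 * - dot (x - M) e) *: e = - (x - y).
    rewrite /e dotZr scalerA (_ : _ * _ = - 1) ?scaleN1r//.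
    transitivity (- (2 * dot (x - M) (x - y)) * N^-1 * N^-1); first by ring.
    by rewrite E5; field.
  by move: E1; rewrite E2 E6 opprB => /eqP; rewrite subr_eq subrK => /eqP.
(* In the direction [- e1], the plane midway between the radii [t1] and [t2] has not yet reached [M]
   and maps the point at radius [t2] to the one at radius [t1]; strict growth across it gives strict
   decrease of the profile. *)
have ee : dot (- e1) (- e1) = 1 by rewrite dotNl dotC dotNl opprK.
have [_ h] := planes _ ee.
have dM : dot M (- e1) = - dot M e1 by rewrite dotC dotNl dotC.
have dx : dot (M + t2 *: e1) (- e1) = - dot M e1 - t2.
  by rewrite dotDl dM dotZl [dot e1 _]dotC dotNl he1 mulrN1.
have h1 : - dot M e1 - (t1 + t2) / 2 < dot M (- e1).
  by rewrite dM; move: t10 t12; move=> *; lra.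
have h2 : dot (M + t2 *: e1) (- e1) < - dot M e1 - (t1 + t2) / 2.
  by rewrite dx; move: t10 t12; move=> *; lra.
have := h _ _ h1 h2; congr (_ < u _).
have := refl_subE (- e1) (- dot M e1 - (t1 + t2) / 2) (M + t2 *: e1).
rewrite dx => /eqP; rewrite subr_eq => /eqP ->.
by apply/rowP => i; rewrite !mxE; field.
Qed.

End symmetry_from_planes.

(** * From the conditions on [gamma] to the estimates behind the moving planes *)

Theorem theorem1p1 (R : realType) (n : nat) (alpha s omega r q gamma c0 : R)
    (F : R -> R) (u : 'rV[R]_n -> R)
    (hn : (1 <= n)%N) (halpha : 0 < alpha < 2) (hs : 0 < s < 1)
    (homega : 0 <= omega) (hr : 1 < r) (hq : 1 < q)
    (hFlip : locally_lipschitz F) (hF0 : F 0 = 0) (hc0 : 0 < c0)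
    (hF' : {ae lebesgue_measure, forall t : R,
              derivable F t 1 /\ c0 <= F^`()%classic t})
    (hu : C11_loc u) (huL : calL alpha F u)
    (hsol : positive_solution alpha s omega r q F u)
    (hdecay : sim_at_infinity u gamma)
    (hgamma_lt : gamma < n%:R / q)
    (hgamma_gt : Num.max (alpha / r)
        (Num.max (2 * s / (q - 1)) ((2 * s + alpha) / (r - 1 + q))) < gamma) :
  exists x0 : 'rV[R]_n, radially_decreasing u x0.
Proof.
have u0 x : 0 < u x by case: (hsol x).
have cu : continuous u.
  by case: hu => du _ _ x; exact: differentiable_continuous (du x).
have cF : continuous F.
  exact: locally_lipschitz_continuous.
have slopeF := slope_ge hFlip hF'.
have [/andP[alpha0 _] /andP[s0 s1]] := (halpha, hs).
move: hgamma_gt; rewrite !gt_max => /and3P[g1 g2 g3].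
have q0 : 0 < q by exact: lt_trans hq.
have q10 : 0 < q - 1 by rewrite subr_gt0.
have qr0 : 0 < r - 1 + q by rewrite addr_gt0// subr_gt0.
have gamma0 : 0 < gamma by apply: lt_trans g1; rewrite divr_gt0// (lt_trans _ hr).
rewrite ltr_pdivrMr// in g2; rewrite ltr_pdivrMr// in g3; rewrite ltr_pdivlMr// in hgamma_lt.
pose s2 := 2 * s.
have s20 : 0 < s2 by rewrite mulr_gt0.
have sq1 : s2 < (q - 1) * gamma by rewrite mulrC.
have q1g : (q - 1) * gamma < q * gamma by rewrite ltr_pM2r// gtrBl.
have qn : q * gamma < n%:R by rewrite mulrC.
have hg : s2 + alpha < (q + r - 1) * gamma.
  by apply: lt_le_trans g3 _; rewrite le_eqVlt; apply/orP; left; apply/eqP; ring.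
(* The kernel is genuinely singular: [2 s < (q - 1) gamma < q gamma < n]. *)
have sn : s2 < n%:R by exact: lt_trans sq1 (lt_trans q1g qn).
have [A A0 uA] := decay_bound cu u0 gamma0 hdecay.
have [K1 K10 pot1] := potential_le hn cu u0 A0 uA q0 s20 (lt_trans sq1 q1g) qn.
have [K2 K20 pot2] := potential_le hn cu u0 A0 uA q10 s20 sq1 (lt_trans q1g qn).
have C20 : 0 < fracC n s2.
  by apply: fracC_gt0; rewrite s20 /s2 -[ltRHS]mulr1 ltr_pM2l.
have equ x : exists lx, is_fracF alpha F u x lx /\
    lx + omega * u x = fracC n s2 * fine (potential u s2 q x) * u x `^ r.
  have [_ [lx [hlx eqx]]] := hsol x; exists lx; split => //.
  have Er : riesz_potential s q u x = potential u s2 q x.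
    apply: eq_integral => y _; congr (_ %:E).
    by rewrite -powRN opprB.
  (* Finiteness from the decay estimate turns the equation between extended reals into one between
     reals. *)
  have fx : potential u s2 q x \is a fin_num.
    by rewrite ge0_fin_numE ?potential_ge0//; exact: le_lt_trans (pot1 x) (ltry _).
  by move: eqx; rewrite Er -(fineK fx) -!EFinM => -[].
have [ck ck0 hck] := negative_minimum_bound hn halpha hc0 homega hr hq sn A0 C20
  K10 K20 cF slopeF cu u0 gamma0 uA pot1 pot2 equ.
have dl0 : 0 < (q + r - 1) * gamma - s2 - alpha by rewrite -addrA -opprD subr_gt0.
apply: (planes_radial hn alpha0 dl0 ck0 cu u0) hck _.
  exact: (decay_to0 gamma0 A0 uA).
move=> e l x0 e1 w0 wx0 x0H y.
exact: (strong_maximum hn halpha hc0 homega hr hq sn A0 C20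
  cF slopeF cu u0 gamma0 uA pot1 pot2 equ e1 w0 wx0 x0H).
Qed.
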